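(* Let $\nu>0$, $\tau>0$, $f\in L^\infty(\mathbb T)$, and let $(u^n)_{n\ge0}$ be the solution of $$\frac{u^{n+1}-u^n}{\tau}+\Pi_N(u^n\partial_xu^n)=\nu^2\partial_{xx}u^{n+1}\ \text{ on }\mathbb T,\quad n\ge0,\qquad u^0=\Pi_Nf.$$ Then there is $\tau_0=\tau_0(\nu,\|f\|_\infty)>0$ such that for all $0<\tau<\tau_0$ and $N\ge2$, $$\sup_{n\ge0}\|u^n\|_\infty\le\|u^0\|_\infty+\alpha_1\cdot N^{-\frac12}+\alpha_2\,\tau^{0.49},$$ where $\alpha_1,\alpha_2>0$ depend only on $(\|f\|_\infty,\nu)$.
   Context: $\mathbb T=\mathbb R/\mathbb Z$; functions are real-valued; $\Pi_Nf(x)=\sum_{|k|\le N}\widehat f(k)e^{2\pi ikx}$ with $\widehat f(k)=\int_0^1f(x)e^{-2\pi ikx}dx$; $\|\cdot\|_\infty$ is the $L^\infty(\mathbb T)$ norm. *)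

(* Defs.v *)
From HB Require Import structures.
From mathcomp Require Import all_boot all_order all_algebra.
From mathcomp Require Import all_classical all_reals all_analysis.
From mathcomp Require Import complex.
Import Order.TTheory GRing.Theory Num.Theory.
Import numFieldNormedType.Exports.

Set Implicit Arguments.
Unset Strict Implicit.
Unset Printing Implicit Defensive.

Local Open Scope classical_set_scope.
Local Open Scope ring_scope.
Local Open Scope complex_scope.

(* Functions on the torus R/Z are represented by 1-periodic functions on R;
   the Lebesgue measure of the torus is that of the fundamental domain [0, 1]. *)
Definition torus_measure (R : realType) :
    {measure set (measurableTypeR R) -> \bar R} :=
  mrestr (@lebesgue_measure R) (measurable_itv `[0%R, 1%R]).

Definition in_Linfty (R : realType) (f : R -> R) : Prop :=
  periodic f 1 /\ f \in Lfun (torus_measure R) +oo%E.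

Definition Linfty_norm (R : realType) (f : R -> R) : \bar R :=
  'N[torus_measure R]_+oo[EFin \o f].

(* e^(i t) *)
Definition expi (R : realType) (t : R) : R[i] := cos t +i* sin t.

Definition integral01 (R : realType) (g : R -> R[i]) : R[i] :=
  let mu := @lebesgue_measure R in
  (\int[mu]_(x in `[0%R, 1%R]) complex.Re (g x)) +i*
  (\int[mu]_(x in `[0%R, 1%R]) complex.Im (g x)).

Definition fourier_coef (R : realType) (f : R -> R) (k : int) : R[i] :=
  integral01 (fun x => (f x)%:C * expi (- (2 * pi * k%:~R * x))).

(* The frequencies |k| <= N are enumerated as k = j - N with 0 <= j <= 2N. *)
Definition Pi_N (R : realType) (N : nat) (f : R -> R) (x : R) : R[i] :=
  \sum_(j < N.*2.+1) let k := j%:Z - N%:Z in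
    fourier_coef f k * expi (2 * pi * k%:~R * x).

(* Although Pi_N f is real for a real function f, the equations are written in
   the complex numbers, where Pi_N takes its values. *)
Definition scheme_solution (R : realType) (nu tau : R) (N : nat) (f : R -> R)
    (u : nat -> R -> R) : Prop :=
  [/\ forall n, periodic (u n) 1,
      forall n x, derivable (u n) x 1 /\ derivable (derive1 (u n)) x 1,
      forall x, (u 0%N x)%:C = Pi_N N f x
    & forall n x,
        ((u n.+1 x - u n x) / tau)%:C
          + Pi_N N (fun y => u n y * derive1 (u n) y) x
        = (nu ^+ 2 * derive1n 2 (u n.+1) x)%:C].

(* Main.v *)
(* The scheme is [u_(n+1) = (1 - tau nu^2 d^2)^-1 (u_n - tau Pi_N (u_n u_n'))]. By
   the maximum principle the resolvent contracts the sup norm, and [u - tau u u'] is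
   the value of [u] at [x - tau u(x)] up to [tau^2 |u|^2 |u''|], so a step raises the
   sup norm by at most [tau^2 |u_n|^2 |u_n''| + tau |(1 - Pi_N)(u_n u_n')|], up to
   constants. As long as the sup norms stay below [B] with [tau B^2 <= nu^2 / 2], the
   energy estimate and parabolic smoothing bound [|u_n''|] by [C (n tau)^(-3/2)], so
   that the first terms add up to [O (B^2 tau^(1/2))]. Only frequencies above [N/2] of
   [u_n] contribute to [(1 - Pi_N)(u_n u_n')]; hence the second terms add up to
   [O (N^(-3/2) t1^(-1/2))] for times beyond [t1], up to logarithms, while an
   interpolation bound for [u_n'] serves before [t1 = N^(-15/8)]. A bootstrap closes
   because these errors are small. *)
Require Import Defs.
From mathcomp Require Import all_boot all_order all_algebra.
From mathcomp Require Import all_classical all_reals all_analysis.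
From mathcomp Require Import complex ess_sup_inf measurable_realfun.
From mathcomp Require Import ring lra zify.
Import Order.TTheory GRing.Theory Num.Theory.
Import numFieldNormedType.Exports.
Import Normc.

Set Implicit Arguments.
Unset Strict Implicit.
Unset Printing Implicit Defensive.

Local Open Scope classical_set_scope.
Local Open Scope ring_scope.
Local Open Scope complex_scope.

Local Notation Re := (@complex.Re _).
Local Notation Im := (@complex.Im _).

(** * Sequences *)

(** The constant 1 in front of the initial norm forces every step to be additive in the sup norm: a
    factor above 1 per step would be lost over infinitely many steps. The obstacle is the datum.
    [Pi_N] is not bounded on L^infinity uniformly in [N], so [u 0] may be of size log N, while the
    smallness of [tau] must not depend on [N]. Logarithms are therefore given away as small powers
    N^eps and tau^(-eps), and this loss separates 0.49 from 1/2. Each order of smoothing uses up one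
    step, so the energy of order 3 is available from the third iterate on; the first three steps are
    estimated apart, through the divergence form of the nonlinearity. The estimates are carried out
    on polynomials in e(x), where finite Fourier sums over equispaced points replace integrals.
    Measure theory enters through the essential sup norm and through the replacement of [f] by a
    trigonometric polynomial that has the same projection and is bounded by twice the norm of
    [f]. *)

Section RealSequences.
Variable R : realType.
Implicit Types (a b d y z : nat -> R).

Lemma prod_1D_ge1 a n : (forall j, 0 <= a j) -> 1 <= \prod_(j < n) (1 + a j).
Proof.
move=> a0; elim: n => [|n ih]; first by rewrite big_ord0.
by rewrite big_ord_recr /= -[leLHS]mulr1 ler_pM ?ler01 // lerDl.
Qed.

(** Discrete Gronwall inequality that keeps the accumulated dissipation [d] on the left: this sum is
    the input for the next order of smoothing. *)
Lemma gronwall y d a b n m :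
  (forall j, 0 <= y j) -> (forall j, 0 <= d j) -> (forall j, 0 <= a j) ->
  (forall j, 0 <= b j) ->
  (forall j, (j < n)%N -> y j.+1 + d j.+1 <= (1 + a j) * y j + b j) ->
  (m <= n)%N ->
  y m + \sum_(j < m) d j.+1
    <= \prod_(j < m) (1 + a j) * (y 0%N + \sum_(j < m) b j).
Proof.
move=> y0 d0 a0 b0 rec; elim: m => [|m ih] mn.
  by rewrite !big_ord0 mul1r.
have {}ih := ih (ltnW mn).
rewrite !big_ord_recr /=.
have := rec m mn.
set P := \prod_(j < m) _ in ih *; set S := \sum_(j < m) _ in ih *.
set Q := \sum_(j < m) _ in ih *.
have S0 : 0 <= S by apply: sumr_ge0 => i _; exact: d0.
have P1 : 1 <= P by exact: prod_1D_ge1.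
have := a0 m; have := b0 m; have := y0 m; have := d0 m.+1.
move: (a m) (b m) (y m) (y m.+1) (d m.+1) ih => am bm ym ym' dm ih ? ? ? ? h.
have h1 : ym' + (S + dm) <= (1 + am) * (ym + S) + bm.
  have : 0 <= am * S by apply: mulr_ge0.
  lra.
apply: le_trans h1 _.
have h2 : (1 + am) * (ym + S) <= (1 + am) * (P * (y 0%N + Q)).
  by apply: ler_wpM2l => //; lra.
have h3 : bm <= P * (1 + am) * bm.
  rewrite -[leLHS]mul1r ler_wpM2r // -[1]mulr1 ler_pM //; lra.
have -> : P * (1 + am) * (y 0%N + (Q + bm)) =
  (1 + am) * (P * (y 0%N + Q)) + P * (1 + am) * bm by ring.
exact: lerD.
Qed.

Lemma prod_1D_expR a n (K : R) : (forall j, 0 <= a j) ->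
  \sum_(j < n) a j <= K -> \prod_(j < n) (1 + a j) <= expR K.
Proof.
move=> a0 aK; apply: (@le_trans _ _ (expR (\sum_(j < n) a j))); last first.
  by rewrite ler_expR.
rewrite expR_sum; apply: ler_prod => j _.
by rewrite addr_ge0 ?ler01 //= expR_ge1Dx.
Qed.

(** In the binomial expansion of (n+1)^(s+1) each power below the top one is at most n^s, and the
    remaining binomial coefficients add up to 2^(s+1) - 1. *)
Lemma natpow_step n s : (0 < n)%N ->
  (n.+1%:R : R) ^+ s.+1 <= n%:R ^+ s.+1 + (2 ^+ s.+1 - 1) * n%:R ^+ s.
Proof.
move=> n0; have n1 : (1 : R) <= n%:R by rewrite ler1n.
elim: s => [|s ih]; first by rewrite !expr1 expr0 -natr1; lra.
have p0 : (0 : R) <= n%:R ^+ s by rewrite exprn_ge0 // ler0n.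
have c0 : (1 : R) <= 2 ^+ s by rewrite exprn_ege1 // ler1n.
rewrite exprS (le_trans (ler_wpM2l _ ih)) ?ler0n // -natr1.
move: (n%:R : R) n1 p0 c0 => x x1.
rewrite !exprS; move: (x ^+ s) (2 ^+ s) => y c y0 c1.
have -> : (x + 1) * (x * y + (2 * c - 1) * y) = x * (x * y) + x * y +
  (2 * c - 1) * (x * y) + (2 * c - 1) * y by ring.
have : (2 * c - 1) * y <= (2 * c - 1) * (x * y).
  rewrite ler_wpM2l //; first lra.
  by rewrite -[leLHS]mul1r ler_wpM2r.
lra.
Qed.

Lemma time_step (tau : R) n s : 0 < tau -> (0 < n)%N ->
  (n.+1%:R * tau) ^+ s.+1 <=
  (n%:R * tau) ^+ s.+1 + 2 ^+ s.+1 * (tau * (n%:R * tau) ^+ s).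
Proof.
move=> t0 n0; rewrite !exprMn.
have ts : 0 <= tau ^+ s.+1 by rewrite exprn_ge0 // ltW.
have := ler_wpM2r ts (natpow_step s n0) => /le_trans; apply.
rewrite mulrDl lerD2l.
have -> : 2 ^+ s.+1 * (tau * (n%:R ^+ s * tau ^+ s)) =
  2 ^+ s.+1 * n%:R ^+ s * tau ^+ s.+1 by rewrite [tau ^+ s.+1]exprS; ring.
rewrite ler_wpM2r // ler_wpM2r ?exprn_ge0 ?ler0n //; lra.
Qed.

Lemma sum_shift_le a s m : (forall j, 0 <= a j) ->
  \sum_(i < m) a (s + i).+1 <= \sum_(j < s + m) a j.+1.
Proof.
by move=> a0; rewrite big_split_ord /= lerDr sumr_ge0.
Qed.

(* The energies [A s n] of order [s] gain the factor [(n tau)^-s]; the sums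
   [tau (j tau)^s A s.+1 j] produced by the dissipation of one order feed the
   Gronwall inequality of the next. *)
Section Smoothing.
Variables (nu K : R) (C : nat -> R).
Hypotheses (nu0 : 0 < nu) (K0 : 0 <= K) (C0 : forall s, 0 <= C s).

(** The bounded sum starts at iterate 1, because the order-1 energy of the initial datum is not
    controlled uniformly in [N]. Accordingly the recursion is asked for at [0 < j], where its
    factors have a bounded product. *)
Definition energy_decay (tau : R) (A : nat -> nat -> R) (n : nat) :=
  [/\ 0 < tau, forall s j, 0 <= A s j,
      forall m, (m <= n)%N -> \sum_(j < m) tau * A 1%N j.+1 <= K
    & forall s j, (0 < s)%N -> (0 < j)%N -> (j < n)%N ->
        A s j.+1 + tau * nu ^+ 2 * A s.+1 j.+1
          <= (1 + C s * (tau * A 1%N j)) * A s j].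

(** Multiply the recursion of order [s.+1] by the weight t^(s+1). The growth of the weight over one
    step, of order tau t^s, produces exactly the terms whose sum is bounded by [Z]; Gronwall then
    bounds both the weighted energy and the dissipation one order higher. *)
Lemma smoothing_step s Z : 0 <= Z ->
  (forall tau A n, energy_decay tau A n -> forall m, (s + m <= n)%N ->
     \sum_(i < m) tau * ((s + i).+1%:R * tau) ^+ s * A s.+1 (s + i).+1 <= Z) ->
  exists2 B, 0 <= B &
  forall tau A n, energy_decay tau A n ->
    (forall m, (s < m)%N -> (m <= n)%N -> (m%:R * tau) ^+ s.+1 * A s.+1 m <= B)
    /\ (forall m, (s.+1 + m <= n)%N ->
     \sum_(i < m) tau * ((s.+1 + i).+1%:R * tau) ^+ s.+1
         * A s.+2 (s.+1 + i).+1 <= B).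
Proof.
move=> Z0 hZ.
(* The power of 2 comes from [time_step]; [1 + C s.+1 * K] bounds the factor [1 + a i] of a single
   step. *)
pose b0 := 2 ^+ s.+1 * (1 + C s.+1 * K).
have b00 : 0 <= b0.
  by rewrite mulr_ge0 ?exprn_ge0 // addr_ge0 ?ler01 // mulr_ge0.
pose G := expR (C s.+1 * K) * (s.+1%:R * Z + b0 * Z).
have G0 : 0 <= G.
  by rewrite mulr_ge0 ?expR_ge0 // addr_ge0 // mulr_ge0 // ler0n.
exists (G + G / nu ^+ 2) => [|tau A n H].
  by rewrite addr_ge0 // divr_ge0 // exprn_ge0 // ltW.
have [t0 A0 HK HA] := H.
have tn0 k : 0 <= k%:R * tau by rewrite mulr_ge0 ?ler0n // ltW.
pose y i := ((s + i).+1%:R * tau) ^+ s.+1 * A s.+1 (s + i).+1.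
pose z i := tau * ((s + i).+1%:R * tau) ^+ s * A s.+1 (s + i).+1.
pose d i := nu ^+ 2 * (tau * ((s + i).+1%:R * tau) ^+ s.+1
              * A s.+2 (s + i).+1).
pose a i := C s.+1 * (tau * A 1%N (s + i).+1).
pose b i := b0 * z i.
have y0 i : 0 <= y i by rewrite mulr_ge0 // exprn_ge0.
have z0 i : 0 <= z i by rewrite !mulr_ge0 // ?exprn_ge0 // ltW.
have d0 i : 0 <= d i.
  by rewrite !mulr_ge0 // ?exprn_ge0 ?tn0 // ltW.
have a0 i : 0 <= a i by rewrite !mulr_ge0 // ltW.
have b0' i : 0 <= b i by rewrite mulr_ge0.
have main m : (s + m < n)%N -> y m + \sum_(j < m) d j.+1 <= G.
  move=> sm.
  have rec i : (i < m)%N -> y i.+1 + d i.+1 <= (1 + a i) * y i + b i.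
    move=> im; have lt : ((s + i).+1 < n)%N.
      by apply: leq_ltn_trans sm; rewrite -addnS leq_add2l.
    have h := HA s.+1 (s + i).+1 isT isT lt.
    have ai : a i <= C s.+1 * K.
      rewrite ler_wpM2l //; have := HK (s + i).+1 (ltnW lt).
      rewrite big_ord_recr /=; apply: le_trans; rewrite lerDr.
      by apply: sumr_ge0 => ? _; rewrite mulr_ge0 // ltW.
    have e1 : y i.+1 + d i.+1 = ((s + i).+2%:R * tau) ^+ s.+1 *
      (A s.+1 (s + i).+2 + tau * nu ^+ 2 * A s.+2 (s + i).+2).
      by rewrite /y /d !addnS; ring.
    rewrite e1.
    apply: (le_trans (ler_wpM2l _ h)); first exact: exprn_ge0.
    rewrite -/(a i).
    have h2 := time_step s t0 (ltn0Sn (s + i)).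
    have h3 : 0 <= (1 + a i) * A s.+1 (s + i).+1.
      by rewrite mulr_ge0 // addr_ge0.
    apply: (le_trans (ler_wpM2r h3 h2)).
    rewrite mulrDl; apply: lerD.
      by rewrite /y le_eqVlt; apply/orP; left; apply/eqP; ring.
    have -> : 2 ^+ s.+1 * (tau * ((s + i).+1%:R * tau) ^+ s) *
      ((1 + a i) * A s.+1 (s + i).+1) = 2 ^+ s.+1 * (1 + a i) * z i.
      by rewrite /z; ring.
    by rewrite /b /b0 ler_wpM2r // ler_wpM2l ?exprn_ge0 // lerD2l.
  have := gronwall y0 d0 a0 b0' rec (leqnn m) => /le_trans; apply.
  have Zm : \sum_(j < m) z j <= Z by apply: hZ H _ _; exact: ltnW.
  apply: ler_pM.
  - exact: le_trans ler01 (prod_1D_ge1 m a0).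
  - by rewrite addr_ge0 // sumr_ge0.
  - apply: prod_1D_expR => //; rewrite -mulr_sumr ler_wpM2l //.
    apply: (le_trans (@sum_shift_le (fun j => tau * A 1%N j) s m _)).
      by move=> j; rewrite mulr_ge0 // ltW.
    exact: HK (ltnW sm).
  - apply: lerD; last by rewrite -mulr_sumr ler_wpM2l.
    have n1 : (s + 1 <= n)%N.
      by rewrite addn1; apply: leq_ltn_trans sm; rewrite leq_addr.
    (* The initial value [y 0] is [s.+1] times the first summand of the sum bounded by [Z]. *)
    have := hZ _ _ _ H _ n1; rewrite big_ord1 => hz.
    apply: (@le_trans _ _ (s.+1%:R * z 0%N)); last by rewrite ler_wpM2l.
    rewrite /y /z addn0 exprS le_eqVlt; apply/orP; left; apply/eqP; ring.
have G1 : 0 <= G / nu ^+ 2 by rewrite divr_ge0 // exprn_ge0 // ltW.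
split=> m.
  move=> sm mn; have e : m = (s + (m - s.+1)).+1 by rewrite -addSn subnKC.
  have := main (m - s.+1)%N; rewrite -ltnS -e ltnS => /(_ mn).
  rewrite {1}/y -e => h; have : 0 <= \sum_(j < m - s.+1) d j.+1.
    by apply: sumr_ge0.
  lra.
move=> sm; have := main m; rewrite -addSn => /(_ sm).
have -> : \sum_(j < m) d j.+1 = nu ^+ 2 *
  \sum_(i < m) tau * ((s.+1 + i).+1%:R * tau) ^+ s.+1 * A s.+2 (s.+1 + i).+1.
  by rewrite mulr_sumr; apply: eq_bigr => i _; rewrite /d addSnnS.
set S := \sum_(i < m) _ => h.
have : S <= G / nu ^+ 2.
  rewrite ler_pdivlMr ?exprn_gt0 // mulrC; have := y0 m; lra.
lra.
Qed.

Lemma smoothing s : exists2 B, 0 <= B &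
  forall tau A n, energy_decay tau A n ->
    forall m, (s < m)%N -> (m <= n)%N -> (m%:R * tau) ^+ s.+1 * A s.+1 m <= B.
Proof.
suff [Z Z0 hZ] : exists2 Z, 0 <= Z & forall tau A n, energy_decay tau A n ->
    forall m, (s + m <= n)%N ->
    \sum_(i < m) tau * ((s + i).+1%:R * tau) ^+ s * A s.+1 (s + i).+1 <= Z.
  have [B B0 hB] := smoothing_step Z0 hZ.
  by exists B => // tau A n /hB[].
elim: s => [|s [Z Z0 hZ]].
  exists K => // tau A n [_ _ h _] m mn.
  by apply: le_trans (h m mn); apply: ler_sum => i _; rewrite expr0 mulr1.
have [B B0 hB] := smoothing_step Z0 hZ.
by exists B => // tau A n /hB[].
Qed.

End Smoothing.

(** The power t^(-3/2): the rate at which the square root of the order-3 energy decays. *)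
Definition pow32V (t : R) : R := (t * Num.sqrt t)^-1.

(** A lower Riemann rectangle for the integral of t^(-3/2) over [a, b]; the right-hand side
    telescopes. *)
Lemma pow32V_step (a b : R) : 0 < a -> a <= b ->
  (b - a) * pow32V b <= 2 * ((Num.sqrt a)^-1 - (Num.sqrt b)^-1).
Proof.
move=> a0 ab; have b0 : 0 < b by exact: lt_le_trans ab.
rewrite /pow32V -{1 2}(sqr_sqrtr (ltW b0)) -{1}(sqr_sqrtr (ltW a0)).
have sa : 0 < Num.sqrt a by rewrite sqrtr_gt0.
have sb : 0 < Num.sqrt b by rewrite sqrtr_gt0.
have sab : Num.sqrt a <= Num.sqrt b by rewrite ler_sqrt // ltW.
move: (Num.sqrt a) (Num.sqrt b) sa sb sab => x y x0 y0 xy.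
have -> : x^-1 - y^-1 = (y - x) * (y ^+ 2) / (x * (y ^+ 2 * y)).
  by field; rewrite !gt_eqF.
have -> : (y ^+ 2 - x ^+ 2) * (y ^+ 2 * y)^-1 =
   (y - x) * (x * (y + x)) / (x * (y ^+ 2 * y)).
  by field; rewrite !gt_eqF.
rewrite [leRHS]mulrA ler_pM2r; last by rewrite invr_gt0 !mulr_gt0 // exprn_gt0.
rewrite [leRHS]mulrCA ler_wpM2l //; first by rewrite subr_ge0.
have : x * (y + x) <= y * (y + y).
  by apply: ler_pM; rewrite ?addr_ge0 ?lerD2l ?(ltW x0) ?(ltW y0).
by rewrite expr2; lra.
Qed.

Section TimeSums.
Variables (tau : R) (k : nat).
Hypotheses (tau0 : 0 < tau) (k0 : (1 < k)%N).

Let t j : R := (k + j)%:R * tau.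

Let t0 j : 0 < t j.
Proof. by rewrite mulr_gt0 // ltr0n ltn_addr // ltnW. Qed.

Let tS j : t j.+1 - t j = tau.
Proof. by rewrite /t addnS -natr1; ring. Qed.

Lemma sum_pow32V m : \sum_(j < m) tau * pow32V (t j.+1) <= 2 / Num.sqrt tau.
Proof.
apply: (@le_trans _ _ (2 * ((Num.sqrt (t 0%N))^-1 - (Num.sqrt (t m))^-1))).
  elim: m => [|m ih]; first by rewrite big_ord0 subrr mulr0.
  rewrite big_ord_recr /= -{2}(tS m).
  have tm : t m <= t m.+1 by rewrite -subr_ge0 tS ltW.
  have := pow32V_step (t0 m) tm; move: ih; lra.
have s0 : 0 < Num.sqrt tau by rewrite sqrtr_gt0.
rewrite ler_pM2l ?ltr0n // (@le_trans _ _ (Num.sqrt (t 0%N))^-1) //.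
  by rewrite lerBlDr lerDl invr_ge0 sqrtr_ge0.
rewrite lef_pV2 ?posrE ?sqrtr_gt0 // ler_sqrt ?(ltW (t0 _)) // /t addn0.
by rewrite ler_peMl ?(ltW tau0) // ler1n ltnW.
Qed.

Variable t1 : R.
Hypothesis t10 : 0 < t1.

Lemma sum_pow32V_late m :
  \sum_(j < m) (if t1 < t j.+1 then tau * pow32V (t j.+1) else 0)
    <= 4 / Num.sqrt t1.
Proof.
(* Cutting time off below at [t1 / 2] makes the telescoping sum constant before it. A counted term
   has t_(j+1) > t1, and t_j >= tau gives t_j >= t_(j+1) / 2, so the cut-off is inactive on it. *)
pose g x := Num.max x (t1 / 2).
have h0 : 0 < t1 / 2 by rewrite divr_gt0 // ltr0n.
have g0 x : 0 < g x by rewrite /g lt_max h0 orbT.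
have ga (u v : R) : u <= v -> g u <= g v.
  by move=> xy; rewrite /g ge_max !le_max xy lexx orbT.
have gV (u v : R) : u <= v -> (Num.sqrt (g v))^-1 <= (Num.sqrt (g u))^-1.
  by move=> xy; rewrite lef_pV2 ?posrE ?sqrtr_gt0 // ler_sqrt ?(ltW (g0 _)) // ga.
apply: (@le_trans _ _
  (2 * ((Num.sqrt (g (t 0%N)))^-1 - (Num.sqrt (g (t m)))^-1))).
  elim: m => [|m ih]; first by rewrite big_ord0 subrr mulr0.
  rewrite big_ord_recr /=.
  have tm : t m <= t m.+1 by rewrite -subr_ge0 tS ltW.
  case: ifPn => h; last by have := gV _ _ tm; move: ih; lra.
  have e1 : t1 / 2 <= t m.
    have : tau <= t m.
      by rewrite /t ler_peMl ?(ltW tau0) // ler1n addn_gt0 ltnW.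
    have := tS m; move: h; lra.
  have := pow32V_step (t0 m) tm; rewrite tS => h2.
  have -> : g (t m.+1) = t m.+1 by apply/max_idPl; lra.
  move: ih; have -> : g (t m) = t m by apply/max_idPl.
  move: h2; lra.
have s0 : 0 < Num.sqrt t1 by rewrite sqrtr_gt0.
have hs : Num.sqrt t1 / 2 <= Num.sqrt (g (t 0%N)).
  have -> : Num.sqrt t1 / 2 = Num.sqrt (t1 / 4).
    have e : (4 : R) = 2 ^+ 2 by ring.
    by rewrite sqrtrM ?ltW // sqrtrV ?ler0n // e sqrtr_sqr ger0_norm ?ler0n.
  by rewrite ler_sqrt // /g le_max; apply/orP; right; lra.
have : (Num.sqrt (g (t 0%N)))^-1 <= (Num.sqrt t1 / 2)^-1.
  by rewrite lef_pV2 ?posrE ?sqrtr_gt0 // divr_gt0 // ltr0n.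
rewrite invf_div.
have : 0 <= (Num.sqrt (g (t m)))^-1 by rewrite invr_ge0 sqrtr_ge0.
lra.
Qed.

Lemma sum_early m :
  \sum_(j < m) (if t1 < t j.+1 then 0 else tau) <= t1.
Proof.
suff : \sum_(j < m) (if t1 < t j.+1 then 0 else tau) <= Num.min (t m) t1.
  by rewrite le_min => /andP[].
elim: m => [|m]; first by rewrite big_ord0 le_min !ltW.
rewrite big_ord_recr /= !le_min => /andP[h1 h2].
case: ltP => h; rewrite ?addr0; first by rewrite h2 (le_trans h1) // -subr_ge0 tS ltW.
have : \sum_(j < m) (if t1 < t j.+1 then 0 else tau) + tau <= t m.+1.
  by have := tS m; move: h1; lra.
by move=> h3; rewrite h3 (le_trans h3).
Qed.

End TimeSums.

End RealSequences.

(** * Derivatives and the maximum principle *)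

Section MaximumPrinciple.
Variable R : realType.
Implicit Types f g : R -> R.

Lemma is_derive_continuous f (df : R -> R) :
  (forall x : R, is_derive x 1 f (df x)) -> continuous f.
Proof.
move=> fd x; apply/differentiable_continuous/derivable1_diffP.
exact: (@ex_derive _ _ _ _ _ _ _ (fd x)).
Qed.

(** Stated with absolute values so that [b] may lie on either side of [a]: the feet of
    characteristics are shifted to the left or to the right. *)
Lemma is_derive_mvt f (df : R -> R) a b :
  (forall x : R, is_derive x 1 f (df x)) ->
  exists2 c, `|c - a| <= `|b - a| & f b - f a = df c * (b - a).
Proof.
move=> fd; have cf := is_derive_continuous fd.
have cw u v : {within `[u, v], continuous f} by exact: continuous_subspaceT.
have [ab|ba] := leP a b.
  have [c + e] := MVT_segment ab (fun x _ => fd x) (cw _ _).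
  rewrite in_itv /= => /andP[ac cb]; exists c => //.
  by rewrite !ger0_norm ?subr_ge0 // lerD2r.
have [c + e] := MVT_segment (ltW ba) (fun x _ => fd x) (cw _ _).
rewrite in_itv /= => /andP[bc ca]; exists c.
  rewrite ![`|_ - a|]distrC !ger0_norm ?subr_ge0 ?lerD2l ?lerN2 //.
  exact: ltW.
by rewrite -opprB e; ring.
Qed.

Lemma periodic_int f (k : int) x : periodic f 1 -> f (x + k%:~R) = f x.
Proof.
move=> fp; have pn n y : f (y + n%:R) = f y by exact: (periodicn fp).
case: k => n; first by rewrite -pmulrn pn.
by rewrite NegzE mulrNz -(pn n.+1 (x - _)) subrK.
Qed.

Lemma periodic_max f : periodic f 1 -> continuous f ->
  exists c, forall x, f x <= f c.
Proof.
move=> fp fc; have cw : {within `[0, 1], continuous f}.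
  exact: continuous_subspaceT.
have [c _ cmax] := EVT_max (@ler01 R) cw; exists c => x.
rewrite -(periodic_int (- Num.floor x) x fp); apply: cmax.
have := floor_itv x; rewrite intrD in_itv /= mulrNz; lra.
Qed.

Lemma derive_at_max f (c df : R) :
  is_derive c 1 f df -> (forall x : R, derivable f x 1) ->
  (forall x, f x <= f c) -> df = 0.
Proof.
move=> h fd fmax.
have := @derive1_at_max R f (c - 1) (c + 1) c.
case=> //; first lra.
  by rewrite in_itv /=; lra.
by move=> _ <-; rewrite derive_val.
Qed.

(** If [f2] were positive, [f1] would be positive just to the right of its zero [c], and the mean
    value theorem would give a value above the maximum. *)
Lemma second_derivative_at_max f (f1 : R -> R) (c f2 : R) :
  (forall x : R, is_derive x 1 f (f1 x)) -> is_derive c 1 f1 f2 ->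
  (forall x, f x <= f c) -> f2 <= 0.
Proof.
move=> fd f1d fmax; rewrite leNgt; apply/negP => f20.
have f1c : f1 c = 0.
  by apply: (derive_at_max (fd c)) => // x; apply: ex_derive (fd x).
have dv : derivable f1 c 1 by exact: ex_derive.
have cv : (fun h => h^-1 *: ((f1 \o shift c) (h *: 1) - f1 c)) @ 0^' --> f2.
  by rewrite -[f2](@derive_val _ _ _ _ _ _ _ f1d); exact: dv.
have : \forall h \near 0^', 0 < h^-1 *: (f1 (h *: 1 + c) - f1 c).
  exact: (cvgr_gt f2 cv 0 f20).
rewrite near_withinE => /nbhs_ballP[e /= e0 he].
have cw : {within `[c, c + e / 2], continuous f}.
  exact/continuous_subspaceT/(is_derive_continuous fd).
have e2 : 0 < e / 2 by rewrite divr_gt0.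
have lt : c < c + e / 2 by rewrite ltrDl.
have [d + fe] := MVT lt (fun x _ => fd x) cw.
rewrite in_itv /= => /andP[cd de].
have dc0 : 0 < d - c by rewrite subr_gt0.
have : 0 < (d - c)^-1 *: (f1 ((d - c) *: 1 + c) - f1 c).
  apply: he; last by rewrite gt_eqF.
  by rewrite /ball /= sub0r normrN gtr0_norm //; lra.
rewrite f1c subr0 /GRing.scale /= mulr1 subrK pmulr_rgt0 ?invr_gt0 // => f1d0.
have : 0 < f1 d * (c + e / 2 - c) by rewrite mulr_gt0 // addrAC subrr add0r.
by rewrite -fe subr_gt0 ltNge fmax.
Qed.

(** At a maximum of [f] the second derivative is nonpositive, so there [f] is at most
    [f - a * f2]. *)
Lemma resolvent_le f (f1 f2 : R -> R) (a G : R) :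
  periodic f 1 -> (forall x : R, is_derive x 1 f (f1 x)) ->
  (forall x : R, is_derive x 1 f1 (f2 x)) -> 0 <= a ->
  (forall x, f x - a * f2 x <= G) -> forall x, f x <= G.
Proof.
move=> fp fd f1d a0 h x.
have [c cmax] := periodic_max fp (is_derive_continuous fd).
have f20 := second_derivative_at_max fd (f1d c) cmax.
have := cmax x; have := h c.
have : a * f2 c <= 0 by rewrite mulr_ge0_le0.
lra.
Qed.

Lemma resolvent_norm_le f (f1 f2 : R -> R) (a G : R) :
  periodic f 1 -> (forall x : R, is_derive x 1 f (f1 x)) ->
  (forall x : R, is_derive x 1 f1 (f2 x)) -> 0 <= a ->
  (forall x, `|f x - a * f2 x| <= G) -> forall x, `|f x| <= G.
Proof.
move=> fp fd f1d a0 h x; rewrite ler_norml; apply/andP; split.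
  have : - f x <= G.
    apply: (@resolvent_le (- f) (- f1) (- f2) a) => //.
    - by move=> y; rewrite /= fctE fp.
    - by move=> y; have := h y; rewrite !fctE ler_norml; lra.
  lra.
apply: (resolvent_le fp fd f1d a0) => y.
by have := h y; rewrite ler_norml; lra.
Qed.

(* At a maximum of [f' - b f] one has [f'' = b f'], so [b f' <= b^2 f]. *)
Lemma derive_le_of_second f (f1 f2 : R -> R) (b : R) :
  periodic f 1 -> periodic f1 1 -> (forall x : R, is_derive x 1 f (f1 x)) ->
  (forall x : R, is_derive x 1 f1 (f2 x)) -> 0 < b ->
  (forall x, f2 x <= b ^+ 2 * f x) -> forall x, f1 x <= b * f x.
Proof.
move=> fp f1p fd f1d b0 h x.
pose q := f1 - b *: f.
have qd y : is_derive (y : R) 1 q (f2 y - b *: f1 y) by exact: is_deriveB.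
have [c cmax] : exists c, forall x, q x <= q c.
  apply: periodic_max => [y|]; last exact: is_derive_continuous qd.
  by rewrite /q !fctE fp f1p.
have := derive_at_max (qd c) (fun y => @ex_derive _ _ _ _ _ _ _ (qd y)) cmax.
move=> /eqP; rewrite subr_eq0 => /eqP e.
have := h c; rewrite e expr2 -mulrA /GRing.scale /= ler_pM2l // => hc.
have qE y : q y = f1 y - b * f y by [].
by have := cmax x; rewrite !qE; lra.
Qed.

(** The lower bound is the upper bound of [derive_le_of_second] for the reflected function x ->
    f(-x). *)
Lemma derive_norm_le_of_second f (f1 f2 : R -> R) (b : R) :
  periodic f 1 -> periodic f1 1 -> (forall x : R, is_derive x 1 f (f1 x)) ->
  (forall x : R, is_derive x 1 f1 (f2 x)) -> 0 < b ->
  (forall x, f2 x <= b ^+ 2 * f x) -> forall x, `|f1 x| <= b * f x.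
Proof.
move=> fp f1p fd f1d b0 h x; rewrite ler_norml.
rewrite (derive_le_of_second fp f1p fd f1d b0 h) andbT.
have comp g (g1 : R -> R) : (forall x : R, is_derive x 1 g (g1 x)) ->
    forall y : R, is_derive y 1 (fun z => g (- z)) (- g1 (- y)).
  move=> gd y; rewrite -[X in is_derive _ _ _ X]mulN1r mulrC.
  have := @is_derive1_comp R g (fun z => - z) y (g1 (- y)) (-1) (gd _) _.
  exact.
have := @derive_le_of_second (fun z => f (- z)) (fun z => - f1 (- z))
   (fun z => f2 (- z)) b.
have pN g : periodic g 1 -> periodic (fun z => g (- z)) 1.
  by move=> gp y; rewrite opprD -(gp (- y - 1)) subrK.
move=> /(_ (pN _ fp)) H.
have : - f1 (- - x) <= b * f (- - x).
  apply: H => //.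
  - by move=> y; rewrite (pN _ f1p).
  - move=> y; rewrite -[f2 _]opprK.
    exact: (is_deriveN (comp _ _ f1d y)).
rewrite opprK; lra.
Qed.

Lemma taylor1_bound f (f1 f2 : R -> R) (X x h : R) :
  (forall x : R, is_derive x 1 f (f1 x)) ->
  (forall x : R, is_derive x 1 f1 (f2 x)) -> (forall x, `|f2 x| <= X) ->
  `|f (x + h) - f x - h * f1 x| <= X * h ^+ 2.
Proof.
move=> fd f1d f2X.
have [c ch e] := is_derive_mvt x (x + h) fd.
have [d dh e1] := is_derive_mvt x c f1d.
move: ch e; rewrite addrAC subrr add0r => ch ->.
have -> : f1 c * h - h * f1 x = f2 d * (c - x) * h by rewrite -e1; ring.
rewrite -[h ^+ 2]ger0_norm ?sqr_ge0 // expr2 !normrM mulrA.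
by rewrite ler_wpM2r // ler_pM.
Qed.

(** Landau's inequality, obtained by solving the Taylor bound for [f1]. The length [h] stays free,
    to be balanced against powers of [N] at the end. *)
Lemma derive_bound_interpolation f (f1 f2 : R -> R) (m X h : R) :
  (forall x : R, is_derive x 1 f (f1 x)) ->
  (forall x : R, is_derive x 1 f1 (f2 x)) ->
  (forall x, `|f x| <= m) -> (forall x, `|f2 x| <= X) -> 0 < h ->
  forall x, `|f1 x| <= 2 * m / h + X * h.
Proof.
move=> fd f1d fm fX h0 x.
have := taylor1_bound x h fd f1d fX.
rewrite ler_norml => /andP[t1 t2].
have := fm (x + h); have := fm x; rewrite !ler_norml => /andP[a1 a2] /andP[b1 b2].
have -> : 2 * m / h + X * h = (2 * m + X * h ^+ 2) / h.
  by field; rewrite gt_eqF.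
have -> : f1 x = h * f1 x / h by field; rewrite gt_eqF.
rewrite -mulNr !ler_pM2r ?invr_gt0 //; lra.
Qed.

End MaximumPrinciple.

(** * Complex moduli and the characters of the torus *)

Section ComplexModulus.
Variable R : realType.
Implicit Types z w : R[i].

Lemma normc_ge0 z : 0 <= normc z.
Proof. by case: z => a b; exact: sqrtr_ge0. Qed.

Lemma sqr_normcE z : normc z ^+ 2 = Re z ^+ 2 + Im z ^+ 2.
Proof. by case: z => a b; rewrite /= sqr_sqrtr // addr_ge0 ?sqr_ge0. Qed.

Lemma normc_real (a : R) : normc a%:C = `|a|.
Proof. by rewrite /= expr0n /= addr0 sqrtr_sqr. Qed.

Lemma normc_sum (I : Type) (r : seq I) (P : pred I) (F : I -> R[i]) :
  normc (\sum_(i <- r | P i) F i) <= \sum_(i <- r | P i) normc (F i).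
Proof.
elim/big_ind2: _ => [|x a y b h1 h2|//]; first by rewrite normc0.
exact: le_trans (le_normcD _ _) (lerD h1 h2).
Qed.

Lemma norm_Re_le z : `|Re z| <= normc z.
Proof.
case: z => a b /=; rewrite -sqrtr_sqr ler_sqrt ?lerDl ?sqr_ge0 //.
by rewrite addr_ge0 ?sqr_ge0.
Qed.

Lemma normc_conj z : normc (conjc z) = normc z.
Proof. by case: z => a b /=; rewrite sqrrN. Qed.

Lemma mul_conj z : z * conjc z = (normc z ^+ 2)%:C.
Proof. by case: z => a b; rewrite sqr_normcE /=; simpc; congr (_ +i* _); ring. Qed.

Lemma Re_normc_real z : Im z = 0 -> normc z = `|Re z|.
Proof. by case: z => a b /= ->; rewrite expr0n addr0 sqrtr_sqr. Qed.

Lemma Re_conjM_le z w : `|Re (conjc z * w)| <= normc z * normc w.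
Proof. by rewrite -(normc_conj z) -normcM norm_Re_le. Qed.

Lemma ReD z w : Re (z + w) = Re z + Re w.
Proof. by case: z w => [a b] [c d]. Qed.

Lemma Re_sum (I : Type) (r : seq I) (P : pred I) (F : I -> R[i]) :
  Re (\sum_(i <- r | P i) F i) = \sum_(i <- r | P i) Re (F i).
Proof. by elim/big_ind2: _ => // x a y b <- <-; rewrite ReD. Qed.

Lemma conjc_sum (I : Type) (r : seq I) (P : pred I) (F : I -> R[i]) :
  conjc (\sum_(i <- r | P i) F i) = \sum_(i <- r | P i) conjc (F i).
Proof. exact: raddf_sum. Qed.

Lemma conjcM z w : conjc (z * w) = conjc z * conjc w.
Proof. exact: rmorphM. Qed.

Lemma conjcB z w : conjc (z - w) = conjc z - conjc w.
Proof. exact: rmorphB. Qed.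

Lemma conj_real z : conjc z = z <-> Im z = 0.
Proof.
case: z => a b /=; split=> [[] h|->]; last by rewrite oppr0.
lra.
Qed.

End ComplexModulus.

Section Character.
Variable R : realType.
Implicit Types x y : R.

Definition e x : R[i] := expi (2 * pi * x).

Lemma eD x y : e (x + y) = e x * e y.
Proof.
rewrite /e /expi mulrDr cosD sinD; simpc; congr (_ +i* _).
by rewrite addrC.
Qed.

Lemma e0 : e 0 = 1.
Proof. by rewrite /e /expi mulr0 cos0 sin0. Qed.

Lemma eMn n x : e (n%:R * x) = e x ^+ n.
Proof.
elim: n => [|n ih]; first by rewrite mul0r e0 expr0.
by rewrite -natr1 mulrDl mul1r eD ih exprSr.
Qed.

Lemma normc_e x : normc (e x) = 1.
Proof. by rewrite /e /expi /= cos2Dsin2 sqrtr1. Qed.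

Lemma conj_e x : conjc (e x) = e (- x).
Proof. by rewrite /e /expi /= mulrN cosN sinN. Qed.

Lemma e1 : e 1 = 1.
Proof. by rewrite /e /expi mulr1 mulr_natl cos2pi sin2pi. Qed.

Lemma e_int (k : int) : e k%:~R = 1.
Proof.
have en n : e n%:R = 1 by rewrite -[n%:R]mulr1 eMn e1 expr1n.
case: k => n; first by rewrite -pmulrn en.
by rewrite NegzE mulrNz -conj_e en conjc1.
Qed.

Lemma e_nat n : e n%:R = 1.
Proof. exact: (e_int n). Qed.

Lemma sqr_normc_e_sub1 x : normc (e x - 1) ^+ 2 = 4 * sin (pi * x) ^+ 2.
Proof.
rewrite sqr_normcE /e /expi /= subr0.
have -> : 2 * pi * x = (pi * x) *+ 2 by rewrite -mulr_natr; ring.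
rewrite cos_mulr2n sin_mulr2n; have := cos2Dsin2 (pi * x).
move: (cos _) (sin _) => c s h; rewrite !mulr2n.
have -> : (c ^+ 2 + c ^+ 2 - 1 - 1) ^+ 2 + (c * s + c * s) ^+ 2 =
  4 * (s ^+ 2) + 4 * (c ^+ 2 - 1) * (c ^+ 2 + s ^+ 2 - 1) by ring.
rewrite h; ring.
Qed.

Lemma cos_piquarter2 : 2 * cos (pi / 4 : R) ^+ 2 = 1.
Proof.
have := cos_mulr2n (pi / 4 : R); rewrite !mulr2n.
have -> : pi / 4 + pi / 4 = pi / 2 :> R by field.
by rewrite cos_pihalf; lra.
Qed.

Lemma mvt_sin x : 0 <= x -> exists2 c, 0 <= c <= x & sin x = x * cos c.
Proof.
move=> x0; have cw : {within `[0, x], continuous (@sin R)}.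
  by apply: continuous_subspaceT; exact: continuous_sin.
have [c + h] := MVT_segment x0 (fun y _ => is_derive_sin y) cw.
rewrite in_itv /= => cx; exists c => //.
by rewrite -[LHS]subr0 -{1}(@sin0 R) h subr0 mulrC.
Qed.

(* [sin x = 2 sin (x/2) cos (x/2)], and both [cos (x/2)] and the derivative of
   [sin] on [[0, x/2]] are at least [cos (pi/4)], whose square is [1/2]. *)
Lemma sin_ge_half x : 0 <= x <= pi / 2 -> x / 2 <= sin x.
Proof.
move=> /andP[x0 xpi].
have p0 := @pi_gt0 R.
have cmono y : 0 <= y <= pi / 4 -> cos (pi / 4 : R) <= cos y.
  move=> /andP[y0 y4]; rewrite leNgt ltr_cos ?in_itv /= -?leNgt //; lra.
have [|c /andP[c0 cx] es] := @mvt_sin (x / 2); first lra.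
have h1 := cmono (x / 2); have h2 := cmono c.
have c40 : 0 < cos (pi / 4 : R) by apply: cos_gt0_pihalf; lra.
have xE : x = (x / 2) *+ 2 by rewrite mulr2n; field.
have -> : sin x = 2 * (x / 2 * (cos (x / 2) * cos c)).
  by rewrite {1}xE sin_mulr2n es mulr2n; ring.
have := cos_piquarter2; rewrite expr2 => e4.
have h3 : cos (pi / 4 : R) * cos (pi / 4) <= cos (x / 2) * cos c.
  by apply: ler_pM; rewrite ?(ltW c40) //; [apply: h1|apply: h2]; lra.
have : x / 2 * (cos (pi / 4 : R) * cos (pi / 4)) <= x / 2 * (cos (x / 2) * cos c).
  by rewrite ler_wpM2l //; lra.
have -> : cos (pi / 4) * cos (pi / 4) = 1 / 2 :> R by move: e4; lra.
lra.
Qed.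

(** The chord has length 2 sin(pi x), and sin(pi x) >= pi x / 2 >= x. It keeps roots of unity away
    from 1 and bounds Dirichlet kernels. *)
Lemma normc_e_sub1_ge x : 0 <= x <= 1 / 2 -> 2 * x <= normc (e x - 1).
Proof.
move=> /andP[x0 x2]; rewrite -(@ler_pXn2r _ 2) ?nnegrE ?normc_ge0 //; last lra.
rewrite sqr_normc_e_sub1.
have p2 := @pi_ge2 R; have p0 := @pi_gt0 R.
have h : pi * x / 2 <= sin (pi * x).
  apply: sin_ge_half; rewrite mulr_ge0 ?(ltW p0) //=.
  have : pi * x <= pi * (1 / 2) by rewrite ler_wpM2l // ltW.
  lra.
have h2 : x <= sin (pi * x).
  have : 2 * x <= pi * x by rewrite ler_wpM2r.
  move: h; lra.
have -> : (2 * x) ^+ 2 = 4 * x ^+ 2 by ring.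
by rewrite ler_pM2l // ler_pXn2r // nnegrE // (le_trans x0).
Qed.

Lemma normc_e_sub1_ge' x : 1 / 2 <= x <= 1 -> 2 * (1 - x) <= normc (e x - 1).
Proof.
move=> h; have -> : normc (e x - 1) = normc (e (1 - x) - 1).
  by rewrite -normc_conj conjcB conjc1 conj_e eD e1 mul1r.
apply: normc_e_sub1_ge; lra.
Qed.

End Character.

(** * Trigonometric polynomials *)

Section TrigPolynomials.
Variable R : realType.
Implicit Types (p q r : {poly R[i]}) (x : R) (D : nat).

(* The trigonometric polynomial with coefficient [p`_j] at frequency [j - D]. *)
Definition trig D p x : R[i] := e (- (D%:R * x)) * p.[e x].

Definition kappa D j : R := 2 * pi * (j%:R - D%:R).

Lemma trigE n D p x : (size p <= n)%N ->
  trig D p x = \sum_(j < n) p`_j * e ((j%:R - D%:R) * x).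
Proof.
move=> sp; rewrite /trig (horner_coef_wide _ sp) mulr_sumr.
by apply: eq_bigr => j _; rewrite mulrCA -eMn -eD; congr (_ * e _); ring.
Qed.

Lemma trigM D1 D2 p q x : trig D1 p x * trig D2 q x = trig (D1 + D2) (p * q) x.
Proof.
rewrite /trig hornerM mulrACA -eD; congr (e _ * _).
by rewrite natrD; ring.
Qed.

Lemma trigD D p q x : trig D (p + q) x = trig D p x + trig D q x.
Proof. by rewrite /trig hornerD mulrDr. Qed.

Lemma trigN D p x : trig D (- p) x = - trig D p x.
Proof. by rewrite /trig hornerN mulrN. Qed.

Lemma trigZ D c p x : trig D (c *: p) x = c * trig D p x.
Proof. by rewrite /trig hornerZ mulrCA. Qed.

Lemma trigMXn D k p x : trig (D + k) ('X^k * p) x = trig D p x.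
Proof.
rewrite /trig hornerM hornerXn -eMn mulrA -eD; congr (e _ * _).
by rewrite natrD; ring.
Qed.

Lemma normc_trig D p x : normc (trig D p x) = normc p.[e x].
Proof. by rewrite /trig normcM normc_e mul1r. Qed.

Lemma trig_periodic D p x : trig D p (x + 1) = trig D p x.
Proof.
rewrite /trig eD e1 mulr1; congr (_ * _).
by rewrite mulrDr mulr1 opprD eD -[e (- D%:R)]conj_e e_nat conjc1 mulr1.
Qed.

Definition dtrig D p : {poly R[i]} :=
  \poly_(j < size p) ('i * (kappa D j)%:C * p`_j).

Lemma coef_dtrig D p j : (dtrig D p)`_j = 'i * (kappa D j)%:C * p`_j.
Proof.
rewrite coef_poly; case: ltnP => // h.
by rewrite nth_default // mulr0.
Qed.

Lemma size_dtrig D p : (size (dtrig D p) <= size p)%N.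
Proof. exact: size_poly. Qed.

Lemma kappaD D1 D2 i j : kappa (D1 + D2) (i + j) = kappa D1 i + kappa D2 j.
Proof. by rewrite /kappa !natrD; ring. Qed.

Lemma dtrigM D1 D2 p q :
  dtrig (D1 + D2) (p * q) = dtrig D1 p * q + p * dtrig D2 q.
Proof.
apply/polyP => n; rewrite coefD coef_dtrig !coefM mulr_sumr -big_split /=.
apply: eq_bigr => -[j /= jn] _; rewrite ltnS in jn; rewrite !coef_dtrig.
by rewrite -{1}(subnKC jn) kappaD rmorphD /=; ring.
Qed.

Definition rtrig D p x : R := Re (trig D p x).

Lemma rtrig_periodic D p : periodic (rtrig D p) 1.
Proof. by move=> x; rewrite /rtrig trig_periodic. Qed.

Lemma norm_rtrig_le D p x : `|rtrig D p x| <= normc p.[e x].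
Proof. by rewrite -(normc_trig D); exact: norm_Re_le. Qed.

Lemma rtrigE n D p x : (size p <= n)%N ->
  rtrig D p x =
    \sum_(j < n) (Re p`_j * cos (kappa D j * x) - Im p`_j * sin (kappa D j * x)).
Proof.
move=> sp; rewrite /rtrig (trigE _ _ sp) Re_sum; apply: eq_bigr => j _.
rewrite /e /expi /kappa !mulrA; case: (p`_j) => a b /=.
by [].
Qed.

Lemma is_derive_rtrig D p x : is_derive x 1 (rtrig D p) (rtrig D (dtrig D p) x).
Proof.
set n := size p.
have -> : rtrig D p = \sum_(j < n)
    (fun y => Re p`_j * cos (kappa D j * y) - Im p`_j * sin (kappa D j * y)).
  by apply/funext => y; rewrite (rtrigE _ _ (leqnn n)) fct_sumE.
rewrite (rtrigE _ _ (size_dtrig D p)).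
apply: is_derive_sum => j.
rewrite coef_dtrig; case: (p`_j) => a b /=.
set k := kappa D j.
have dk : is_derive x 1 (fun y => k * y) k.
  have := is_deriveZ k (@is_derive_id _ _ x 1).
  by rewrite /GRing.scale /= mulr1.
have dc := @is_derive1_comp _ (@cos R) (fun y => k * y) x _ _ (is_derive_cos _) dk.
have ds := @is_derive1_comp _ (@sin R) (fun y => k * y) x _ _ (is_derive_sin _) dk.
have := is_deriveB (is_deriveZ a dc) (is_deriveZ b ds).
rewrite /GRing.scale /=.
set L := (X in is_derive _ _ _ X -> _); set L' := (X in _ -> is_derive _ _ _ X).
by have -> : L = L' by rewrite /L /L'; ring.
Qed.

Definition real_trig D p := (size p <= D.*2.+1)%N /\ forall x, Im (trig D p x) = 0.

Definition hermitian D p := (size p <= D.*2.+1)%N /\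
  forall j, (j <= D.*2)%N -> conjc p`_j = p`_(D.*2 - j).

Lemma hermitian_real D p : hermitian D p -> real_trig D p.
Proof.
move=> [sp hp]; split=> // x; apply/conj_real.
rewrite (trigE _ _ sp) conjc_sum (reindex_inj rev_ord_inj) /=.
apply: eq_bigr => -[j /= jn] _; rewrite subSS conjcM conj_e.
rewrite hp ?leq_subr // subKn //; congr (_ * e _).
by rewrite natrB // -mul2n natrM; ring.
Qed.

Lemma orthogonality P (m : int) : (0 < P)%N -> (`|m| < P)%N ->
  \sum_(l < P) e (m%:~R * (l%:R / P%:R)) = (if m == 0 then P%:R else 0) :> R[i].
Proof.
move=> P0 mP; case: eqP => [->|/eqP m0].
  under eq_bigr do rewrite mul0r e0.
  by rewrite sumr_const card_ord.
have Pn : (P%:R : R) != 0 by rewrite pnatr_eq0 -lt0n.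
pose w : R[i] := e (m%:~R / P%:R).
have wl l : e (m%:~R * (l%:R / P%:R)) = w ^+ l.
  by rewrite /w -eMn; congr e; ring.
under eq_bigr do rewrite wl.
have : w ^+ P - 1 = (w - 1) * \sum_(l < P) w ^+ l by rewrite subrX1.
have -> : w ^+ P = 1 by rewrite -eMn mulrCA divff // mulr1 e_int.
rewrite subrr => /esym/eqP; rewrite mulf_eq0 => /orP[|/eqP ->//].
move=> /eqP/(congr1 (@normc R)); rewrite normc0 => h.
suff : 0 < normc (w - 1) by rewrite h ltxx.
(* A root of unity with exponent k/P, 0 < k < P, differs from 1: the chord bound applies on
   whichever half of [0, 1] contains k/P. *)
have wpos (k : nat) : (0 < k)%N -> (k < P)%N -> 0 < normc (e (k%:R / P%:R : R) - 1).
  move=> k0 kP; have kr : (0 : R) < k%:R by rewrite ltr0n.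
  have Pr : (0 : R) < P%:R by rewrite ltr0n.
  have q0 : 0 < k%:R / P%:R :> R by rewrite divr_gt0.
  have q1 : k%:R / P%:R < 1 :> R by rewrite ltr_pdivrMr // mul1r ltr_nat.
  have [h2|h2] := leP (k%:R / P%:R : R) (1 / 2).
    apply: lt_le_trans (normc_e_sub1_ge _); last lra.
    by rewrite mulr_gt0.
  by apply: lt_le_trans (normc_e_sub1_ge' _); lra.
rewrite /w; case: (m) m0 mP => k k0 kP.
  by apply: wpos => //; rewrite lt0n.
rewrite NegzE mulrNz mulNr -conj_e -[X in normc (_ - X)]conjc1 -conjcB.
by rewrite normc_conj; apply: wpos.
Qed.

(** Discrete Fourier inversion on [P] equispaced points, exact as soon as [P] is at least the number
    of coefficients. Parseval and the bounds for spectral cut-offs rest on it rather than on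
    integrals. *)
Lemma trig_filter P D p x j : (size p <= P)%N -> (j < P)%N ->
  \sum_(l < P) trig D p (x - l%:R / P%:R) * e ((j%:R - D%:R) * (l%:R / P%:R))
    = P%:R * (p`_j * e ((j%:R - D%:R) * x)).
Proof.
move=> sp jP; have P0 : (0 < P)%N by exact: leq_trans jP.
under eq_bigr do rewrite (trigE _ _ sp) mulr_suml.
rewrite exchange_big /=.
have E (i : 'I_P) : \sum_(l < P) p`_i * e ((i%:R - D%:R) * (x - l%:R / P%:R)) *
    e ((j%:R - D%:R) * (l%:R / P%:R)) =
    p`_i * e ((i%:R - D%:R) * x) * (if (i == j :> nat) then P%:R else 0).
  have ij : (`|j%:Z - i%:Z| < P)%N by have := ltn_ord i; lia.
  have := orthogonality P0 ij; rewrite subr_eq0 => ho.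
  have -> : (i == j :> nat) = (j%:Z == i%:Z) by rewrite eq_sym.
  rewrite -ho mulr_sumr; apply: eq_bigr => l _.
  rewrite -!mulrA -!eD; congr (_ * e _).
  by rewrite intrB -!pmulrn; ring.
rewrite (eq_bigr _ (fun i _ => E i)) (bigD1 (Ordinal jP)) //= eqxx.
rewrite big1 => [|i ij]; first by rewrite addr0 [RHS]mulrC.
have -> : (i == j :> nat) = false; last by rewrite mulr0.
by apply/negP => /eqP h; case/eqP: ij; apply/val_inj.
Qed.

Lemma coef_filter P D p j : (size p <= P)%N -> (j < P)%N ->
  P%:R * p`_j =
    \sum_(l < P) trig D p (- (l%:R / P%:R)) * e ((j%:R - D%:R) * (l%:R / P%:R)).
Proof.
move=> sp jP; rewrite -[RHS](eq_bigr _ (fun l _ => congr1 (fun y => _ y * _) (add0r _))).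
by rewrite (trig_filter D 0 sp jP) mulr0 e0 mulr1.
Qed.

Lemma real_hermitian D p : real_trig D p -> hermitian D p.
Proof.
move=> [sp hp]; split=> // j jD.
have P0 : (D.*2.+1%:R : R[i]) != 0 by rewrite pnatr_eq0.
apply: (mulfI P0).
have j1 : (j < D.*2.+1)%N by [].
have j2 : (D.*2 - j < D.*2.+1)%N by rewrite ltnS leq_subr.
rewrite (coef_filter D sp j2) -[X in X * _](conjc_nat R) -conjcM.
rewrite (coef_filter D sp j1) conjc_sum; apply: eq_bigr => l _.
rewrite conjcM conj_e; congr (_ * e _); first exact/conj_real.
have d2 : D.*2%:R = 2 * D%:R :> R by rewrite -mul2n natrM.
by rewrite natrB // d2; ring.
Qed.

Definition nrm2 p : R := \sum_(j < size p) normc p`_j ^+ 2.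

Lemma big_ord_widen0 (V : nmodType) (F : nat -> V) m n : (m <= n)%N ->
  (forall j, (m <= j)%N -> F j = 0) -> \sum_(j < n) F j = \sum_(j < m) F j.
Proof.
move=> mn F0; rewrite (big_ord_widen _ F mn) [RHS]big_mkcond /=.
by apply: eq_bigr => j _; case: ltnP => // /F0.
Qed.

Lemma nrm2E n p : (size p <= n)%N -> nrm2 p = \sum_(j < n) normc p`_j ^+ 2.
Proof.
move=> sp; rewrite (big_ord_widen0 (F := fun j => normc p`_j ^+ 2) sp) //.
by move=> j sj; rewrite nth_default // normc0 expr0n.
Qed.

Lemma nrm2_ge0 p : 0 <= nrm2 p.
Proof. by apply: sumr_ge0 => j _; exact: sqr_ge0. Qed.

(** The number [P] of sample points is left free so that several polynomials can be compared
    pointwise on one grid, as in [nrm2_mul_le]. *)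
Lemma parseval P p : (size p <= P)%N ->
  P%:R * nrm2 p = \sum_(l < P) normc p.[e (- (l%:R / P%:R))] ^+ 2.
Proof.
move=> sp; apply: (@complexI R); rewrite (nrm2E sp).
rewrite rmorphM !rmorph_sum /= mulr_sumr.
have E (j : 'I_P) : (P%:R)%:C * (normc p`_j ^+ 2)%:C = \sum_(l < P)
    trig 0 p (- (l%:R / P%:R)) * e ((j%:R - 0%:R) * (l%:R / P%:R)) * conjc p`_j.
  by rewrite -mul_conj mulrA rmorph_nat (coef_filter 0 sp (ltn_ord j)) mulr_suml.
rewrite (eq_bigr _ (fun j _ => E j)) exchange_big /=; apply: eq_bigr => l _.
rewrite -(normc_trig 0) -mul_conj.
under eq_bigr do rewrite -mulrA.
rewrite -mulr_sumr; congr (_ * _).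
rewrite (trigE _ _ sp) conjc_sum; apply: eq_bigr => j _.
by rewrite conjcM conj_e mulrC mulrN opprK.
Qed.

Definition sup_le p (m : R) := forall x, normc p.[e x] <= m.

Lemma sup_le_ge0 p m : sup_le p m -> 0 <= m.
Proof. by move=> /(_ 0); apply: le_trans; exact: normc_ge0. Qed.

Lemma nrm2_le_sup p m : sup_le p m -> nrm2 p <= m ^+ 2.
Proof.
move=> pm; have P0 : (0 : R) < (size p).+1%:R by rewrite ltr0n.
rewrite -(ler_pM2l P0) (parseval (leqnSn _)).
have -> : (size p).+1%:R * m ^+ 2 = \sum_(l < (size p).+1) m ^+ 2.
  by rewrite sumr_const card_ord mulr_natl.
apply: ler_sum => l _.
by rewrite ler_pXn2r ?nnegrE ?normc_ge0 ?(sup_le_ge0 pm).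
Qed.

Lemma nrm2_mul_le p q m : sup_le p m -> nrm2 (p * q) <= m ^+ 2 * nrm2 q.
Proof.
move=> pm; set P := (maxn (size (p * q)) (size q)).+1.
have s1 : (size (p * q)%R <= P)%N by rewrite leqW // leq_maxl.
have s2 : (size q <= P)%N by rewrite leqW // leq_maxr.
have P0 : (0 : R) < P%:R by rewrite ltr0n.
rewrite -(ler_pM2l P0) mulrCA !parseval // mulr_sumr; apply: ler_sum => l _.
rewrite hornerM normcM exprMn ler_wpM2r ?sqr_ge0 //.
by rewrite ler_pXn2r ?nnegrE ?normc_ge0 ?(sup_le_ge0 pm).
Qed.

Lemma normc_horner_le n p x : (size p <= n)%N ->
  normc p.[e x] <= \sum_(j < n) normc p`_j.
Proof.
move=> sp; rewrite -(normc_trig 0) (trigE _ _ sp).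
apply: le_trans (normc_sum _ _ _) _; apply: ler_sum => j _.
by rewrite normcM normc_e mulr1.
Qed.

End TrigPolynomials.

(** * Dirichlet kernels and low-pass filters *)

Section Dirichlet.
Variable R : realType.
Implicit Types (p q : {poly R[i]}) (x : R) (D K : nat).

Lemma normc_nat n : normc (n%:R : R[i]) = n%:R.
Proof. by rewrite -(rmorph_nat (real_complex R)) normc_real ger0_norm. Qed.

(** The absolute value |j - D|: at least one of the two truncated differences is zero. *)
Definition freq D j : nat := (j - D + (D - j))%N.

Definition lowpass D K p : {poly R[i]} :=
  \poly_(j < size p) (if (freq D j <= K)%N then p`_j else 0).

Lemma coef_lowpass D K p j :
  (lowpass D K p)`_j = if (freq D j <= K)%N then p`_j else 0.
Proof.
by rewrite coef_poly; case: ltnP => // h; rewrite nth_default // if_same.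
Qed.

Lemma size_lowpass D K p : (size (lowpass D K p) <= size p)%N.
Proof. exact: size_poly. Qed.

Lemma lowpass_id D K p : (size p <= D.*2.+1)%N -> (D <= K)%N -> lowpass D K p = p.
Proof.
move=> sp DK; apply/polyP => j; rewrite coef_lowpass; case: leqP => //.
move=> h; rewrite nth_default //; apply: leq_trans sp _.
by move: h; rewrite /freq; lia.
Qed.

(** A bound for the Lebesgue constant on a grid of 2D + 1 points, that is, for the mean modulus of
    the Dirichlet kernel, whatever the cut-off. It grows like log D. *)
Definition lam D : R := 1 + 2 * \sum_(l < D.*2) l.+1%:R^-1.

Lemma lam_ge1 D : 1 <= lam D.
Proof. by rewrite lerDl mulr_ge0 // sumr_ge0. Qed.

Lemma dirichlet_kernel_le n x : normc (\sum_(i < n) e (i%:R * x)) <= n%:R.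
Proof.
apply: le_trans (normc_sum _ _ _) _.
under eq_bigr do rewrite normc_e.
by rewrite sumr_const card_ord.
Qed.

Lemma dirichlet_kernel_sub1 n x :
  normc (\sum_(i < n) e (i%:R * x)) * normc (e x - 1) <= 2.
Proof.
rewrite -normcM mulrC; under eq_bigr do rewrite eMn.
rewrite -subrX1 -eMn; apply: le_trans (le_normcD _ _) _.
by rewrite normcN normc1 normc_e.
Qed.

Lemma lowpass_kernel_shift D K x : (K <= D)%N ->
  \sum_(j < D.*2.+1 | (freq D j <= K)%N) e ((j%:R - D%:R) * x)
    = e (- (K%:R * x)) * \sum_(i < K.*2.+1) e (i%:R * x).
Proof.
move=> KD; rewrite mulr_sumr.
rewrite -(big_mkord (fun j => (freq D j <= K)%N)
  (fun j => e ((j%:R - D%:R) * x))).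
rewrite (big_cat_nat _ _ (n := (D - K)%N)) //=; last by lia.
rewrite [X in X + _]big_nat_cond big_pred0 => [|j]; last first.
  by apply/negP => /andP[]; rewrite /freq; lia.
rewrite add0r (big_cat_nat _ _ (n := (D + K).+1)) //=; [|lia|lia].
rewrite [X in _ + X]big_nat_cond [X in _ + X]big_pred0 => [|j]; last first.
  by apply/negP => /andP[]; rewrite /freq; lia.
rewrite addr0 big_nat_cond.
rewrite (eq_bigl (fun j => (D - K <= j < (D + K).+1)%N)); last first.
  by move=> j; rewrite /freq; case: (boolP (D - K <= j < _)%N) => //= h; lia.
rewrite -big_nat -{1}[(D - K)%N]add0n big_addn.
have -> : ((D + K).+1 - (D - K))%N = K.*2.+1 by lia.
rewrite big_mkord; apply: eq_bigr => i _.
by rewrite -eD natrD natrB //; congr e; ring.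
Qed.

Lemma trig_lowpass D K p x : (size p <= D.*2.+1)%N ->
  D.*2.+1%:R * trig D (lowpass D K p) x =
  \sum_(l < D.*2.+1) trig D p (x - l%:R / D.*2.+1%:R) *
    \sum_(j < D.*2.+1 | (freq D j <= K)%N)
      e ((j%:R - D%:R) * (l%:R / D.*2.+1%:R)).
Proof.
move=> sp; set P := D.*2.+1.
rewrite (trigE _ _ (leq_trans (size_lowpass D K p) sp)) mulr_sumr.
under [RHS]eq_bigr do rewrite mulr_sumr.
rewrite exchange_big /= [RHS]big_mkcond /=; apply: eq_bigr => j _.
rewrite coef_lowpass; case: ifP => _; last by rewrite mul0r mulr0.
by rewrite (trig_filter D x sp (ltn_ord j)).
Qed.

Lemma lowpass_sup_le D K p (m : R) : (size p <= D.*2.+1)%N -> sup_le p m ->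
  sup_le (lowpass D K p) (lam D * m).
Proof.
move=> sp pm x; have m0 := sup_le_ge0 pm.
have [DK|/ltnW KD] := leqP D K.
  rewrite lowpass_id //; apply: le_trans (pm x) _.
  by rewrite ler_peMl // lam_ge1.
set P := D.*2.+1; have P0 : (0 : R) < P%:R by rewrite ltr0n.
rewrite -(normc_trig D) -(ler_pM2l P0).
have -> : P%:R * normc (trig D (lowpass D K p) x) =
    normc (P%:R * trig D (lowpass D K p) x).
  by rewrite [RHS]normcM normc_nat.
rewrite trig_lowpass // -/P.
apply: le_trans (normc_sum _ _ _) _.
(* The kernel is at most [P] at [l = 0], and elsewhere at most 2 / |e(l/P) - 1|, hence at most P/l
   or P/(P-l) according to the half in which l/P lies. The sum of the two serves both cases and is
   symmetric in [l]. *)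
pose b (l : nat) : R := if l == 0%N then P%:R else P%:R * (l%:R^-1 + (P - l)%:R^-1).
apply: (@le_trans _ _ (\sum_(l < P) m * b l)).
  apply: ler_sum => -[l lP] _; rewrite normcM; apply: ler_pM.
  - exact: normc_ge0.
  - exact: normc_ge0.
  - by rewrite normc_trig.
  rewrite lowpass_kernel_shift // normcM normc_e mul1r /b /=.
  case: eqP => [_|/eqP l0].
    apply: le_trans (dirichlet_kernel_le _ _) _; rewrite ler_nat /P; lia.
  have lr : (0 : R) < l%:R by rewrite ltr0n lt0n.
  have lr' : (0 : R) < (P - l)%:R by rewrite ltr0n subn_gt0.
  have := dirichlet_kernel_sub1 K.*2.+1 (l%:R / P%:R).
  set N := normc _; set E := normc _ => NE.
  have N0 : 0 <= N by exact: normc_ge0.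
  have lP1 : l%:R / P%:R <= 1 :> R by rewrite ler_pdivrMr // mul1r ler_nat ltnW.
  have q0 : 0 <= l%:R / P%:R :> R by rewrite divr_ge0.
  have [h|h] := leP (l%:R / P%:R : R) (1 / 2).
    have h1 : 2 * (l%:R / P%:R) <= E by apply: normc_e_sub1_ge; lra.
    have : N * (2 * (l%:R / P%:R)) <= 2 by apply: le_trans NE; exact: ler_wpM2l.
    rewrite mulrCA -[leRHS]mulr1 ler_pM2l // mulrA ler_pdivrMr // mul1r => h2.
    rewrite mulrDr; apply: (@le_trans _ _ (P%:R / l%:R)).
      by rewrite ler_pdivlMr.
    by rewrite lerDl mulr_ge0.
  have e1 : 1 - l%:R / P%:R = (P - l)%:R / P%:R :> R.
    by rewrite natrB 1?ltnW //; field; rewrite gt_eqF.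
  have h1 : 2 * ((P - l)%:R / P%:R) <= E.
    rewrite -e1; apply: normc_e_sub1_ge'; lra.
  have : N * (2 * ((P - l)%:R / P%:R)) <= 2 by apply: le_trans NE; exact: ler_wpM2l.
  rewrite mulrCA -[leRHS]mulr1 ler_pM2l // mulrA ler_pdivrMr // mul1r => h2.
  rewrite mulrDr; apply: (@le_trans _ _ (P%:R / (P - l)%:R)).
    by rewrite ler_pdivlMr.
  by rewrite lerDr mulr_ge0.
rewrite -mulr_sumr [lam D * m]mulrC [leRHS]mulrCA.
rewrite ler_wpM2l // big_ord_recl /= {1}/b eqxx.
have -> : \sum_(i < D.*2) b (bump 0 i) = P%:R * (2 * \sum_(i < D.*2) i.+1%:R^-1).
  have -> : 2 * \sum_(i < D.*2) i.+1%:R^-1 =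
    \sum_(i < D.*2) (i.+1%:R^-1 + (P - i.+1)%:R^-1) :> R.
    rewrite big_split /= mulr_natl mulr2n; congr (_ + _).
    rewrite (reindex_inj rev_ord_inj) /=; apply: eq_bigr => i _.
    by congr (_%:R^-1); rewrite /P; have := ltn_ord i; lia.
  by rewrite mulr_sumr; apply: eq_bigr => i _; rewrite /b /bump /= add1n.
by rewrite -{1}[P%:R]mulr1 -mulrDr.
Qed.

Lemma harmonic_le n : (0 < n)%N -> \sum_(l < n) l.+1%:R^-1 <= 1 + ln (n%:R : R).
Proof.
case: n => // n _; elim: n => [|n ih].
  by rewrite big_ord1 invr1 ln1 addr0.
rewrite big_ord_recr /=.
suff h : (n.+2%:R : R)^-1 <= ln n.+2%:R - ln n.+1%:R.
  by apply: le_trans (lerD ih h) _; move: (ln _) (ln _) => u v; lra.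
have n1 : (0 : R) < n.+1%:R by rewrite ltr0n.
have n2 : (0 : R) < n.+2%:R by rewrite ltr0n.
have := @le_ln1Dx R (- (n.+2%:R)^-1).
have -> : 1 + - n.+2%:R^-1 = n.+1%:R / n.+2%:R :> R.
  by rewrite -[n.+2%:R]natr1; move: n.+1%:R n1 => a a0; field; apply: lt0r_neq0; lra.
rewrite ln_div ?posrE // => h.
have {}h : ln n.+1%:R - ln n.+2%:R <= - n.+2%:R^-1 :> R.
  by apply: h; rewrite ltrN2 invf_lt1 // ltr1n.
by rewrite -lerN2 opprB.
Qed.

End Dirichlet.

(** * Inequalities for finite sums *)

Section FiniteSums.
Variable R : realType.
Implicit Types f g a b : nat -> R.

Lemma cauchy_schwarz_sum n a b :
  (\sum_(i < n) a i * b i) ^+ 2 <= (\sum_(i < n) a i ^+ 2) * \sum_(i < n) b i ^+ 2.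
Proof.
rewrite expr2 !mulr_suml.
under eq_bigr do rewrite mulr_sumr; under [leRHS]eq_bigr do rewrite mulr_sumr.
have -> : \sum_(i < n) \sum_(j < n) a i ^+ 2 * b j ^+ 2 =
  \sum_(i < n) \sum_(j < n) (a i ^+ 2 * b j ^+ 2 + a j ^+ 2 * b i ^+ 2) / 2.
  under [RHS]eq_bigr do under eq_bigr do rewrite mulrDl.
  under [RHS]eq_bigr do rewrite big_split.
  rewrite big_split /= [X in _ + X]exchange_big /= -big_split /=.
  apply: eq_bigr => i _; rewrite -big_split /=; apply: eq_bigr => j _.
  by field.
apply: ler_sum => i _; apply: ler_sum => j _.
have := sqr_ge0 (a i * b j - a j * b i); rewrite !expr2; lra.
Qed.

(** Young's inequality for the convolution of l^2 with l^1: Cauchy-Schwarz with f sqrt(g) and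
    sqrt(g) leaves the convolution of f^2 with g, whose total mass is the value at 1 of a product of
    two polynomials. *)
Lemma young_sum n M f g : (forall i, 0 <= f i) -> (forall i, 0 <= g i) ->
  (forall i, (n <= i)%N -> f i = 0) -> (forall i, (n <= i)%N -> g i = 0) ->
  \sum_(m < M) (\sum_(i < m.+1) f i * g (m - i)%N) ^+ 2
    <= (\sum_(i < n) f i ^+ 2) * (\sum_(i < n) g i) ^+ 2.
Proof.
move=> f0 g0 fn gn.
set G1 := \sum_(i < n) g i.
have G10 : 0 <= G1 by apply: sumr_ge0.
have part k (h : nat -> R) : (forall i, 0 <= h i) ->
    (forall i, (n <= i)%N -> h i = 0) -> \sum_(i < k) h i <= \sum_(i < n) h i.
  move=> h0 hn; rewrite -(@big_ord_widen0 _ h _ (n + k) (leq_addr _ _)) //.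
  by rewrite addnC big_split_ord /= lerDl sumr_ge0.
pose Q : {poly R} := \poly_(i < n) (f i ^+ 2) * \poly_(i < n) g i.
have Qm m : Q`_m = \sum_(i < m.+1) f i ^+ 2 * g (m - i)%N.
  rewrite coefM; apply: eq_bigr => i _; rewrite !coef_poly.
  case: ltnP => [_|h]; last by rewrite fn ?expr0n ?mul0r.
  by case: ltnP => [//|h]; rewrite gn ?mulr0.
apply: (@le_trans _ _ (\sum_(m < M) Q`_m * G1)).
  apply: ler_sum => -[m /= _] _; rewrite Qm.
  have -> : \sum_(i < m.+1) f i * g (m - i)%N =
     \sum_(i < m.+1) (f i * Num.sqrt (g (m - i)%N)) * Num.sqrt (g (m - i)%N).
    by apply: eq_bigr => i _; rewrite -mulrA -expr2 sqr_sqrtr.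
  apply: le_trans (cauchy_schwarz_sum m.+1
    (fun i => f i * Num.sqrt (g (m - i)%N)) (fun i => Num.sqrt (g (m - i)%N))) _.
  apply: ler_pM; try by apply: sumr_ge0 => i _; exact: sqr_ge0.
    by apply: ler_sum => i _; rewrite exprMn sqr_sqrtr.
  under eq_bigr do rewrite sqr_sqrtr //.
  rewrite (reindex_inj rev_ord_inj) /=.
  rewrite (eq_bigr (fun i : 'I_m.+1 => g i)); last first.
    by move=> i _; rewrite subSS subKn // -ltnS ltn_ord.
  exact: part.
rewrite -mulr_suml [G1 ^+ 2]expr2 mulrA ler_wpM2r //.
have sQ : (size Q <= n + n)%N.
  apply: leq_trans (size_polyMleq _ _) _; rewrite -subn1 leq_subLR.
  apply: leq_trans (leq_add (size_poly _ _) (size_poly _ _)) _.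
  by rewrite add1n leqnSn.
have -> : (\sum_(i < n) f i ^+ 2) * G1 = Q.[1].
  rewrite hornerM !horner_poly; congr (_ * _); apply: eq_bigr => i _;
  by rewrite expr1n mulr1.
have Q0 i : 0 <= Q`_i.
  by rewrite Qm sumr_ge0 // => j _; rewrite mulr_ge0 ?sqr_ge0.
have sQ' : (size Q <= M + (n + n))%N by apply: leq_trans sQ _; rewrite leq_addl.
rewrite (horner_coef_wide _ sQ') big_split_ord /=.
under [X in _ <= X + _]eq_bigr do rewrite expr1n mulr1.
by rewrite lerDl sumr_ge0 // => i _; rewrite expr1n mulr1.
Qed.

Lemma sum_freq D (F : nat -> R) :
  \sum_(j < D.*2.+1) F (freq D j) = F 0%N + 2 * \sum_(k < D) F k.+1.
Proof.
have -> : D.*2.+1 = (D + D.+1)%N by lia.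
rewrite big_split_ord big_ord_recl /=.
have -> : freq D (D + 0) = 0%N by rewrite /freq; lia.
rewrite (reindex_inj rev_ord_inj) /= addrCA; congr (_ + _).
rewrite mulr_natl mulr2n; congr (_ + _); apply: eq_bigr => i _; congr F;
  by have := ltn_ord i; rewrite /freq ?/bump /=; lia.
Qed.

Lemma sum_inv_sqr_le n : \sum_(k < n) (k.+1%:R ^+ 2)^-1 <= 2 :> R.
Proof.
case: n => [|n]; first by rewrite big_ord0.
suff : \sum_(k < n.+1) (k.+1%:R ^+ 2)^-1 <= 2 - (n.+1%:R)^-1 :> R.
  by move=> /le_trans; apply; rewrite lerBlDr lerDl invr_ge0.
elim: n => [|n ih]; first by rewrite big_ord1 expr1n invr1; lra.
rewrite big_ord_recr /= -[n.+2%:R]natr1; move: ih.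
have : (0 : R) < n.+1%:R by rewrite ltr0n.
move: (n.+1%:R : R) => x x0.
have -> : ((x + 1) ^+ 2)^-1 = (x * (x + 1))^-1 - (x * (x + 1) ^+ 2)^-1.
  by field; rewrite !lt0r_neq0 //; lra.
have -> : (x * (x + 1))^-1 = x^-1 - (x + 1)^-1.
  by field; rewrite !lt0r_neq0 //; lra.
have : 0 <= (x * (x + 1) ^+ 2)^-1.
  by rewrite invr_ge0 mulr_ge0 ?sqr_ge0 // ltW.
lra.
Qed.

End FiniteSums.

(** * The implicit diffusion step *)

Section Resolvent.
Variable R : realType.
Implicit Types (p q : {poly R[i]}) (x m : R) (D N : nat).

Definition symbol (a : R) D j : R := 1 + a * kappa R D j ^+ 2.

Definition resolvent (a : R) D p : {poly R[i]} :=
  \poly_(j < size p) (p`_j * (symbol a D j)^-1%:C).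

Lemma coef_resolvent a D p j :
  (resolvent a D p)`_j = p`_j * (symbol a D j)^-1%:C.
Proof. by rewrite coef_poly; case: ltnP => // h; rewrite nth_default ?mul0r. Qed.

Lemma size_resolvent a D p : (size (resolvent a D p) <= size p)%N.
Proof. exact: size_poly. Qed.

Lemma symbol_ge1 a D j : 0 <= a -> 1 <= symbol a D j.
Proof. by move=> a0; rewrite lerDl mulr_ge0 // sqr_ge0. Qed.

Lemma symbol_gt0 a D j : 0 <= a -> 0 < symbol a D j.
Proof. by move=> a0; rewrite (lt_le_trans ltr01) // symbol_ge1. Qed.

Lemma kappa_rev D j : (j <= D.*2)%N -> kappa R D (D.*2 - j) = - kappa R D j.
Proof.
move=> jD; have d2 : D.*2%:R = 2 * D%:R :> R by rewrite -mul2n natrM.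
by rewrite /kappa natrB // d2; ring.
Qed.

Lemma resolvent_eq a D p : 0 <= a ->
  resolvent a D p - a%:C *: dtrig D (dtrig D (resolvent a D p)) = p.
Proof.
move=> a0; apply/polyP => j; rewrite coefB coefZ !coef_dtrig coef_resolvent.
have s0 := symbol_gt0 D j a0; set s := symbol a D j in s0 *.
set z := p`_j * _.
have -> : z - a%:C * ('i * (kappa R D j)%:C * ('i * (kappa R D j)%:C * z)) =
   z * (1 - 'i ^+ 2 * a%:C * (kappa R D j)%:C ^+ 2) by ring.
rewrite sqr_i mulN1r mulNr opprK -rmorphXn -rmorphM -(rmorph1 (real_complex R)).
rewrite -rmorphD -/(symbol a D j) -/s /z -mulrA -rmorphM.
by rewrite mulVf ?rmorph1 ?mulr1 // gt_eqF.
Qed.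

Lemma real_resolvent a D p : real_trig D p -> real_trig D (resolvent a D p).
Proof.
move=> /real_hermitian[sp hp]; apply: hermitian_real; split.
  exact: leq_trans (size_resolvent _ _ _) sp.
move=> j jD; rewrite !coef_resolvent conjcM hp // conjc_real.
by rewrite /symbol kappa_rev // sqrrN.
Qed.

Lemma real_dtrig D p : real_trig D p -> real_trig D (dtrig D p).
Proof.
move=> /real_hermitian[sp hp]; apply: hermitian_real; split.
  exact: leq_trans (size_dtrig _ _) sp.
move=> j jD; rewrite !coef_dtrig !conjcM hp // conjc_real kappa_rev //.
have -> : conjc 'i = - 'i :> R[i] by rewrite /=; simpc.
by rewrite rmorphN; ring.
Qed.

Lemma real_trigM D1 D2 p q : real_trig D1 p -> real_trig D2 q ->
  real_trig (D1 + D2) (p * q).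
Proof.
move=> [sp hp] [sq hq]; split=> [|x].
  apply: leq_trans (size_polyMleq _ _) _; rewrite -subn1 leq_subLR.
  by apply: leq_trans (leq_add sp sq) _; lia.
rewrite -trigM; move: (hp x) (hq x).
by case: (trig D1 p x) (trig D2 q x) => [b c] [b' c'] /= -> ->; rewrite mulr0 mul0r addr0.
Qed.

Lemma real_trigB D p q : real_trig D p -> real_trig D q -> real_trig D (p - q).
Proof.
move=> [sp hp] [sq hq]; split=> [|x].
  by apply: leq_trans (size_polyD _ _) _; rewrite size_polyN geq_max sp.
rewrite trigD trigN; move: (hp x) (hq x).
by case: (trig D p x) (trig D q x) => [b c] [b' c'] /= -> ->; rewrite subr0.
Qed.

Lemma real_trigZ D (c : R) p : real_trig D p -> real_trig D (c%:C *: p).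
Proof.
move=> [sp hp]; split=> [|x].
  exact: leq_trans (size_scale_leq _ _) sp.
rewrite trigZ; move: (hp x).
by case: (trig D p x) => b d /= ->; rewrite mulr0 mul0r addr0.
Qed.

Lemma freq_rev D j : (j <= D.*2)%N -> freq D (D.*2 - j) = freq D j.
Proof. by rewrite /freq; lia. Qed.

Lemma real_lowpass D K p : real_trig D p -> real_trig D (lowpass D K p).
Proof.
move=> /real_hermitian[sp hp]; apply: hermitian_real; split.
  exact: leq_trans (size_lowpass _ _ _) sp.
move=> j jD; rewrite !coef_lowpass freq_rev // -hp //.
by case: ifP => // _; rewrite conjc0.
Qed.

Lemma real_trig_norm D p x : real_trig D p -> normc p.[e x] = `|rtrig D p x|.
Proof. by move=> [_ hp]; rewrite -(normc_trig D) Re_normc_real. Qed.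

Lemma real_trigC D p x : real_trig D p -> (rtrig D p x)%:C = trig D p x.
Proof.
move=> [_ /(_ x)]; rewrite /rtrig.
by case: (trig D p x) => b c /= ->; rewrite complexr0.
Qed.

Lemma rtrigD D p q x : rtrig D (p + q) x = rtrig D p x + rtrig D q x.
Proof. by rewrite /rtrig trigD ReD. Qed.

Lemma rtrigN D p x : rtrig D (- p) x = - rtrig D p x.
Proof. by rewrite /rtrig trigN; case: (trig _ _ _). Qed.

Lemma rtrigZ D (c : R) p x : rtrig D (c%:C *: p) x = c * rtrig D p x.
Proof.
by rewrite /rtrig trigZ; case: (trig _ _ _) => a b /=; rewrite mul0r subr0.
Qed.

Lemma resolvent_rtrig a D p x : 0 <= a -> rtrig D (resolvent a D p) x -
  a * rtrig D (dtrig D (dtrig D (resolvent a D p))) x = rtrig D p x.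
Proof.
by move=> a0; rewrite -[in RHS](resolvent_eq D p a0) rtrigD rtrigN rtrigZ.
Qed.

Lemma resolvent_sup_le a D p m : 0 <= a -> real_trig D p -> sup_le p m ->
  sup_le (resolvent a D p) m.
Proof.
move=> a0 rp pm x; rewrite (real_trig_norm x (real_resolvent a rp)).
apply: (@resolvent_norm_le _ _ (rtrig D (dtrig D (resolvent a D p)))
  (rtrig D (dtrig D (dtrig D (resolvent a D p)))) a) => //.
- exact: rtrig_periodic.
- by move=> y; exact: is_derive_rtrig.
- by move=> y; exact: is_derive_rtrig.
- by move=> y; rewrite resolvent_rtrig // -real_trig_norm.
Qed.

(* For [p >= 0], [h := (1 - a d^2)^-1 p] satisfies [h'' <= h / a]. *)
Lemma dresolvent_sup_le a b D p m : 0 < b -> a * b ^+ 2 = 1 -> real_trig D p ->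
  (forall x, 0 <= rtrig D p x) -> sup_le (resolvent a D p) m ->
  sup_le (dtrig D (resolvent a D p)) (b * m).
Proof.
move=> b0 ab rp p0 hm x.
have a0 : 0 < a.
  by rewrite -(pmulr_lgt0 _ (exprn_gt0 2 b0)) ab ltr01.
rewrite (real_trig_norm x (real_dtrig (real_resolvent a rp))).
apply: (@le_trans _ _ (b * rtrig D (resolvent a D p) x)); last first.
  rewrite ler_wpM2l ?(ltW b0) //; apply: le_trans (hm x).
  by rewrite (real_trig_norm x (real_resolvent a rp)) ler_norm.
apply: (@derive_norm_le_of_second _ (rtrig D (resolvent a D p)) _
   (rtrig D (dtrig D (dtrig D (resolvent a D p))))) => //.
- exact: rtrig_periodic.
- exact: rtrig_periodic.
- by move=> y; exact: is_derive_rtrig.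
- by move=> y; exact: is_derive_rtrig.
- move=> y; rewrite -(ler_pM2l a0) mulrA ab mul1r.
  by have := resolvent_rtrig D p y (ltW a0); have := p0 y; lra.
Qed.

(** The truncation to |k| <= N of a polynomial of half-width [N + N], such as a product; the shift
    moves frequency 0 from index [N + N] to index [N]. *)
Definition proj N q : {poly R[i]} := \poly_(j < N.*2.+1) q`_(j + N).

Lemma coef_proj N q j :
  (proj N q)`_j = if (j <= N.*2)%N then q`_(j + N) else 0.
Proof. by rewrite coef_poly ltnS. Qed.

Lemma size_proj N q : (size (proj N q) <= N.*2.+1)%N.
Proof. exact: size_poly. Qed.

Lemma projE N q : 'X^N * proj N q = lowpass (N + N) N q.
Proof.
apply/polyP => j; rewrite coefXnM coef_lowpass coef_proj; case: ltnP => h.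
  by rewrite ifF //; apply/negP; rewrite /freq; lia.
rewrite subnK //.
have -> : (j - N <= N.*2)%N = (freq (N + N) j <= N)%N by rewrite /freq; lia.
by [].
Qed.

Lemma trig_proj N q x : trig N (proj N q) x = trig (N + N) (lowpass (N + N) N q) x.
Proof. by rewrite -projE trigMXn. Qed.

Lemma real_proj N q : real_trig (N + N) q -> real_trig N (proj N q).
Proof.
move=> rq; split; first exact: size_proj.
by move=> x; rewrite trig_proj; case: (real_lowpass N rq).
Qed.

Lemma nrm2_proj_le N q : nrm2 (proj N q) <= nrm2 q.
Proof.
rewrite (nrm2E (size_proj N q)).
have sq : (size q <= N + (N.*2.+1 + size q))%N by lia.
rewrite (nrm2E sq) !big_split_ord /=.
rewrite (eq_bigr (fun j : 'I_(N.*2.+1) => normc q`_(N + j) ^+ 2)); last first.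
  by move=> j _; rewrite coef_proj -ltnS ltn_ord addnC.
by rewrite addrCA lerDl addr_ge0 // sumr_ge0 // => j _; exact: sqr_ge0.
Qed.

End Resolvent.

(** * The scheme *)

Section Energy.
Variables (R : realType) (nu tau : R) (N : nat).
Hypotheses (nu0 : 0 < nu) (tau0 : 0 < tau).
Implicit Types (p q : {poly R[i]}) (m : R).

Let a := tau * nu ^+ 2.

Let a_gt0 : 0 < a.
Proof. by rewrite mulr_gt0 // exprn_gt0. Qed.

Definition advection p := proj N (p * dtrig N p).

Definition step p := resolvent a N (p - tau%:C *: advection p).

Lemma real_advection p : real_trig N p -> real_trig N (advection p).
Proof.
by move=> rp; apply: real_proj; apply: real_trigM => //; exact: real_dtrig.
Qed.

Lemma real_step p : real_trig N p -> real_trig N (step p).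
Proof.
move=> rp; apply: real_resolvent; apply: real_trigB => //.
by apply: real_trigZ; exact: real_advection.
Qed.

Lemma size_step p : real_trig N p -> (size (step p) <= N.*2.+1)%N.
Proof. by case/real_step. Qed.

Lemma coef_step p j : (symbol a N j)%:C * (step p)`_j =
  p`_j - tau%:C * (advection p)`_j.
Proof.
rewrite coef_resolvent coefB coefZ mulrCA -rmorphM mulfV ?rmorph1 ?mulr1 //.
by rewrite gt_eqF // symbol_gt0 // ltW.
Qed.

Lemma mul_dtrig p : p * dtrig N p = (2^-1)%:C *: dtrig (N + N) (p * p).
Proof.
rewrite dtrigM [dtrig N p * p]mulrC -mulr2n -[X in _ *: X]scaler_nat scalerA.
by rewrite -(rmorph_nat (real_complex R)) -rmorphM mulVf ?pnatr_eq0 // rmorph1 scale1r.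
Qed.

Lemma coef_advection p j : (j <= N.*2)%N ->
  (advection p)`_j = 'i * (kappa R N j / 2)%:C * (p * p)`_(j + N).
Proof.
move=> jN; rewrite coef_proj jN mul_dtrig coefZ coef_dtrig kappaD.
have -> : kappa R N N = 0 by rewrite /kappa subrr mulr0.
by rewrite addr0 [(_ / 2)%:C]rmorphM /=; move: (kappa _ _ _) => k; ring.
Qed.

(* The transport term does not contribute to the energy: [u u u'] is the
   derivative of [u^3 / 3]. *)
Lemma advection_energy p : real_trig N p ->
  \sum_(j < N.*2.+1) conjc p`_j * (advection p)`_j = 0.
Proof.
move=> /real_hermitian[sp hp].
pose D3 := dtrig (N + N + N) (p * p * p).
have c0 : D3`_(N + N + N) = 0.
  rewrite coef_dtrig.
  have -> : kappa R (N + N + N) (N + N + N) = 0 by rewrite /kappa subrr mulr0.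
  by rewrite mulr0 mul0r.
have D3E : D3 = 3%:R *: (p * (p * dtrig N p)).
  rewrite /D3 !dtrigM scaler_nat; ring.
move: c0; rewrite D3E coefZ => /eqP; rewrite mulf_eq0 pnatr_eq0 /= coefM => /eqP c0.
rewrite -[RHS]c0 (reindex_inj rev_ord_inj) /=.
rewrite (eq_bigr (fun i : 'I_N.*2.+1 => p`_i * (p * dtrig N p)`_(N + N + N - i))).
  rewrite -(@big_ord_widen0 _ (fun i => p`_i * (p * dtrig N p)`_(N + N + N - i))
    N.*2.+1 (N + N + N).+1) //; first by lia.
  by move=> j h; rewrite nth_default ?mul0r // (leq_trans sp).
move=> i _; have hi : (i <= N.*2)%N by rewrite -ltnS.
rewrite subSS hp ?leq_subr // subKn // coef_proj leq_subr; congr (_ * _`_ _); lia.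
Qed.

(** Pairing the implicit step with the new value and using 2 Re(conj z' (z' - z)) = |z'|^2 - |z|^2 +
    |z' - z|^2. The increment term is kept, since it absorbs the error of an explicit
    nonlinearity. *)
Lemma energy_mode (z z' r : R[i]) (s : R) :
  (1 + s)%:C * z' = z - tau%:C * r ->
  normc z' ^+ 2 + 2 * s * normc z' ^+ 2 =
  normc z ^+ 2 - normc (z' - z) ^+ 2 - 2 * tau * Re (conjc z' * r).
Proof.
rewrite !sqr_normcE; case: z z' r => [x y] [x' y'] [r1 r2] /= [].
rewrite !mul0r !subr0 !addr0 => hx hy.
have -> : x = (1 + s) * x' + tau * r1 by rewrite hx; ring.
have -> : y = (1 + s) * y' + tau * r2 by rewrite hy; ring.
ring.
Qed.

Lemma energy_step p m : real_trig N p -> sup_le p m ->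
  nrm2 (step p) + 2 * a * nrm2 (dtrig N (step p))
    <= nrm2 p + tau ^+ 2 * m ^+ 2 * nrm2 (dtrig N p).
Proof.
move=> rp pm; have [sp _] := rp; have s' := size_step rp.
have sd : (size (dtrig N (step p)) <= N.*2.+1)%N.
  exact: leq_trans (size_dtrig _ _) s'.
have key (j : 'I_N.*2.+1) : normc (step p)`_j ^+ 2
    + 2 * a * normc (dtrig N (step p))`_j ^+ 2 <=
  normc p`_j ^+ 2 + tau ^+ 2 * normc (advection p)`_j ^+ 2
    - 2 * tau * Re (conjc p`_j * (advection p)`_j).
  have := energy_mode (coef_step p j).
  set z := p`_j; set z' := (step p)`_j; set r := (advection p)`_j => h.
  have -> : normc (dtrig N (step p))`_j ^+ 2 = kappa R N j ^+ 2 * normc z' ^+ 2.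
    rewrite coef_dtrig -/z' !normcM normc_real.
    have -> : normc ('i : R[i]) = 1 by rewrite /= expr0n expr1n add0r sqrtr1.
    by rewrite mul1r exprMn real_normK // num_real.
  rewrite mulrA -[2 * a * _]mulrA h.
  (* The nonlinear term is orthogonal to the old iterate, while the identity pairs it with the new
     one. The difference is absorbed by |z' - z|^2 and leaves tau^2 |r|^2. *)
  have -> : conjc z' * r = conjc z * r + conjc (z' - z) * r.
    by rewrite -mulrDl -rmorphD addrC subrK.
  rewrite ReD.
  have := Re_conjM_le (z' - z) r; rewrite ler_norml => /andP[h1 _].
  have h2 := sqr_ge0 (normc (z' - z) - tau * normc r).
  have : - (2 * tau * Re (conjc (z' - z) * r)) <=
     2 * tau * (normc (z' - z) * normc r).
    rewrite -mulrN ler_pM2l ?mulr_gt0 //; lra.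
  move: h2; rewrite sqrrB exprMn.
  rewrite -mulr_natl; move: (Re _) (Re _) (normc _) (normc _) (normc _) => A B C D E.
  rewrite !expr2; lra.
rewrite (nrm2E s') (nrm2E sd) (nrm2E sp).
have -> : \sum_(j < N.*2.+1) normc (step p)`_j ^+ 2 +
   2 * a * (\sum_(j < N.*2.+1) normc (dtrig N (step p))`_j ^+ 2) =
  \sum_(j < N.*2.+1) (normc (step p)`_j ^+ 2
    + 2 * a * normc (dtrig N (step p))`_j ^+ 2).
  by rewrite big_split /= mulr_sumr.
apply: le_trans (ler_sum _ (fun j _ => key j)) _.
rewrite sumrB !big_split /= -!mulr_sumr -Re_sum advection_energy // mulr0 subr0.
rewrite lerD2l -mulrA ler_wpM2l ?sqr_ge0 //.
rewrite -(nrm2E (size_proj _ _)).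
apply: le_trans (nrm2_proj_le _ _) _; exact: nrm2_mul_le.
Qed.

(* The first step uses the divergence form of the nonlinearity, which requires
   no derivative of the initial datum. *)
Lemma energy_first_step p m : real_trig N p -> sup_le p m ->
  nrm2 (step p) + a * nrm2 (dtrig N (step p))
    <= nrm2 p + tau / (4 * nu ^+ 2) * (m ^+ 2 * nrm2 p).
Proof.
move=> rp pm; have [sp _] := rp; have s' := size_step rp.
have sd : (size (dtrig N (step p)) <= N.*2.+1)%N.
  exact: leq_trans (size_dtrig _ _) s'.
pose w := proj N (p * p).
have key (j : 'I_N.*2.+1) : normc (step p)`_j ^+ 2
    + a * normc (dtrig N (step p))`_j ^+ 2 <=
  normc p`_j ^+ 2 + tau / (4 * nu ^+ 2) * normc w`_j ^+ 2.
  have := energy_mode (coef_step p j).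
  have jN : (j <= N.*2)%N by rewrite -ltnS.
  rewrite coef_advection //.
  have -> : w`_j = (p * p)`_(j + N) by rewrite coef_proj jN.
  set z := p`_j; set z' := (step p)`_j; set r := (p * p)`_(j + N) => h.
  have ni : normc ('i : R[i]) = 1 by rewrite /= expr0n expr1n add0r sqrtr1.
  have -> : normc (dtrig N (step p))`_j ^+ 2 = kappa R N j ^+ 2 * normc z' ^+ 2.
    rewrite coef_dtrig -/z' !normcM normc_real ni.
    by rewrite mul1r exprMn real_normK // num_real.
  have := Re_conjM_le z' ('i * (kappa R N j / 2)%:C * r).
  rewrite !normcM ni mul1r normc_real [`|_ / 2|]normrM [`|2^-1|]ger0_norm //.
  move: h; set k := kappa R N j; set B := Re _ => h.
  rewrite ler_norml => /andP[h1 _].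
  have e1 : normc z' * (`|k| * 2^-1 * normc r) = 2^-1 * (`|k| * normc z' * normc r).
    by ring.
  move: h1; rewrite e1 => {e1} h1.
  have nun : nu != 0 by rewrite gt_eqF.
  have tn : tau != 0 by rewrite gt_eqF.
  have h2 : tau * (`|k| * normc z' * normc r) <=
     a * (k ^+ 2 * normc z' ^+ 2) + tau / (4 * nu ^+ 2) * normc r ^+ 2.
    have := sqr_ge0 (nu * (`|k| * normc z') - normc r / (2 * nu)).
    rewrite -(ler_pM2l tau0) mulr0 => h3.
    have -> : k ^+ 2 = `|k| ^+ 2 by rewrite real_normK // num_real.
    rewrite -subr_ge0; apply: le_trans h3 _.
    by rewrite /a le_eqVlt; apply/orP; left; apply/eqP; field.
  have h4 : - (2 * tau * B) <= tau * (`|k| * normc z' * normc r).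
    have : - (2 * tau * B) <= 2 * tau * (2^-1 * (`|k| * normc z' * normc r)).
      rewrite -mulrN ler_pM2l ?mulr_gt0 //; lra.
    by move=> /le_trans; apply; rewrite le_eqVlt; apply/orP; left; apply/eqP; field.
  have h5 := sqr_ge0 (normc (z' - z)).
  move: h h2 h4 h5; rewrite -/k.
  move: (tau * (_ * _ * _)) (tau / _ * _) (normc _ ^+ 2) (2 * tau * B) => X Y Z W.
  move: (normc z ^+ 2) (normc z' ^+ 2) => U V; rewrite /a => h6 h7 h8 h9.
  have : 2 * (tau * nu ^+ 2 * k ^+ 2) * V = 2 * (tau * nu ^+ 2 * (k ^+ 2 * V)).
    by ring.
  lra.
rewrite (nrm2E s') (nrm2E sd) (nrm2E sp).
have -> : \sum_(j < N.*2.+1) normc (step p)`_j ^+ 2 +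
   a * (\sum_(j < N.*2.+1) normc (dtrig N (step p))`_j ^+ 2) =
  \sum_(j < N.*2.+1) (normc (step p)`_j ^+ 2
    + a * normc (dtrig N (step p))`_j ^+ 2).
  by rewrite big_split /= mulr_sumr.
apply: le_trans (ler_sum _ (fun j _ => key j)) _.
rewrite big_split /= -!mulr_sumr lerD2l -(nrm2E sp).
rewrite ler_wpM2l //.
  by rewrite divr_ge0 ?(ltW tau0) // mulr_ge0 // sqr_ge0.
rewrite -(nrm2E (size_proj _ _)).
apply: le_trans (nrm2_proj_le _ _) _; exact: nrm2_mul_le.
Qed.

End Energy.

(** * Parabolic smoothing of the higher energies *)

Section EnergySmoothing.
Variables (R : realType) (N : nat).
Implicit Types (p q : {poly R[i]}).

Definition energy s p : R :=
  \sum_(j < N.*2.+1) kappa R N j ^+ s.*2 * normc p`_j ^+ 2.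

Lemma kappa_even_ge0 D j s : 0 <= kappa R D j ^+ s.*2.
Proof. by rewrite exprn_even_ge0 // odd_double. Qed.

Lemma kappa_even_norm D j s : kappa R D j ^+ s.*2 = (`|kappa R D j| ^+ s) ^+ 2.
Proof. by rewrite -exprM muln2 -normrX ger0_norm // kappa_even_ge0. Qed.

Lemma energy_ge0 s p : 0 <= energy s p.
Proof.
by apply: sumr_ge0 => j _; rewrite mulr_ge0 ?kappa_even_ge0 // sqr_ge0.
Qed.

Lemma energy0 p : (size p <= N.*2.+1)%N -> energy 0 p = nrm2 p.
Proof.
move=> sp; rewrite (nrm2E sp); apply: eq_bigr => j _.
by rewrite double0 expr0 mul1r.
Qed.

Lemma normc_i : normc ('i : R[i]) = 1.
Proof. by rewrite /= expr0n expr1n add0r sqrtr1. Qed.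

Lemma energy_dtrig s p : energy s (dtrig N p) = energy s.+1 p.
Proof.
apply: eq_bigr => j _; rewrite coef_dtrig !normcM normc_i mul1r normc_real.
by move: (kappa R N j) => k; rewrite exprMn real_normK ?num_real // mulrA -exprD doubleS addn2.
Qed.

Lemma energy1 p : (size p <= N.*2.+1)%N -> energy 1 p = nrm2 (dtrig N p).
Proof.
move=> sp; rewrite -energy_dtrig energy0 //.
exact: leq_trans (size_dtrig _ _) sp.
Qed.

Definition fluct p : {poly R[i]} :=
  \poly_(j < size p) (if j == N then 0 else p`_j).

Lemma coef_fluct p j : (fluct p)`_j = if j == N then 0 else p`_j.
Proof.
by rewrite coef_poly; case: ltnP => // h; rewrite nth_default // if_same.
Qed.

Lemma size_fluct p : (size (fluct p) <= size p)%N.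
Proof. exact: size_poly. Qed.

(** Splits off the mean [c]: its cross term with [p] is transport at constant speed, which
    [smoothing_mode] treats as a Fourier multiplier. Only the square of the fluctuation has to be
    estimated by energies. *)
Lemma sqr_fluct p j : j != N ->
  (p * p)`_(j + N) = 2 * p`_N * p`_j + (fluct p * fluct p)`_(j + N).
Proof.
move=> jN; set c := p`_N; set q := fluct p.
have pE : p = c *: 'X^N + q.
  apply/polyP => i; rewrite coefD coefZ coefXn coef_fluct; case: eqP => [->|_].
    by rewrite mulr1 addr0.
  by rewrite mulr0 add0r.
have -> : p * p = (c * c) *: 'X^(N + N) + (2 * c) *: ('X^N * q) + q * q.
  rewrite {1 2}pE mulrDl !mulrDr exprD -!scalerAl -!scalerAr scalerA.
  rewrite [q * 'X^N]mulrC -!addrA; congr (_ + _).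
  by rewrite addrA -scalerDl mulr_natl mulr2n.
rewrite !coefD !coefZ coefXn coefXnM ifF; last by apply/negbTE; lia.
have -> : (j + N == N + N)%N = false by apply/negbTE; lia.
by rewrite mulr0 add0r addnK coef_fluct (negbTE jN).
Qed.

Lemma kappa_sqr D j : kappa R D j ^+ 2 = (2 * pi) ^+ 2 * (freq D j)%:R ^+ 2.
Proof.
rewrite /kappa exprMn; congr (_ * _); rewrite /freq natrD.
have [h|h] := leqP D j.
  by rewrite (eqP (_ : (D - j)%N == 0%N)) ?subn_eq0 // addr0 natrB.
rewrite (eqP (_ : (j - D)%N == 0%N)) ?subn_eq0 ?(ltnW h) // add0r natrB 1?ltnW //.
by ring.
Qed.

Lemma twopi_ge4 : 4 <= 2 * pi :> R.
Proof. by have := @pi_ge2 R; lra. Qed.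

Lemma sqr_twopi_ge16 : 16 <= (2 * pi) ^+ 2 :> R.
Proof.
have -> : (16 : R) = 4 ^+ 2 by ring.
by rewrite ler_pXn2r ?nnegrE //; have := twopi_ge4; lra.
Qed.

(** Cauchy-Schwarz with the weights 1/|kappa|. Since (2 pi)^2 >= 16, their squares sum to at most 2
    * 2 / 16 over both signs of the frequency. *)
Lemma sum_normc_fluct p : (size p <= N.*2.+1)%N ->
  (\sum_(j < N.*2.+1) normc (fluct p)`_j) ^+ 2 <= energy 1 p.
Proof.
move=> sp; set k := kappa R N.
pose b j : R := if j == N then 0 else `|k j|^-1.
have -> : \sum_(j < N.*2.+1) normc (fluct p)`_j =
    \sum_(j < N.*2.+1) (`|k j| * normc p`_j) * b j.
  apply: eq_bigr => j _; rewrite coef_fluct /b; case: eqP => [_|/eqP jN].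
    by rewrite normc0 mulr0.
  rewrite mulrC mulrA mulVf ?mul1r // normr_eq0 mulf_neq0 //.
    by rewrite mulf_neq0 // gt_eqF // pi_gt0.
  by rewrite subr_eq0 eqr_nat.
apply: le_trans (cauchy_schwarz_sum _ (fun j => `|k j| * normc p`_j) b) _.
rewrite -[leRHS]mulr1; apply: ler_pM.
- by apply: sumr_ge0 => j _; exact: sqr_ge0.
- by apply: sumr_ge0 => j _; exact: sqr_ge0.
- by apply: ler_sum => j _; rewrite exprMn real_normK // num_real.
pose F (f : nat) : R := if f == 0%N then 0 else (16 * f%:R ^+ 2)^-1.
have := sum_freq N F; rewrite /F /= add0r => eF.
apply: (@le_trans _ _ (\sum_(j < N.*2.+1) F (freq N j))).
  apply: ler_sum => j _; rewrite /b /F.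
  have -> : (freq N j == 0)%N = (j == N :> nat) by rewrite /freq; lia.
  case: eqP => [_|/eqP jN]; first by rewrite expr0n.
  have f0 : (0 : R) < (freq N j)%:R by rewrite ltr0n /freq; lia.
  rewrite exprVn real_normK ?num_real // kappa_sqr.
  rewrite lef_pV2 ?posrE ?mulr_gt0 ?exprn_gt0 ?pi_gt0 //.
  by rewrite ler_pM2r ?exprn_gt0 // sqr_twopi_ge16.
rewrite eF.
have -> : \sum_(i < N) (16 * i.+1%:R ^+ 2)^-1 =
    16^-1 * \sum_(i < N) (i.+1%:R ^+ 2)^-1 :> R.
  by rewrite mulr_sumr; apply: eq_bigr => i _; rewrite invfM.
have := sum_inv_sqr_le R N; lra.
Qed.

Lemma sum_expr_le (x y : R) s : 0 <= x -> 0 <= y ->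
  (x + y) ^+ s <= 2 ^+ s * (x ^+ s + y ^+ s).
Proof.
wlog xy : x y / x <= y.
  move=> H x0 y0; have [h|/ltW h] := leP x y; first exact: H.
  by rewrite addrC [x ^+ s + _]addrC; exact: H.
move=> x0 y0; apply: (@le_trans _ _ ((2 * y) ^+ s)).
  rewrite lerXn2r ?nnegrE ?addr_ge0 ?mulr_ge0 //; lra.
by rewrite exprMn ler_wpM2l ?exprn_ge0 // lerDr exprn_ge0.
Qed.

(** A product estimate: |k1 + k2|^s <= 2^s (|k1|^s + |k2|^s) puts all derivatives on one factor, and
    Young's inequality takes the other factor in l^1, where [sum_normc_fluct] bounds it. *)
Lemma energy_sqr_fluct s p : (size p <= N.*2.+1)%N -> (0 < s)%N ->
  \sum_(j < N.*2.+1) kappa R N j ^+ s.*2 *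
      normc (fluct p * fluct p)`_(j + N) ^+ 2
    <= 4 ^+ s.+1 * (energy s p * energy 1 p).
Proof.
move=> sp s0; set q := fluct p.
have sq : (size q <= N.*2.+1)%N by apply: leq_trans (size_fluct _) sp.
pose f i : R := `|kappa R N i| ^+ s * normc q`_i.
pose g i : R := normc q`_i.
have f0 i : 0 <= f i by rewrite mulr_ge0 ?exprn_ge0 ?normc_ge0.
have g0 i : 0 <= g i by exact: normc_ge0.
have gn i : (N.*2.+1 <= i)%N -> g i = 0.
  by move=> h; rewrite /g nth_default ?normc0 // (leq_trans sq).
have fn i : (N.*2.+1 <= i)%N -> f i = 0.
  by move=> /gn; rewrite /f -/(g i) => ->; rewrite mulr0.
have key m : `|kappa R (N + N) m| ^+ s * normc (q * q)`_m <=
    2 ^+ s.+1 * \sum_(i < m.+1) f i * g (m - i)%N.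
  rewrite coefM.
  apply: (@le_trans _ _ (\sum_(i < m.+1)
     2 ^+ s * (f i * g (m - i)%N + f (m - i)%N * g i))).
    apply: le_trans (ler_wpM2l (exprn_ge0 _ (normr_ge0 _)) (normc_sum _ _ _)) _.
    rewrite mulr_sumr; apply: ler_sum => i _; rewrite normcM.
    have im : (i <= m)%N by rewrite -ltnS.
    rewrite -{1}(subnKC im) kappaD.
    have h : `|kappa R N i + kappa R N (m - i)| ^+ s <=
       2 ^+ s * (`|kappa R N i| ^+ s + `|kappa R N (m - i)| ^+ s).
      apply: le_trans (sum_expr_le s (normr_ge0 _) (normr_ge0 _)).
      by rewrite lerXn2r ?nnegrE ?addr_ge0 // ler_normD.
    apply: le_trans (ler_wpM2r _ h) _; first by rewrite mulr_ge0 ?normc_ge0.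
    rewrite -mulrA ler_wpM2l ?exprn_ge0 // /f /g le_eqVlt; apply/orP; left.
    by apply/eqP; ring.
  rewrite -mulr_sumr exprSr -mulrA ler_wpM2l ?exprn_ge0 // big_split /=.
  rewrite [X in _ + X](reindex_inj rev_ord_inj) /=.
  rewrite [X in _ + X](eq_bigr (fun i : 'I_m.+1 => f i * g (m - i)%N)).
    by rewrite mulr_natl mulr2n.
  by move=> i _; rewrite subSS subKn // -ltnS.
apply: (@le_trans _ _ (\sum_(m < (N + N.*2.+1)%N)
   (2 ^+ s.+1 * \sum_(i < m.+1) f i * g (m - i)%N) ^+ 2)).
  rewrite big_split_ord /=.
  apply: (@le_trans _ _ (\sum_(j < N.*2.+1)
   (2 ^+ s.+1 * \sum_(i < (N + j).+1) f i * g (N + j - i)%N) ^+ 2)); last first.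
    by rewrite lerDr sumr_ge0 // => i _; exact: sqr_ge0.
  apply: ler_sum => j _; rewrite kappa_even_norm -exprMn.
  have -> : kappa R N j = kappa R (N + N) (N + j).
    by rewrite kappaD {2}/kappa subrr mulr0 add0r.
  rewrite addnC lerXn2r ?nnegrE ?mulr_ge0 ?exprn_ge0 ?normc_ge0 //.
  by rewrite sumr_ge0 // => i _; rewrite mulr_ge0.
under eq_bigr do rewrite exprMn.
rewrite -mulr_sumr -exprM mulnC exprM.
have -> : (2 : R) ^+ 2 = 4 by ring.
rewrite ler_wpM2l ?exprn_ge0 //.
apply: le_trans (young_sum (N + N.*2.+1) f0 g0 fn gn) _.
apply: ler_pM; [by apply: sumr_ge0 => i _; exact: sqr_ge0|exact: sqr_ge0| |].
  apply: ler_sum => i _; rewrite /f exprMn -kappa_even_norm coef_fluct.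
  case: eqP => _ //; rewrite normc0 expr0n mulr0.
  by rewrite mulr_ge0 ?kappa_even_ge0 ?sqr_ge0.
exact: sum_normc_fluct.
Qed.

Variables (nu tau : R).
Hypotheses (nu0 : 0 < nu) (tau0 : 0 < tau).

Lemma amgm_sqr (x u v : R) : 0 <= u -> 0 <= v -> x ^+ 2 <= u * v -> 2 * x <= u + v.
Proof.
move=> u0 v0 h; have [x0|x0] := leP x 0; first lra.
rewrite -(@ler_pXn2r _ 2) ?nnegrE ?addr_ge0 //; last lra.
by move: h; have := sqr_ge0 (u - v); rewrite !expr2; lra.
Qed.

(** Transport by the mean multiplies a mode by 1 - i tau k c. With x = tau nu^2 k^2, the hypothesis
    on [c] bounds its squared modulus by 1 + x/2: half of the implicit damping pays for it, the
    other half for the cross term with [w]. *)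
Lemma smoothing_mode (z z' w : R[i]) (k c : R) : tau * c ^+ 2 <= nu ^+ 2 / 2 ->
  (1 + tau * nu ^+ 2 * k ^+ 2)%:C * z' =
    z - tau%:C * ('i * (k / 2)%:C * (2 * c%:C * z + w)) ->
  (1 + tau * nu ^+ 2 * k ^+ 2) * normc z' ^+ 2
    <= normc z ^+ 2 + tau / (2 * nu ^+ 2) * normc w ^+ 2.
Proof.
move=> hc; set x := tau * nu ^+ 2 * k ^+ 2.
have x0 : 0 <= x by rewrite mulr_ge0 ?sqr_ge0 // mulr_ge0 ?sqr_ge0 // ltW.
set b := tau / (2 * nu ^+ 2).
have b0 : 0 <= b by rewrite divr_ge0 ?(ltW tau0) // mulr_ge0 // sqr_ge0.
have -> : z - tau%:C * ('i * (k / 2)%:C * (2 * c%:C * z + w)) =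
   z * (1 +i* (- (tau * k * c))) - 'i * (tau * k / 2)%:C * w.
  have -> : 1 +i* (- (tau * k * c)) = 1 - 'i * (tau * k * c)%:C.
    by simpc.
  have -> : (k / 2)%:C = 2^-1 * k%:C :> R[i].
    by rewrite rmorphM /= fmorphV rmorph_nat mulrC.
  have -> : (tau * k / 2)%:C = 2^-1 * tau%:C * k%:C :> R[i].
    by rewrite !rmorphM /= fmorphV rmorph_nat; ring.
  by rewrite !rmorphM /=; field.
move=> /(congr1 (@normc R)); rewrite normcM normc_real ger0_norm; last by lra.
move=> e.
have h1 : (1 + x) * normc z' <= normc z * normc (1 +i* (- (tau * k * c)))
    + `|tau * k / 2| * normc w.
  rewrite e; apply: le_trans (le_normcD _ _) _.
  by rewrite normcN !normcM normc_i mul1r normc_real.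
set P := normc (1 +i* _) in h1; set Q := `|_ / 2| in h1.
have P2 : P ^+ 2 <= 1 + x / 2.
  rewrite /P sqr_normcE /= sqrrN expr1n lerD2l.
  have -> : (tau * k * c) ^+ 2 = tau * k ^+ 2 * (tau * c ^+ 2) by ring.
  have : tau * k ^+ 2 * (tau * c ^+ 2) <= tau * k ^+ 2 * (nu ^+ 2 / 2).
    by rewrite ler_wpM2l // mulr_ge0 ?sqr_ge0 // ltW.
  by rewrite /x; lra.
have Q2 : Q ^+ 2 = b * (x / 2).
  rewrite /Q real_normK ?num_real // /b /x; field.
  by rewrite gt_eqF.
have P0 : 0 <= P by exact: normc_ge0.
have Q0 : 0 <= Q by exact: normr_ge0.
have Z0 := normc_ge0 z; have W0 := normc_ge0 w; have Z'0 := normc_ge0 z'.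
move: h1 P2 Q2 P0 Q0 Z0 W0 Z'0.
move: (normc z) (normc w) (normc z') => Z W Z' h1 P2 Q2 P0 Q0 Z0 W0 Z'0.
have x1 : 0 < 1 + x by lra.
rewrite -(ler_pM2l x1).
apply: (@le_trans _ _ ((Z * P + Q * W) ^+ 2)).
  have l0 : 0 <= (1 + x) * Z' by rewrite mulr_ge0 // ltW.
  have r0 : 0 <= Z * P + Q * W by rewrite addr_ge0 // mulr_ge0.
  by rewrite mulrA -expr2 -exprMn lerXn2r.
have h2 : 2 * (Z * P * (Q * W)) <= (b * W ^+ 2) * P ^+ 2 + (x / 2) * Z ^+ 2.
  have u0 : 0 <= (b * W ^+ 2) * P ^+ 2.
    by rewrite mulr_ge0 ?sqr_ge0 // mulr_ge0 ?sqr_ge0.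
  have v0 : 0 <= (x / 2) * Z ^+ 2 by rewrite mulr_ge0 ?sqr_ge0 // divr_ge0.
  apply: (amgm_sqr u0 v0).
  rewrite !exprMn Q2 le_eqVlt; apply/orP; left; apply/eqP; ring.
have h3 : b * W ^+ 2 * P ^+ 2 <= b * W ^+ 2 * (1 + x / 2).
  by rewrite ler_wpM2l // mulr_ge0 ?sqr_ge0.
have h4 : Z ^+ 2 * P ^+ 2 <= Z ^+ 2 * (1 + x / 2) by rewrite ler_wpM2l ?sqr_ge0.
rewrite sqrrD !exprMn Q2 mulr2n.
lra.
Qed.

Lemma energy_smoothing_step s p : real_trig N p -> (0 < s)%N ->
  tau * Re p`_N ^+ 2 <= nu ^+ 2 / 2 ->
  energy s (step nu tau N p) + tau * nu ^+ 2 * energy s.+1 (step nu tau N p)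
    <= (1 + 4 ^+ s.+1 / (2 * nu ^+ 2) * (tau * energy 1 p)) * energy s p.
Proof.
move=> rp s0 hc; have [sp hp] := real_hermitian rp.
have cN : p`_N = (Re p`_N)%:C.
  have : conjc p`_N = p`_N.
    by rewrite hp -addnn ?addnK // leq_addr.
  by case: (p`_N) => u v /= [] h; have -> : v = 0 by lra.
set w := fun j => (fluct p * fluct p)`_(j + N).
have key (j : 'I_N.*2.+1) :
    kappa R N j ^+ s.*2 * normc (step nu tau N p)`_j ^+ 2 +
    tau * nu ^+ 2 * (kappa R N j ^+ s.+1.*2 * normc (step nu tau N p)`_j ^+ 2)
    <= kappa R N j ^+ s.*2 * normc p`_j ^+ 2
      + tau / (2 * nu ^+ 2) * (kappa R N j ^+ s.*2 * normc (w j) ^+ 2).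
  (* At frequency 0 the weights of both orders vanish because [0 < s]. *)
  have [jN|jN] := eqVneq (j : nat) N.
    rewrite jN; have -> : kappa R N N = 0 by rewrite /kappa subrr mulr0.
    by rewrite !expr0n !double_eq0 eqn0Ngt s0 /= !mul0r !mulr0.
  have := coef_step N nu0 tau0 p j.
  have jN2 : (j <= N.*2)%N by rewrite -ltnS.
  rewrite (coef_advection p jN2) (sqr_fluct p jN) {1}cN => h.
  have := smoothing_mode hc h; rewrite -/(w j).
  set k := kappa R N j => h2.
  have -> : k ^+ s.+1.*2 = k ^+ s.*2 * k ^+ 2 by rewrite -exprD doubleS addn2.
  have := ler_wpM2l (kappa_even_ge0 N j s) h2; rewrite -/k.
  move: (k ^+ s.*2) (normc _ ^+ 2) (normc _ ^+ 2) (normc _ ^+ 2) => A B C D; lra.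
rewrite /energy mulr_sumr -big_split /=.
apply: le_trans (ler_sum _ (fun j _ => key j)) _.
rewrite big_split /= -mulr_sumr -/(energy s p) -/(energy 1 p) [leRHS]mulrDl mul1r lerD2l.
have h := energy_sqr_fluct sp s0.
have c0 : 0 <= tau / (2 * nu ^+ 2).
  by rewrite divr_ge0 ?(ltW tau0) // mulr_ge0 // sqr_ge0.
apply: le_trans (ler_wpM2l c0 h) _.
move: (4 ^+ s.+1) (energy s p) (energy 1 p) => A B C.
by rewrite le_eqVlt; apply/orP; left; apply/eqP; field; rewrite gt_eqF.
Qed.

End EnergySmoothing.

(** * Sup-norm bounds for derivatives and for the truncated frequencies *)

Section SupNorm.
Variable R : realType.
Implicit Types (p q : {poly R[i]}) (D N K : nat).

Lemma sup_leD p q (a b : R) : sup_le p a -> sup_le q b -> sup_le (p + q) (a + b).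
Proof.
move=> pa qb x; rewrite hornerD; apply: le_trans (le_normcD _ _) _.
exact: lerD (pa x) (qb x).
Qed.

Lemma sup_leN p (a : R) : sup_le p a -> sup_le (- p) a.
Proof. by move=> pa x; rewrite hornerN normcN. Qed.

Lemma sup_leB p q (a b : R) : sup_le p a -> sup_le q b -> sup_le (p - q) (a + b).
Proof. by move=> pa qb; apply: sup_leD => //; exact: sup_leN. Qed.

Lemma sup_leZ (c : R) p (a : R) : 0 <= c -> sup_le p a -> sup_le (c%:C *: p) (c * a).
Proof.
move=> c0 pa x; rewrite hornerZ normcM normc_real ger0_norm //.
exact: ler_wpM2l.
Qed.

Lemma sup_le_trans p (a b : R) : a <= b -> sup_le p a -> sup_le p b.
Proof. by move=> ab pa x; exact: le_trans (pa x) ab. Qed.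

Lemma sup_leM p q (a b : R) : sup_le p a -> sup_le q b -> sup_le (p * q) (a * b).
Proof.
move=> pa qb x; rewrite hornerM normcM; apply: ler_pM => //; exact: normc_ge0.
Qed.

Lemma sup_le_sum n p (a : R) : (size p <= n)%N ->
  \sum_(j < n) normc p`_j <= a -> sup_le p a.
Proof. by move=> sp h x; apply: le_trans (normc_horner_le x sp) h. Qed.

Lemma sup_le_proj N q (a : R) : sup_le (lowpass (N + N) N q) a -> sup_le (proj N q) a.
Proof. by move=> h x; rewrite -(normc_trig N) trig_proj normc_trig. Qed.

Lemma rtrig_norm_sup D p (a : R) x : sup_le p a -> `|rtrig D p x| <= a.
Proof. by move=> pa; apply: le_trans (norm_rtrig_le D p x) (pa x). Qed.

Lemma rtrigM D1 D2 p q x : real_trig D1 p ->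
  rtrig (D1 + D2) (p * q) x = rtrig D1 p x * rtrig D2 q x.
Proof.
move=> [_ /(_ x)]; rewrite /rtrig -trigM.
by case: (trig D1 p x) (trig D2 q x) => [a b] [c d] /= ->; rewrite mul0r subr0.
Qed.

Lemma sum_normc_le n p : (\sum_(j < n) normc p`_j) ^+ 2 <= n%:R * nrm2 p.
Proof.
have -> : \sum_(j < n) normc p`_j = \sum_(j < n) 1 * normc p`_j.
  by apply: eq_bigr => j _; rewrite mul1r.
apply: le_trans (cauchy_schwarz_sum n (fun=> 1) (fun j => normc p`_j)) _.
apply: ler_pM.
- by apply: sumr_ge0 => j _; exact: sqr_ge0.
- by apply: sumr_ge0 => j _; exact: sqr_ge0.
- by under eq_bigr do rewrite expr1n; rewrite sumr_const card_ord.
rewrite (nrm2E (leq_addl n (size p))) big_split_ord /= lerDl.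
by apply: sumr_ge0 => j _; exact: sqr_ge0.
Qed.

Lemma sup_le_nrm2 n p : (size p <= n)%N -> sup_le p (Num.sqrt (n%:R * nrm2 p)).
Proof.
move=> sp; apply: (sup_le_sum sp).
have s0 : 0 <= \sum_(j < n) normc p`_j.
  by apply: sumr_ge0 => j _; exact: normc_ge0.
rewrite -(ger0_norm s0) -sqrtr_sqr ler_sqrt ?sum_normc_le //.
by rewrite mulr_ge0 ?nrm2_ge0.
Qed.

(** A second derivative has mean zero, so [sum_normc_fluct] bounds all of it by its order-1 energy.
    This is why order 3 is the one to follow. *)
Lemma sup_le_second_derivative N p : (size p <= N.*2.+1)%N ->
  sup_le (dtrig N (dtrig N p)) (Num.sqrt (energy N 3 p)).
Proof.
move=> sp; set q := dtrig N _.
have sq : (size q <= N.*2.+1)%N.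
  by apply: leq_trans (size_dtrig _ _) _; apply: leq_trans (size_dtrig _ _) _.
have k0 : kappa R N N = 0 by rewrite /kappa subrr mulr0.
apply: (sup_le_sum sq).
have s0 : 0 <= \sum_(j < N.*2.+1) normc q`_j.
  by apply: sumr_ge0 => j _; exact: normc_ge0.
have -> : energy N 3 p = energy N 1 q by rewrite !energy_dtrig.
rewrite -(ger0_norm s0) -sqrtr_sqr ler_sqrt ?energy_ge0 //.
have := sum_normc_fluct sq.
rewrite (eq_bigr (fun j : 'I_N.*2.+1 => normc q`_j)) // => j _.
rewrite coef_fluct; case: eqP => [->|//].
by rewrite /q !coef_dtrig k0 mulr0 !mul0r.
Qed.

Lemma freq_le D j : (j <= D.*2)%N -> (freq D j <= D)%N.
Proof. by rewrite /freq; lia. Qed.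

Lemma kappa_norm D j : `|kappa R D j| = 2 * pi * (freq D j)%:R.
Proof.
have p0 : 0 <= 2 * pi * (freq D j)%:R :> R.
  by rewrite mulr_ge0 // mulr_ge0 // pi_ge0.
apply/eqP; rewrite -(@eqrXn2 _ 2) // real_normK ?num_real // kappa_sqr.
by apply/eqP; rewrite [RHS]exprMn.
Qed.

Lemma twopi_le8 : 2 * pi <= 8 :> R.
Proof. by have := @pihalf_lt2 R; lra. Qed.

Lemma nrm2_dtrig_le N p : (size p <= N.*2.+1)%N ->
  nrm2 (dtrig N p) <= (8 * N%:R) ^+ 2 * nrm2 p.
Proof.
move=> sp; have sd : (size (dtrig N p) <= N.*2.+1)%N.
  exact: leq_trans (size_dtrig _ _) sp.
rewrite (nrm2E sd) (nrm2E sp) mulr_sumr; apply: ler_sum => j _.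
rewrite coef_dtrig !normcM normc_i mul1r normc_real.
rewrite [_ ^+ 2]exprMn ler_wpM2r ?sqr_ge0 // kappa_norm.
have p0 : 0 <= 2 * pi :> R by rewrite mulr_ge0 // pi_ge0.
have f0 : 0 <= 2 * pi * (freq N j)%:R :> R by exact: mulr_ge0.
have n0 : 0 <= 8 * N%:R :> R by exact: mulr_ge0.
rewrite lerXn2r // ler_pM ?twopi_le8 //.
by rewrite ler_nat freq_le // -ltnS.
Qed.

(** Meant for early times, before smoothing acts: in the interpolation the second derivative is
    bounded from the L^2 norm alone, by Bernstein and Cauchy-Schwarz over the 2N + 1
    coefficients. *)
Lemma sup_le_derivative N p (m h : R) : real_trig N p -> sup_le p m -> 0 < h ->
  sup_le (dtrig N p)
    (2 * m / h + (8 * N%:R) ^+ 2 * Num.sqrt (N.*2.+1%:R * nrm2 p) * h).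
Proof.
move=> rp pm h0 x; have [sp _] := rp.
have rd := real_dtrig rp; have [sd _] := rd; have [sd2 _] := real_dtrig rd.
rewrite (real_trig_norm x rd).
apply: (@derive_bound_interpolation _ (rtrig N p) _
   (rtrig N (dtrig N (dtrig N p)))) => //.
- by move=> y; exact: is_derive_rtrig.
- by move=> y; exact: is_derive_rtrig.
- by move=> y; exact: rtrig_norm_sup.
move=> y; apply: rtrig_norm_sup.
apply: sup_le_trans (sup_le_nrm2 sd2).
have N0 : (0 : R) <= N.*2.+1%:R by [].
have e4 : (8 * N%:R) ^+ 2 * Num.sqrt (N.*2.+1%:R * nrm2 p) =
    Num.sqrt (((8 * N%:R) ^+ 2) ^+ 2 * (N.*2.+1%:R * nrm2 p)).
  rewrite [RHS]sqrtrM ?sqr_ge0 // sqrtr_sqr ger0_norm // sqr_ge0 //.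
rewrite e4 ler_sqrt; last first.
  by rewrite mulr_ge0 ?sqr_ge0 // mulr_ge0 // nrm2_ge0.
rewrite mulrCA ler_wpM2l // expr2 -mulrA.
apply: le_trans (nrm2_dtrig_le sd) _.
by rewrite ler_wpM2l ?sqr_ge0 // nrm2_dtrig_le.
Qed.

Lemma high_advection_early N p (m X : R) : real_trig N p -> sup_le p m ->
  sup_le (dtrig N p) X ->
  sup_le (p * dtrig N p - lowpass (N + N) N (p * dtrig N p))
    ((1 + lam R (N + N)) * (m * X)).
Proof.
move=> rp pm dX; have [sq _] := real_trigM rp (real_dtrig rp).
rewrite mulrDl mul1r; apply: sup_leB; first exact: sup_leM.
by apply: lowpass_sup_le => //; exact: sup_leM.
Qed.

Lemma nrm2_highpass_le N p : (size p <= N.*2.+1)%N ->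
  N%:R ^+ 6 * nrm2 (p - lowpass N N./2 p) <= energy N 3 p.
Proof.
move=> sp; have sl : (size (p - lowpass N N./2 p)%R <= N.*2.+1)%N.
  apply: leq_trans (size_polyD _ _) _; rewrite size_polyN geq_max sp.
  exact: leq_trans (size_lowpass _ _ _) sp.
rewrite (nrm2E sl) mulr_sumr; apply: ler_sum => j _.
rewrite coefB coef_lowpass; case: leqP => h.
  by rewrite subrr normc0 expr0n mulr0 mulr_ge0 ?sqr_ge0 ?kappa_even_ge0.
rewrite subr0 ler_wpM2r ?sqr_ge0 // kappa_even_norm -exprM kappa_norm.
rewrite lerXn2r ?nnegrE ?mulr_ge0 ?pi_ge0 //.
have h2 : (N <= 2 * freq N j)%N by lia.
have : (N%:R : R) <= 2 * (freq N j)%:R by rewrite -natrM ler_nat.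
have := twopi_ge4 R; have : (0 : R) <= (freq N j)%:R by [].
move: (2 * pi) (N%:R) ((freq N j)%:R) => P n f f0 P4 nf.
have : 4 * f <= P * f by rewrite ler_wpM2r.
lra.
Qed.

Lemma lowpass_sqr_coef N K p m : (K + K <= N)%N -> (N < freq (N + N) m)%N ->
  (lowpass N K p * lowpass N K p)`_m = 0.
Proof.
move=> KN hm; rewrite coefM big1 // => i _; rewrite !coef_lowpass.
case: leqP => [h1|_]; last by rewrite mul0r.
case: leqP => [h2|_]; last by rewrite mulr0.
by move: hm h1 h2 (ltn_ord i); rewrite /freq; lia.
Qed.

(* Only products with a factor of frequency above [N/2] reach frequencies
   above [N]. *)
Lemma high_advection_late N p (m : R) : (0 < N)%N -> real_trig N p ->
  sup_le p m ->
  sup_le (p * dtrig N p - lowpass (N + N) N (p * dtrig N p))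
    (24 * pow32V N%:R * ((1 + lam R N) * m * Num.sqrt (energy N 3 p))).
Proof.
move=> N0 rp pm; have [sp _] := rp.
set q := p * dtrig N p; have [sq _] : real_trig (N + N) q.
  by apply: real_trigM => //; exact: real_dtrig.
have m0 := sup_le_ge0 pm.
set pl := lowpass N N./2 p.
(* This is p^2 - pl^2, and pl^2 has no frequency above [N]. The first factor is small in L^2, the
   second is bounded in sup norm. *)
set r := (p - pl) * (p + pl).
have sl : (size (q - lowpass (N + N) N q)%R <= (N + N).*2.+1)%N.
  apply: leq_trans (size_polyD _ _) _; rewrite size_polyN geq_max sq.
  exact: leq_trans (size_lowpass _ _ _) sq.
have n0 : (0 : R) < N%:R by rewrite ltr0n.
have coef_le (j : 'I_(N + N).*2.+1) :
    normc (q - lowpass (N + N) N q)`_j <= 8 * N%:R * normc r`_j.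
  rewrite coefB coef_lowpass; case: leqP => h.
    by rewrite subrr normc0 mulr_ge0 ?normc_ge0 // mulr_ge0.
  rewrite subr0 /q mul_dtrig coefZ coef_dtrig.
  have -> : (p * p)`_j = r`_j.
    have -> : p * p = r + pl * pl by rewrite /r; ring.
    rewrite coefD (lowpass_sqr_coef p _ h) ?addr0 //; lia.
  rewrite !normcM normc_i mul1r !normc_real mulrA ler_wpM2r ?normc_ge0 //.
  rewrite ger0_norm // kappa_norm.
  have : (freq (N + N) j)%:R <= 2 * N%:R :> R.
    have jl : (j <= (N + N).*2)%N by rewrite -ltnS.
    by have := freq_le jl; rewrite -natrM ler_nat; move: (freq _ _) => f; lia.
  have := twopi_le8; have := twopi_ge4 R.
  have : (0 : R) <= (freq (N + N) j)%:R by [].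
  move: (2 * pi) (N%:R) ((freq (N + N) j)%:R) n0 => P n f n0 f0 P4 P8 fn.
  have : P * f <= 8 * (2 * n) by apply: ler_pM => //; lra.
  lra.
apply: (sup_le_sum sl).
apply: le_trans (ler_sum _ (fun j _ => coef_le j)) _.
rewrite -mulr_sumr.
have S0 : 0 <= \sum_(j < (N + N).*2.+1) normc r`_j.
  by apply: sumr_ge0 => j _; exact: normc_ge0.
have rle : nrm2 r <= ((1 + lam R N) * m) ^+ 2 * nrm2 (p - pl).
  rewrite /r mulrC; apply: nrm2_mul_le.
  rewrite mulrDl mul1r; apply: sup_leD => //.
  exact: lowpass_sup_le.
have hp := nrm2_highpass_le sp; rewrite -/pl in hp.
have L0 : 0 <= (1 + lam R N) * m.
  by rewrite mulr_ge0 // addr_ge0 // (le_trans ler01) // lam_ge1.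
have E0 := energy_ge0 N 3 p.
set E := energy N 3 p in hp E0 *; set L := (1 + lam R N) * m in rle L0 *.
clearbody L E.
have sn : (N + N).*2.+1%:R <= 5 * N%:R :> R.
  rewrite -natrM ler_nat; lia.
have S2 := sum_normc_le (N + N).*2.+1 r.
set S := \sum_(j < _) _ in S0 S2 *.
(* The powers of [N]: one derivative gives N, summing 4N + 1 coefficients gives N^(1/2), the order-3
   energy of the high part gives N^(-3). The total is N^(-3/2), with 24 = 8 * 3 and sqrt 5 <= 3. *)
have hS : (N%:R ^+ 3 * S) ^+ 2 <= 5 * N%:R * (L ^+ 2 * E).
  rewrite exprMn -exprM.
  apply: (@le_trans _ _ (N%:R ^+ 6 * (5 * N%:R * (L ^+ 2 * nrm2 (p - pl))))).
    rewrite ler_wpM2l ?exprn_ge0 // (le_trans S2) // ler_pM ?nrm2_ge0 //.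
  have -> : N%:R ^+ 6 * (5 * N%:R * (L ^+ 2 * nrm2 (p - pl))) =
     5 * N%:R * (L ^+ 2 * (N%:R ^+ 6 * nrm2 (p - pl))) by ring.
  by rewrite ler_wpM2l ?mulr_ge0 // ler_wpM2l ?sqr_ge0.
have hs : N%:R ^+ 3 * S <= 3 * Num.sqrt N%:R * (L * Num.sqrt E).
  rewrite -(@ler_pXn2r _ 2) ?nnegrE ?mulr_ge0 ?exprn_ge0 ?sqrtr_ge0 //.
  apply: le_trans hS _; rewrite !exprMn !sqr_sqrtr //.
  rewrite ler_wpM2r ?mulr_ge0 ?sqr_ge0 //.
  by rewrite ler_wpM2r //; lra.
rewrite /pow32V.
have sn0 : 0 < Num.sqrt (N%:R : R) by rewrite sqrtr_gt0.
have sN : Num.sqrt (N%:R : R) ^+ 2 = N%:R by rewrite sqr_sqrtr.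
move: hs sn0 sN; move: (Num.sqrt (N%:R : R)) (L * Num.sqrt E) => w F hs w0 wN.
rewrite -wN in hs *.
have -> : 24 * (w ^+ 2 * w)^-1 * F = 8 * w ^+ 2 * ((w ^+ 2) ^+ 3)^-1 * (3 * w * F).
  by field; rewrite gt_eqF.
have w8 : 0 <= 8 * w ^+ 2 by rewrite mulr_ge0 ?sqr_ge0.
rewrite -[leRHS]mulrA ler_wpM2l //.
by rewrite ler_pdivlMl // !exprn_gt0.
Qed.

End SupNorm.

(** * Growth of the sup norm in one step *)

Section StepSup.
Variables (R : realType) (nu tau : R) (N : nat).
Hypotheses (nu0 : 0 < nu) (tau0 : 0 < tau).
Implicit Types (p q : {poly R[i]}).

Let a := tau * nu ^+ 2.
Let b := (nu * Num.sqrt tau)^-1.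

Let a_gt0 : 0 < a.
Proof. by rewrite mulr_gt0 // exprn_gt0. Qed.

Let b_gt0 : 0 < b.
Proof. by rewrite invr_gt0 mulr_gt0 // sqrtr_gt0. Qed.

Let ab1 : a * b ^+ 2 = 1.
Proof.
rewrite /a /b exprVn exprMn sqr_sqrtr ?(ltW tau0) //.
by field; rewrite !gt_eqF.
Qed.

(* [u - tau u u'] is [u] evaluated at the foot [x - tau u(x)] of the discrete
   characteristic, up to a second-order Taylor error. *)
Lemma step_sup_transport p (m X Y : R) : real_trig N p -> sup_le p m ->
  sup_le (dtrig N (dtrig N p)) X ->
  sup_le (p * dtrig N p - lowpass (N + N) N (p * dtrig N p)) Y ->
  sup_le (step nu tau N p) (m + X * (tau * m) ^+ 2 + tau * Y).
Proof.
move=> rp pm hX hY.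
have radv : real_trig N (p - tau%:C *: advection N p).
  by apply: real_trigB => //; apply: real_trigZ; exact: real_advection.
apply: resolvent_sup_le => //; first exact: ltW.
move=> x; rewrite (real_trig_norm x radv) rtrigD rtrigN rtrigZ.
set q := p * dtrig N p in hY *.
have -> : rtrig N (advection N p) x = rtrig N p x * rtrig N (dtrig N p) x
    - rtrig (N + N) (q - lowpass (N + N) N q) x.
  rewrite rtrigD rtrigN /q rtrigM // opprB addrCA subrr addr0.
  by rewrite /rtrig trig_proj.
have hy := rtrig_norm_sup (N + N) x hY.
have hX0 y : `|rtrig N (dtrig N (dtrig N p)) y| <= X by exact: rtrig_norm_sup.
set u := rtrig N p x; set u' := rtrig N (dtrig N p) x.
have hT := taylor1_bound x (- (tau * u)) (is_derive_rtrig N p)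
  (is_derive_rtrig N (dtrig N p)) hX0.
have hu : `|u| <= m by exact: rtrig_norm_sup.
have hu2 := rtrig_norm_sup N (x + - (tau * u)) pm.
have e2 : X * (- (tau * u)) ^+ 2 <= X * (tau * m) ^+ 2.
  rewrite ler_wpM2l ?(sup_le_ge0 hX) // sqrrN.
  have mm : (tau * u) ^+ 2 = (tau * `|u|) ^+ 2.
    by rewrite !exprMn real_normK // num_real.
  rewrite mm lerXn2r ?nnegrE ?mulr_ge0 ?(ltW tau0) ?(sup_le_ge0 pm) //.
  by rewrite ler_wpM2l // ltW.
have e3 : `|tau * rtrig (N + N) (q - lowpass (N + N) N q) x| <= tau * Y.
  by rewrite normrM (gtr0_norm tau0) ler_wpM2l // ltW.
move: hT hu2 e3; rewrite -/u -/u' !ler_norml.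
move=> /andP[t1 t2] /andP[v1 v2] /andP[w1 w2].
move: t1 t2 v1 v2 w1 w2 e2.
move: (rtrig N p _) (rtrig (N + N) _ x) (X * _ ^+ 2) (X * _ ^+ 2) => A B C D.
move=> t1 t2 v1 v2 w1 w2 e2.
apply/andP; split; lra.
Qed.

Definition resolvent_flux p := dtrig (N + N) (resolvent a (N + N) (p * p)).

Lemma step_divergence p : (size p <= N.*2.+1)%N -> step nu tau N p =
  resolvent a N p - (tau / 2)%:C *: proj N (resolvent_flux p).
Proof.
move=> sp; apply/polyP => j.
rewrite coefB coefZ !coef_resolvent coefB coefZ.
rewrite [(proj N (resolvent_flux p))`_j]coef_proj.
case: leqP => jN; last first.
  have -> : (advection N p)`_j = 0 by rewrite coef_proj leqNgt jN.
  by rewrite !mulr0 !subr0.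
rewrite (coef_advection p jN) coef_dtrig coef_resolvent /symbol !kappaD.
have -> : kappa R N N = 0 by rewrite /kappa subrr mulr0.
rewrite addr0 mulrBl; congr (_ - _).
have -> : (kappa R N j / 2)%:C = 2^-1 * (kappa R N j)%:C :> R[i].
  by rewrite [LHS]rmorphM /= fmorphV rmorph_nat mulrC.
have -> : (tau / 2)%:C = 2^-1 * tau%:C :> R[i].
  by rewrite [LHS]rmorphM /= fmorphV rmorph_nat mulrC.
by move: (tau%:C) (kappa R N j)%:C (_^-1%:C) => t k s; ring.
Qed.

Lemma step_sup_divergence p (m E : R) : (size p <= N.*2.+1)%N ->
  sup_le (resolvent a N p) m -> sup_le (proj N (resolvent_flux p)) E ->
  sup_le (step nu tau N p) (m + tau / 2 * E).
Proof.
move=> sp hm hE; rewrite step_divergence //; apply: sup_leB => //.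
by apply: sup_leZ => //; rewrite divr_ge0 // ltW.
Qed.

(** The square u^2 is nonnegative, as [dresolvent_sup_le] requires; so the derivative costs only the
    factor [b], without a logarithm. *)
Lemma resolvent_flux_sup p (H : R) : real_trig N p ->
  sup_le (resolvent a (N + N) (p * p)) H -> sup_le (resolvent_flux p) (b * H).
Proof.
move=> rp hH; apply: (dresolvent_sup_le b_gt0 ab1) => //.
  exact: real_trigM.
by move=> x; rewrite rtrigM // -expr2 sqr_ge0.
Qed.

Lemma size_resolvent_flux p : real_trig N p ->
  (size (resolvent_flux p) <= (N + N).*2.+1)%N.
Proof.
move=> rp; apply: leq_trans (size_dtrig _ _) _.
by apply: leq_trans (size_resolvent _ _ _) _; case: (real_trigM rp rp).
Qed.

Lemma sum_high_coef q : (0 < N)%N ->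
  \sum_(j < (N + N).*2.+1) (if (freq (N + N) j <= N)%N then 0
     else `|kappa R (N + N) j|^-1 * normc q`_j)
    <= (Num.sqrt N%:R)^-1 * Num.sqrt (nrm2 q).
Proof.
move=> N0; have n0 : (0 : R) < N%:R by rewrite ltr0n.
pose w j : R := if (freq (N + N) j <= N)%N then 0 else `|kappa R (N + N) j|^-1.
rewrite (eq_bigr (fun j : 'I_(N + N).*2.+1 => w j * normc q`_j)); last first.
  by move=> j _; rewrite /w; case: ifP => _ //; rewrite mul0r.
set S := \sum_(j < _) _.
have w0 j : 0 <= w j by rewrite /w; case: ifP => // _; rewrite invr_ge0.
have S0 : 0 <= S.
  by apply: sumr_ge0 => j _; rewrite mulr_ge0 ?normc_ge0.
rewrite -sqrtrV ?ler0n // -sqrtrM ?invr_ge0 // -(ger0_norm S0) -sqrtr_sqr.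
rewrite ler_sqrt ?mulr_ge0 ?invr_ge0 ?nrm2_ge0 //.
apply: le_trans (cauchy_schwarz_sum _ w (fun j => normc q`_j)) _.
apply: ler_pM.
- by apply: sumr_ge0 => j _; exact: sqr_ge0.
- by apply: sumr_ge0 => j _; exact: sqr_ge0.
- apply: (@le_trans _ _ (\sum_(j < (N + N).*2.+1) (16 * N%:R ^+ 2)^-1)).
    apply: ler_sum => j _; rewrite /w; case: leqP => h.
      by rewrite expr0n invr_ge0 mulr_ge0 // sqr_ge0.
    rewrite exprVn real_normK ?num_real // kappa_sqr.
    have f0 : (N%:R : R) <= (freq (N + N) j)%:R by rewrite ler_nat ltnW.
    have h2 : (N%:R : R) ^+ 2 <= (freq (N + N) j)%:R ^+ 2.
      by rewrite lerXn2r ?nnegrE.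
    have p16 := sqr_twopi_ge16 R.
    have N2 : 0 < (N%:R : R) ^+ 2 by rewrite exprn_gt0.
    have le : 16 * N%:R ^+ 2 <= (2 * pi) ^+ 2 * (freq (N + N) j)%:R ^+ 2 :> R.
      by apply: ler_pM => //; exact: ltW.
    have p0 : 0 < 16 * N%:R ^+ 2 :> R by rewrite mulr_gt0.
    by rewrite lef_pV2 // posrE // (lt_le_trans p0).
  rewrite sumr_const card_ord -[leLHS]mulr_natl.
  have : (N + N).*2.+1%:R <= 5 * N%:R :> R by rewrite -natrM ler_nat; lia.
  move: (_.+1%:R) => c hc; rewrite ler_pdivrMr ?mulr_gt0 ?exprn_gt0 //.
  have -> : N%:R^-1 * (16 * N%:R ^+ 2) = 16 * N%:R :> R.
    by field; rewrite gt_eqF.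
  by apply: le_trans hc _; rewrite ler_wpM2r //; lra.
rewrite (nrm2E (leq_addl (N + N).*2.+1 (size q))) big_split_ord /= lerDl.
by apply: sumr_ge0 => j _; exact: sqr_ge0.
Qed.

(** The multiplier kappa / (1 + a kappa^2) is at most 1 / (a kappa), which is square-summable beyond
    frequency [N]. *)
Lemma resolvent_flux_high p (m : R) : (0 < N)%N -> real_trig N p -> sup_le p m ->
  sup_le (resolvent_flux p - lowpass (N + N) N (resolvent_flux p))
   (a^-1 * ((Num.sqrt N%:R)^-1 * (m * Num.sqrt (nrm2 p)))).
Proof.
move=> N0 rp pm; have sG := size_resolvent_flux rp.
set G := resolvent_flux p in sG *.
have sl : (size (G - lowpass (N + N) N G)%R <= (N + N).*2.+1)%N.
  apply: leq_trans (size_polyD _ _) _; rewrite size_polyN geq_max sG.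
  exact: leq_trans (size_lowpass _ _ _) sG.
apply: (sup_le_sum sl).
apply: (@le_trans _ _ (a^-1 * \sum_(j < (N + N).*2.+1)
   (if (freq (N + N) j <= N)%N then 0
     else `|kappa R (N + N) j|^-1 * normc (p * p)`_j))).
  rewrite mulr_sumr; apply: ler_sum => j _; rewrite coefB coef_lowpass.
  case: leqP => h; first by rewrite subrr normc0 mulr0.
  rewrite subr0 coef_dtrig coef_resolvent !normcM normc_i mul1r !normc_real.
  rewrite mulrA mulrAC [leRHS]mulrA ler_wpM2r ?normc_ge0 //.
  have k0 : 0 < `|kappa R (N + N) j|.
    rewrite kappa_norm mulr_gt0 ?mulr_gt0 ?pi_gt0 // ltr0n.
    exact: leq_ltn_trans h.
  have s0 := symbol_gt0 (N + N) j (ltW a_gt0).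
  rewrite [`|_^-1|]gtr0_norm ?invr_gt0 // -invfM.
  rewrite ler_pdivrMr // ler_pdivlMl ?mulr_gt0 //.
  rewrite /symbol -mulrA -expr2 real_normK ?num_real //.
  by rewrite lerDr.
rewrite ler_wpM2l ?invr_ge0 ?(ltW a_gt0) //.
apply: le_trans (sum_high_coef (p * p) N0) _.
rewrite ler_wpM2l ?invr_ge0 ?sqrtr_ge0 //.
have m0 := sup_le_ge0 pm.
have -> : m * Num.sqrt (nrm2 p) = Num.sqrt (m ^+ 2 * nrm2 p).
  by rewrite sqrtrM ?sqr_ge0 // sqrtr_sqr ger0_norm.
rewrite ler_sqrt ?nrm2_mul_le //.
by rewrite mulr_ge0 ?sqr_ge0 ?nrm2_ge0.
Qed.

(** Here the projection of the flux costs a factor [lam], acceptable as long as [N] is at most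
    1/tau. *)
Lemma step_sup_small_N p (m H : R) : real_trig N p ->
  sup_le (resolvent a N p) m -> sup_le (resolvent a (N + N) (p * p)) H ->
  sup_le (step nu tau N p) (m + tau / 2 * (lam R (N + N) * (b * H))).
Proof.
move=> rp hm hH; have [sp _] := rp.
apply: step_sup_divergence => //; apply: sup_le_proj; apply: lowpass_sup_le.
  exact: size_resolvent_flux.
exact: resolvent_flux_sup.
Qed.

(** Subtracting the tail beyond [N] avoids the factor [lam]; the tail is small once [N] exceeds
    1/tau. The bound [m'] of [p] itself is separate from [m], because the resolvent of a projected
    datum can be far smaller than the datum. *)
Lemma step_sup_large_N p (m m' H : R) : (0 < N)%N -> real_trig N p ->
  sup_le p m' ->
  sup_le (resolvent a N p) m -> sup_le (resolvent a (N + N) (p * p)) H ->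
  sup_le (step nu tau N p) (m + tau / 2 * (b * H +
    a^-1 * ((Num.sqrt N%:R)^-1 * (m' * Num.sqrt (nrm2 p))))).
Proof.
move=> N0 rp pm hm hH; have [sp _] := rp.
apply: step_sup_divergence => //; apply: sup_le_proj.
set G := resolvent_flux p.
have -> : lowpass (N + N) N G = G - (G - lowpass (N + N) N G) by ring.
apply: sup_leB; first exact: resolvent_flux_sup.
exact: resolvent_flux_high.
Qed.

Lemma resolvent_proj q : resolvent a N (proj N q) = proj N (resolvent a (N + N) q).
Proof.
apply/polyP => j; rewrite coef_resolvent !coef_proj; case: leqP => _.
  rewrite coef_resolvent /symbol kappaD.
  have -> : kappa R N N = 0 by rewrite /kappa subrr mulr0.
  by rewrite addr0.
by rewrite mul0r.
Qed.

(* The resolvent damps frequency [k] by [1 / (a (2 pi k)^2)]. *)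
Lemma resolvent_proj_sup q (m : R) : (0 < N)%N -> real_trig (N + N) q ->
  sup_le q m -> sup_le (resolvent a N (proj N q))
    (m + a^-1 * (N%:R^-1 * ((Num.sqrt N%:R)^-1 * m))).
Proof.
move=> N0 rq qm; rewrite resolvent_proj; apply: sup_le_proj.
set G := resolvent a (N + N) q.
have rG : real_trig (N + N) G by exact: real_resolvent.
have -> : lowpass (N + N) N G = G - (G - lowpass (N + N) N G) by ring.
apply: sup_leB; first by apply: resolvent_sup_le => //; exact: ltW.
have [sG _] := rG.
have sl : (size (G - lowpass (N + N) N G)%R <= (N + N).*2.+1)%N.
  apply: leq_trans (size_polyD _ _) _; rewrite size_polyN geq_max sG.
  exact: leq_trans (size_lowpass _ _ _) sG.
apply: (sup_le_sum sl).
have n0 : (0 : R) < N%:R by rewrite ltr0n.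
apply: (@le_trans _ _ (a^-1 * (N%:R^-1 * \sum_(j < (N + N).*2.+1)
   (if (freq (N + N) j <= N)%N then 0
     else `|kappa R (N + N) j|^-1 * normc q`_j)))).
  rewrite 2!mulr_sumr; apply: ler_sum => j _; rewrite coefB coef_lowpass.
  case: leqP => h; first by rewrite subrr normc0 !mulr0.
  rewrite subr0 coef_resolvent !normcM !normc_real mulrC.
  rewrite !mulrA ler_wpM2r ?normc_ge0 //.
  have s0 := symbol_gt0 (N + N) j (ltW a_gt0).
  have kN : N%:R <= `|kappa R (N + N) j|.
    rewrite kappa_norm; apply: (@le_trans _ _ (freq (N + N) j)%:R).
      by rewrite ler_nat ltnW.
    by rewrite ler_peMl //; have := twopi_ge4 R; lra.
  have k0 : 0 < `|kappa R (N + N) j| by exact: lt_le_trans kN.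
  rewrite [`|_^-1|]gtr0_norm ?invr_gt0 // -!invfM lef_pV2 ?posrE ?mulr_gt0 //.
  rewrite /symbol -(real_normK (num_real (kappa R (N + N) j))).
  apply: (@le_trans _ _ (a * `|kappa R (N + N) j| ^+ 2)); last by rewrite lerDr.
  by rewrite -mulrA ler_wpM2l ?(ltW a_gt0) // expr2 ler_wpM2r // ltW.
rewrite ler_wpM2l ?invr_ge0 ?(ltW a_gt0) // ler_wpM2l ?invr_ge0 //.
apply: le_trans (sum_high_coef q N0) _.
rewrite ler_wpM2l ?invr_ge0 ?sqrtr_ge0 //.
have m0 := sup_le_ge0 qm.
by rewrite -(ger0_norm m0) -sqrtr_sqr ler_sqrt ?sqr_ge0 // nrm2_le_sup.
Qed.

(** Since (1 + y)^2 <= 2 (1 + y^2), each term is at most 2 / ((1 + x) (1 + x + c)) with x + c = y,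
    and these telescope. *)
Lemma sum_resolvent_le (c : R) n : 0 < c ->
  \sum_(k < n) (1 + (c * k.+1%:R) ^+ 2)^-1 <= 2 / c.
Proof.
move=> c0.
suff : \sum_(k < n) (1 + (c * k.+1%:R) ^+ 2)^-1 <= 2 / c * (1 - (1 + c * n%:R)^-1).
  move=> /le_trans; apply; rewrite ler_piMr ?divr_ge0 ?(ltW c0) //.
  by rewrite lerBlDr lerDl invr_ge0 addr_ge0 // mulr_ge0 // ltW.
elim: n => [|n ih]; first by rewrite big_ord0 mulr0 addr0 invr1 subrr mulr0.
rewrite big_ord_recr /=; apply: le_trans (lerD ih (lexx _)) _.
have x0 : 0 <= c * n%:R by rewrite mulr_ge0 // ltW.
rewrite -[n.+1%:R]natr1; have -> : c * (n%:R + 1) = c * n%:R + c by ring.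
move: (c * n%:R) x0 => x x0.
have -> : 2 / c * (1 - (1 + (x + c))^-1) =
   2 / c * (1 - (1 + x)^-1) + 2 / ((1 + x) * (1 + (x + c))).
  by field; rewrite !lt0r_neq0 //; lra.
rewrite lerD2l -[leLHS]mul1r ler_pdivrMr; last first.
  by rewrite ltr_pwDl // sqr_ge0.
rewrite mulrAC ler_pdivlMr; last by rewrite mulr_gt0 //; lra.
have := sqr_ge0 (x + c - 1); have : 0 <= c * (1 + x).
  by rewrite mulr_ge0 ?(ltW c0) //; lra.
have := sqr_ge0 x; rewrite !expr2; nra.
Qed.

(** Each coefficient of p^2 is at most [nrm2 p], and the resolvent multipliers sum to at most
    [1 + b]. The bound involves no sup norm of [p], hence no logarithm for projected data. *)
Lemma resolvent_sqr_sup p : real_trig N p ->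
  sup_le (resolvent a (N + N) (p * p)) (nrm2 p * (1 + b)).
Proof.
move=> rp; have [sp _] := rp; have [spp _] := real_trigM rp rp.
have sr := leq_trans (size_resolvent a (N + N) (p * p)) spp.
apply: (sup_le_sum sr).
have pp m : normc (p * p)`_m <= nrm2 p.
  rewrite coefM; apply: le_trans (normc_sum _ _ _) _.
  under eq_bigr do rewrite normcM.
  have T0 : 0 <= nrm2 p by exact: nrm2_ge0.
  rewrite -(@ler_pXn2r _ 2) ?nnegrE //; last first.
    by apply: sumr_ge0 => i _; rewrite mulr_ge0 ?normc_ge0.
  apply: le_trans (cauchy_schwarz_sum _ (fun i => normc p`_i)
     (fun i => normc p`_(m - i))) _.
  have part : \sum_(i < m.+1) normc p`_i ^+ 2 <= nrm2 p.
    rewrite (nrm2E (leq_addl m.+1 (size p))) big_split_ord /= lerDl.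
    by apply: sumr_ge0 => j _; exact: sqr_ge0.
  rewrite expr2; apply: ler_pM => //; try by apply: sumr_ge0 => j _; exact: sqr_ge0.
  rewrite (reindex_inj rev_ord_inj) /=.
  rewrite (eq_bigr (fun i : 'I_m.+1 => normc p`_i ^+ 2)) // => i _.
  by rewrite subSS subKn // -ltnS.
pose c := 4 * nu * Num.sqrt tau.
have c0 : 0 < c by rewrite !mulr_gt0 // sqrtr_gt0.
pose F (f : nat) : R := (1 + (c * f%:R) ^+ 2)^-1.
apply: (@le_trans _ _ (nrm2 p * \sum_(j < (N + N).*2.+1) F (freq (N + N) j))).
  rewrite mulr_sumr; apply: ler_sum => j _.
  rewrite coef_resolvent normcM normc_real.
  have s0 := symbol_gt0 (N + N) j (ltW a_gt0).
  rewrite [`|_^-1|]gtr0_norm ?invr_gt0 // ler_pM ?normc_ge0 ?invr_ge0 ?(ltW s0) ?pp //.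
  have F0 : 0 < 1 + (c * (freq (N + N) j)%:R) ^+ 2 by rewrite ltr_pwDl // sqr_ge0.
  rewrite lef_pV2 ?posrE // /symbol lerD2l kappa_sqr.
  rewrite exprMn mulrA ler_wpM2r ?sqr_ge0 //.
  have -> : c ^+ 2 = a * 16.
    by rewrite /c !exprMn sqr_sqrtr ?(ltW tau0) // /a; ring.
  by rewrite ler_pM2l // sqr_twopi_ge16.
rewrite ler_wpM2l ?nrm2_ge0 // sum_freq /F.
rewrite mulr0 expr0n addr0 invr1 lerD2l.
have := sum_resolvent_le (N + N) c0.
have -> : 2 / c = b / 2.
  by rewrite /c /b; field; rewrite !gt_eqF // ?sqrtr_gt0.
by lra.
Qed.

End StepSup.

(** * Energy bounds and bootstrap along the iteration *)

Section Iteration.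
Variables (R : realType) (nu : R).
Hypothesis nu0 : 0 < nu.

Definition smoothing_const (s : nat) : R := 4 ^+ s.+1 / (2 * nu ^+ 2).

Lemma energy_iter_decay (E : R) tau N p0 B n :
  0 < tau -> real_trig N p0 -> nrm2 p0 <= E -> tau * B ^+ 2 <= nu ^+ 2 / 2 ->
  (forall j, (j < n)%N -> sup_le (iter j (step nu tau N) p0) B) ->
  (forall j, (j <= n)%N -> nrm2 (iter j (step nu tau N) p0) <= 4 * E) /\
  energy_decay nu (4 * E / nu ^+ 2) smoothing_const tau
    (fun s j => energy N s (iter j (step nu tau N) p0)) n.
Proof.
move=> tau0 rp0 pE hB hsup; set P := fun j => iter j (step nu tau N) p0.
have rP j : real_trig N (P j).
  by elim: j => [//|j ih]; rewrite /P iterS; exact: real_step.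
have sP j : (size (P j) <= N.*2.+1)%N by case: (rP j).
have nu2 : 0 < nu ^+ 2 by rewrite exprn_gt0.
set a := tau * nu ^+ 2; have a0 : 0 < a by rewrite mulr_gt0.
have E0 : 0 <= E by apply: le_trans pE; exact: nrm2_ge0.
(* The extra copy of the last dissipation pays for the explicit error tau^2 B^2 |u'|^2 <= a |u'|^2
   of the next step. The first step gives 2E for one copy; carrying two copies of the dissipation
   doubles it to 4E. *)
have main m : (m < n)%N -> nrm2 (P m.+1) + a * nrm2 (dtrig N (P m.+1)) +
    a * (\sum_(j < m.+1) nrm2 (dtrig N (P j.+1))) <= 4 * E.
  elim: m => [|m ih] mn.
    have := energy_first_step nu0 tau0 (rP 0%N) (hsup _ mn); rewrite -/(P 1%N) -/a.
    have h : tau / (4 * nu ^+ 2) * (B ^+ 2 * nrm2 (P 0%N)) <= nrm2 (P 0%N).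
      have -> : tau / (4 * nu ^+ 2) * (B ^+ 2 * nrm2 (P 0%N)) =
         (tau * B ^+ 2) / (4 * nu ^+ 2) * nrm2 (P 0%N).
        by field; rewrite gt_eqF.
      rewrite ler_piMl ?nrm2_ge0 // ler_pdivrMr ?mulr_gt0 // mul1r.
      by move: hB nu2; lra.
    rewrite big_ord1; have := nrm2_ge0 (P 1%N).
    by move: h pE; rewrite /P /=; lra.
  have {ih} := ih (ltnW mn).
  have := energy_step nu0 tau0 (rP m.+1) (hsup _ mn); rewrite -/(P m.+2) -/a.
  have h : tau ^+ 2 * B ^+ 2 * nrm2 (dtrig N (P m.+1)) <=
      a * nrm2 (dtrig N (P m.+1)).
    rewrite ler_wpM2r ?nrm2_ge0 // expr2 -mulrA ler_wpM2l ?(ltW tau0) //.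
    by move: hB nu2; lra.
  rewrite [in X in _ -> _ -> X]big_ord_recr /= [in X in _ -> _ -> X]mulrDr.
  by lra.
have E1 j : energy N 1 (P j) = nrm2 (dtrig N (P j)) by rewrite energy1.
have pos m : 0 <= a * (\sum_(j < m) nrm2 (dtrig N (P j.+1))).
  by rewrite mulr_ge0 ?(ltW a0) // sumr_ge0 // => j _; exact: nrm2_ge0.
have posd m : 0 <= a * nrm2 (dtrig N (P m)).
  by rewrite mulr_ge0 ?(ltW a0) // nrm2_ge0.
split=> [[_|m mn]|].
- by move: pE; rewrite /=; lra.
- by have := main m mn; have := pos m.+1; have := posd m.+1; rewrite -/(P m.+1); lra.
split => //.
- by move=> s j; exact: energy_ge0.
- case=> [_|m mn]; first by rewrite big_ord0 divr_ge0 ?(ltW nu2) // mulr_ge0.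
  have := main m mn; rewrite ler_pdivlMr // mulr_suml.
  have := posd m.+1; have := nrm2_ge0 (P m.+1).
  have -> : \sum_(i < m.+1) tau * energy N 1 (iter i.+1 (step nu tau N) p0) * nu ^+ 2 =
    a * (\sum_(j < m.+1) nrm2 (dtrig N (P j.+1))).
    by rewrite mulr_sumr; apply: eq_bigr => j _; rewrite -E1 /a /P; ring.
  lra.
move=> s j s0 j0 jn; rewrite iterS.
apply: (energy_smoothing_step nu0 tau0 (rP j) s0).
have h2 : Re (P j)`_N ^+ 2 <= B ^+ 2.
  apply: le_trans (nrm2_le_sup (hsup _ jn)).
  apply: (@le_trans _ _ (normc (P j)`_N ^+ 2)).
    by rewrite sqr_normcE lerDl sqr_ge0.
  have NN : (N < N.*2.+1)%N by lia.
  rewrite (nrm2E (sP j)) (bigD1 (Ordinal NN)) //= lerDl.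
  by apply: sumr_ge0 => i _; exact: sqr_ge0.
by apply: le_trans hB; rewrite ler_wpM2l // ltW.
Qed.

Lemma sqrt_energy3_le (t A B3 : R) : 0 < t -> 0 <= A -> t ^+ 3 * A <= B3 ->
  Num.sqrt A <= Num.sqrt B3 * pow32V t.
Proof.
move=> t0 A0 h; rewrite /pow32V ler_pdivlMr; last first.
  by rewrite mulr_gt0 // sqrtr_gt0.
have -> : t * Num.sqrt t = Num.sqrt (t ^+ 3).
  by rewrite exprSr sqrtrM ?sqr_ge0 // sqrtr_sqr gtr0_norm.
have t3 : 0 <= t ^+ 3 by rewrite exprn_ge0 // ltW.
rewrite -sqrtrM // ler_sqrt; first by rewrite mulrC.
by apply: le_trans h; rewrite mulr_ge0.
Qed.

Lemma pow32V_gt0 (t : R) : 0 < t -> 0 < pow32V t.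
Proof. by move=> t0; rewrite invr_gt0 mulr_gt0 // sqrtr_gt0. Qed.

(* Steps [0, 1, 2], where the energy of order 3 is not yet controlled, cost
   [c0] each; [c1], [c2], [c3] bound the Taylor error and the contributions of
   the truncated frequencies at times after and before [t1]. *)
Section Bootstrap.
Variables (tau E B U t1 h B3 : R) (N : nat) (p0 : {poly R[i]}).
Hypotheses (tau0 : 0 < tau) (N0 : (0 < N)%N) (t10 : 0 < t1) (h0 : 0 < h).
Hypotheses (rp0 : real_trig N p0) (pE : nrm2 p0 <= E) (pU : sup_le p0 U).
Hypothesis hB : tau * B ^+ 2 <= nu ^+ 2 / 2.
Hypothesis hB3 : forall A n,
  energy_decay nu (4 * E / nu ^+ 2) smoothing_const tau A n ->
  forall m, (2 < m)%N -> (m <= n)%N -> (m%:R * tau) ^+ 3 * A 3%N m <= B3.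

Variable c0 : R.
Hypothesis c0P :
  tau / 2 * (lam R (N + N) * ((nu * Num.sqrt tau)^-1 * B ^+ 2)) <= c0 \/
  tau / 2 * ((nu * Num.sqrt tau)^-1 * B ^+ 2 +
    (tau * nu ^+ 2)^-1 * ((Num.sqrt N%:R)^-1 * (B * Num.sqrt (4 * E)))) <= c0.

Let c1 : R := B ^+ 2 * Num.sqrt B3.
Let c2 : R := 24 * pow32V N%:R * ((1 + lam R N) * B * Num.sqrt B3).
Let c3 : R := (1 + lam R (N + N)) * (B * (2 * B / h +
    (8 * N%:R) ^+ 2 * Num.sqrt (N.*2.+1%:R * (4 * E)) * h)).

Definition total_error : R :=
  3 * c0 + c1 * (2 * Num.sqrt tau) + c2 * (4 / Num.sqrt t1) + c3 * t1.

Hypothesis errB : U + total_error <= B.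

Let P j := iter j (step nu tau N) p0.

Let increment j : R :=
  if (j < 3)%N then c0 else
  c1 * (tau ^+ 2 * pow32V (j%:R * tau)) +
  (if t1 < j%:R * tau then c2 * (tau * pow32V (j%:R * tau)) else c3 * tau).

Let U0 : 0 <= U. Proof. exact: sup_le_ge0 pU. Qed.

Let E0 : 0 <= E.
Proof. by apply: le_trans pE; exact: nrm2_ge0. Qed.

Let lam0 D : 0 <= 1 + lam R D.
Proof. by rewrite addr_ge0 // (le_trans ler01) // lam_ge1. Qed.

Hypothesis B0 : 0 <= B.

Let n0 : (0 : R) < N%:R. Proof. by rewrite ltr0n. Qed.

Let c00 : 0 <= c0.
Proof.
have b0 : 0 <= (nu * Num.sqrt tau)^-1.
  by rewrite invr_ge0 mulr_ge0 ?sqrtr_ge0 // ltW.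
have t2 : 0 <= tau / 2 by rewrite divr_ge0 // ltW.
case: c0P => /(le_trans _); apply.
  have l0 : 0 <= lam R (N + N) by exact: le_trans ler01 (lam_ge1 _ _).
  by apply: mulr_ge0 => //; apply: mulr_ge0 => //; apply: mulr_ge0 => //; exact: sqr_ge0.
apply: mulr_ge0 => //; apply: addr_ge0; first by rewrite mulr_ge0 ?sqr_ge0.
apply: mulr_ge0; first by rewrite invr_ge0 mulr_ge0 ?sqr_ge0 // ltW.
by apply: mulr_ge0; [rewrite invr_ge0 sqrtr_ge0|rewrite mulr_ge0 ?sqrtr_ge0].
Qed.

Let c10 : 0 <= c1.
Proof. by rewrite mulr_ge0 ?sqr_ge0 ?sqrtr_ge0. Qed.

Let c20 : 0 <= c2.
Proof.
rewrite mulr_ge0 //; first by rewrite mulr_ge0 // ltW // pow32V_gt0.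
by rewrite mulr_ge0 ?sqrtr_ge0 // mulr_ge0.
Qed.

Let c30 : 0 <= c3.
Proof.
rewrite mulr_ge0 // mulr_ge0 // addr_ge0 //.
  by rewrite divr_ge0 ?(ltW h0) // mulr_ge0.
by rewrite mulr_ge0 ?(ltW h0) // mulr_ge0 ?sqr_ge0 ?sqrtr_ge0.
Qed.

Let increment_ge0 j : 0 <= increment j.
Proof.
rewrite /increment; case: ltnP => // j3.
have t0 : 0 < j%:R * tau by rewrite mulr_gt0 // ltr0n (leq_trans _ j3).
have w0 := ltW (pow32V_gt0 t0).
rewrite addr_ge0 //; first by rewrite mulr_ge0 // mulr_ge0 // sqr_ge0.
by case: ifP => _; rewrite mulr_ge0 // ?mulr_ge0 // ltW.
Qed.

Let sum_increment n : \sum_(j < n) increment j <= total_error.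
Proof.
apply: (@le_trans _ _ (\sum_(j < n + 3) increment j)).
  by rewrite big_split_ord /= lerDl sumr_ge0.
rewrite addnC big_split_ord /= !big_ord_recl big_ord0 /= /total_error.
have -> : c0 + (c0 + (c0 + 0)) = 3 * c0 by ring.
rewrite -!addrA lerD2l.
have tj (j : 'I_n) : (3 + j)%:R * tau = (2 + j.+1)%:R * tau :> R.
  by congr (_%:R * _); lia.
have two : (1 < 2)%N by [].
have k1 := sum_pow32V tau0 two n.
have k2 := sum_pow32V_late tau0 two t10 n.
have k3 := sum_early tau0 two t10 n.
rewrite (eq_bigr (fun j : 'I_n => c1 * tau * (tau * pow32V ((2 + j.+1)%:R * tau)) +
   (c2 * (if t1 < (2 + j.+1)%:R * tau then tau * pow32V ((2 + j.+1)%:R * tau) else 0)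
    + c3 * (if t1 < (2 + j.+1)%:R * tau then 0 else tau)))); last first.
  move=> j _; rewrite /increment /= -tj; congr (_ + _); first by ring.
  by case: ifP => _; rewrite mulr0 ?addr0 ?add0r.
rewrite !big_split /=; apply: lerD.
  rewrite -mulr_sumr; apply: le_trans (ler_wpM2l _ k1) _; first by rewrite mulr_ge0 // ltW.
  rewrite -mulrA ler_wpM2l // -{1}(sqr_sqrtr (ltW tau0)).
  have s0 : 0 < Num.sqrt tau by rewrite sqrtr_gt0.
  by rewrite le_eqVlt; apply/orP; left; apply/eqP; field; rewrite gt_eqF.
by apply: lerD; rewrite -mulr_sumr; apply: ler_wpM2l.
Qed.

(** The induction is strong because the energy decay up to time [n] needs the bound [B] on all
    earlier iterates. The increments are added up instead of being replaced by [B], so that [U]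
    keeps the factor 1. *)
Lemma bootstrap n : sup_le (P n) (U + \sum_(j < n) increment j).
Proof.
elim/ltn_ind: n => -[_|n ih]; first by rewrite big_ord0 addr0.
have supB j : (j <= n)%N -> sup_le (P j) B.
  move=> jn; apply: sup_le_trans (ih j _); last by rewrite ltnS.
  by apply: le_trans errB; rewrite lerD2l.
have [nE dec] := @energy_iter_decay E tau N p0 B n.+1 tau0 rp0 pE hB supB.
have rP j : real_trig N (P j).
  by elim: j => [//|j ihj]; rewrite /P iterS; exact: real_step.
have [sP _] := rP n.
have PB := supB n (leqnn n); have Pn := ih n (leqnn _).
have nEn : nrm2 (P n) <= 4 * E by exact: nE.
have E4 : 0 <= 4 * E by rewrite mulr_ge0.
have -> : P n.+1 = step nu tau N (P n) by [].
rewrite big_ord_recr [X in sup_le _ X]addrA.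
set m := U + _ in Pn *.
have mB : m <= B by apply: le_trans errB; rewrite lerD2l.
have m0 := sup_le_ge0 Pn.
have a0 : 0 <= tau * nu ^+ 2 by rewrite mulr_ge0 ?sqr_ge0 // ltW.
have rm : sup_le (resolvent (tau * nu ^+ 2) N (P n)) m by exact: resolvent_sup_le.
have rmm : sup_le (resolvent (tau * nu ^+ 2) (N + N) (P n * P n)) (B ^+ 2).
  by apply: resolvent_sup_le => //; [exact: real_trigM|rewrite expr2; exact: sup_leM].
rewrite /increment; case: ltnP => n3.
  case: c0P => hc.
    apply: sup_le_trans (step_sup_small_N nu0 tau0 (rP n) rm rmm).
    by rewrite lerD2l.
  apply: sup_le_trans (step_sup_large_N nu0 tau0 N0 (rP n) PB rm rmm).
  rewrite lerD2l (le_trans _ hc) // ler_wpM2l ?divr_ge0 ?(ltW tau0) // lerD2l.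
  rewrite ler_wpM2l ?invr_ge0 // ler_wpM2l ?invr_ge0 ?sqrtr_ge0 //.
  by rewrite ler_wpM2l // ler_sqrt.
set t := n%:R * tau.
have t0 : 0 < t by rewrite mulr_gt0 // ltr0n (leq_trans _ n3).
have hE3 : Num.sqrt (energy N 3 (P n)) <= Num.sqrt B3 * pow32V t.
  by apply: sqrt_energy3_le => //; [exact: energy_ge0|exact: (hB3 dec)].
have w0 := ltW (pow32V_gt0 t0).
have X2 : sup_le (dtrig N (dtrig N (P n))) (Num.sqrt B3 * pow32V t).
  exact: sup_le_trans hE3 (sup_le_second_derivative sP).
have trans Y : sup_le (P n * dtrig N (P n) - lowpass (N + N) N (P n * dtrig N (P n))) Y ->
    sup_le (step nu tau N (P n)) (m + (c1 * (tau ^+ 2 * pow32V t) + tau * Y)).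
  move=> hY; apply: sup_le_trans (step_sup_transport nu0 tau0 (rP n) Pn X2 hY).
  rewrite -addrA lerD2l lerD2r /c1 exprMn.
  have -> : B ^+ 2 * Num.sqrt B3 * (tau ^+ 2 * pow32V t) =
     Num.sqrt B3 * pow32V t * (tau ^+ 2 * B ^+ 2) by ring.
  rewrite ler_wpM2l ?mulr_ge0 ?sqrtr_ge0 // ler_wpM2l ?sqr_ge0 //.
  by rewrite lerXn2r ?nnegrE.
case: ifP => ht.
  have := high_advection_late N0 (rP n) PB => hY.
  apply: sup_le_trans (trans _ hY); rewrite lerD2l lerD2l.
  have -> : c2 * (tau * pow32V t) = tau * (24 * pow32V N%:R *
     ((1 + lam R N) * B * (Num.sqrt B3 * pow32V t))) by rewrite /c2; ring.
  have wN := ltW (pow32V_gt0 n0).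
  rewrite ler_wpM2l ?(ltW tau0) // ler_wpM2l ?mulr_ge0 //.
  by rewrite ler_wpM2l // mulr_ge0.
have dP := sup_le_derivative (rP n) PB h0.
have := high_advection_early (rP n) PB dP => hY.
apply: sup_le_trans (trans _ hY); rewrite lerD2l lerD2l.
rewrite [c3 * _]mulrC ler_wpM2l ?(ltW tau0) // /c3 ler_wpM2l // ler_wpM2l //.
rewrite lerD2l ler_wpM2r ?(ltW h0) // ler_wpM2l ?sqr_ge0 //.
by rewrite ler_sqrt ?mulr_ge0 // ler_wpM2l.
Qed.

Lemma iterates_sup n : sup_le (P n) (U + total_error).
Proof. by apply: sup_le_trans (bootstrap n); rewrite lerD2l. Qed.

End Bootstrap.

End Iteration.

(** * Fourier coefficients of bounded functions *)

Section TorusIntegral.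
Variable R : realType.
Implicit Types (f g : R -> R) (p q : {poly R[i]}) (N D : nat).

Let mu := @lebesgue_measure R.
Let I01 : set (measurableTypeR R) := `[0%R, 1%R]%classic.

Definition int01 g : R := (\int[mu]_(x in `[0%R, 1%R]) g x)%R.

Definition integrable01 g := mu.-integrable `[0%R, 1%R] (EFin \o g).

Let mI : measurable I01. Proof. exact: measurable_itv. Qed.

Lemma continuous_integrable01 g : continuous g -> integrable01 g.
Proof.
move=> gc; apply: continuous_compact_integrable; first exact: segment_compact.
exact: continuous_subspaceT.
Qed.

Lemma mu01 : mu `[0%R, 1%R] = 1%E.
Proof. by rewrite /mu lebesgue_measure_itv /= lte01 oppr0 adde0. Qed.

Lemma int01_cst (c : R) : int01 (fun=> c) = c.
Proof.
rewrite /int01 Rintegral_cst //.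
rewrite [X in fine X](_ : _ = 1%E) ?mulr1 //; exact: mu01.
Qed.

Lemma int01D f g : integrable01 f -> integrable01 g ->
  int01 (fun x => f x + g x) = int01 f + int01 g.
Proof. by move=> hf hg; rewrite /int01 RintegralD. Qed.

Lemma int01Z (c : R) g : integrable01 g -> int01 (fun x => c * g x) = c * int01 g.
Proof. by move=> hg; rewrite /int01 RintegralZl. Qed.

Lemma int01_sum n (F : 'I_n -> R -> R) : (forall j, integrable01 (F j)) ->
  integrable01 (fun x => \sum_(j < n) F j x) /\
  int01 (fun x => \sum_(j < n) F j x) = \sum_(j < n) int01 (F j).
Proof.
elim: n F => [|n ih] F hF.
  have -> : (fun x => \sum_(j < 0) F j x) = (fun=> 0).
    by apply/funext => x; rewrite big_ord0.
  rewrite int01_cst big_ord0; split=> //.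
  by apply: continuous_integrable01; exact: cst_continuous.
have -> : (fun x => \sum_(j < n.+1) F j x) =
   (fun x => \sum_(j < n) F (widen_ord (leqnSn n) j) x + F ord_max x).
  by apply/funext => x; rewrite big_ord_recr.
have [i1 i2] := ih (fun j => F (widen_ord (leqnSn n) j)) (fun j => hF _).
split; last by rewrite int01D // i2 big_ord_recr.
exact: (integrableD mI i1 (hF ord_max)).
Qed.

Lemma int01_derivative (F f : R -> R) : (forall x : R, is_derive x 1 F (f x)) ->
  continuous f -> int01 f = F 1 - F 0.
Proof.
move=> Fd fc; rewrite /int01 /Rintegral.
have cF := is_derive_continuous Fd.
rewrite (@continuous_FTC2 _ f F) ?ltr01 //.
- exact: continuous_subspaceT.
- split.
  + by move=> x _; exact: (@ex_derive _ _ _ _ _ _ _ (Fd x)).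
  + exact: cvg_at_right_filter (cF 0).
  + exact: cvg_at_left_filter (cF 1).
- by move=> x _; rewrite derive1E (@derive_val _ _ _ _ _ _ _ (Fd x)).
Qed.

Lemma rtrig_continuous D p : continuous (rtrig D p).
Proof. exact: is_derive_continuous (is_derive_rtrig D p). Qed.

Definition antideriv D p : {poly R[i]} :=
  \poly_(j < size p) (if j == D then 0 else p`_j / ('i * (kappa R D j)%:C)).

Lemma coef_antideriv D p j : (antideriv D p)`_j =
  if j == D then 0 else p`_j / ('i * (kappa R D j)%:C).
Proof.
rewrite coef_poly; case: ltnP => // h.
by rewrite nth_default ?mul0r ?if_same.
Qed.

Lemma dtrig_antideriv D p : p = (p`_D)%:P * 'X^D + dtrig D (antideriv D p).
Proof.
apply/polyP => j; rewrite coefD coefCM coefXn coef_dtrig coef_antideriv.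
case: (eqVneq j D) => [->|jD]; first by rewrite mulr1 mulr0 addr0.
rewrite mulr0 add0r mulrC divfK // mulf_neq0 //.
  by rewrite eq_complex /= oner_eq0 andbF.
rewrite -(rmorph0 (real_complex R)) (inj_eq (@complexI R)).
have k0 : kappa R D j != 0.
  apply: mulf_neq0; last by rewrite subr_eq0 eqr_nat.
  by apply: mulf_neq0 => //; rewrite gt_eqF // pi_gt0.
by [].
Qed.

Lemma rtrig_antideriv D p x : rtrig D p x =
  Re p`_D + rtrig D (dtrig D (antideriv D p)) x.
Proof.
rewrite {1}(dtrig_antideriv D p) rtrigD; congr (_ + _).
rewrite /rtrig /trig hornerM hornerC hornerXn -eMn mulrCA -eD.
by rewrite addrC subrr e0 mulr1.
Qed.

(** Apart from its mean, a trigonometric polynomial has a periodic antiderivative, so the rest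
    integrates to zero. *)
Lemma int01_rtrig D p : int01 (rtrig D p) = Re p`_D.
Proof.
have c1 : continuous (rtrig D (dtrig D (antideriv D p))) by exact: rtrig_continuous.
have -> : rtrig D p = fun x => Re p`_D + rtrig D (dtrig D (antideriv D p)) x.
  by apply/funext => x; rewrite rtrig_antideriv.
rewrite int01D; last 2 first.
- by apply: continuous_integrable01; exact: cst_continuous.
- exact: continuous_integrable01.
rewrite int01_cst (int01_derivative (is_derive_rtrig D (antideriv D p))) //.
by rewrite -[1]add0r rtrig_periodic subrr addr0.
Qed.

Lemma is_derive_rtrig_reflect D q x (y : R) :
  is_derive y 1 (fun z => rtrig D q (x - z)) (- rtrig D (dtrig D q) (x - y)).
Proof.
have d1 : is_derive y 1 (fun z => x - z) (- 1).
  have := is_deriveB (is_derive_cst x y 1) (@is_derive_id _ _ y 1).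
  by rewrite sub0r.
have := @is_derive1_comp _ (rtrig D q) (fun z => x - z) y _ _
   (is_derive_rtrig D q (x - y)) d1.
by rewrite mulrN1.
Qed.

Lemma rtrig_reflect_continuous D q x : continuous (fun y => rtrig D q (x - y)).
Proof. exact: is_derive_continuous (is_derive_rtrig_reflect D q x). Qed.

Lemma int01_rtrig_reflect D p x : int01 (fun y => rtrig D p (x - y)) = Re p`_D.
Proof.
set A := antideriv D p; set dA := dtrig D A.
have c1 : continuous (fun y => rtrig D dA (x - y)).
  exact: rtrig_reflect_continuous.
have -> : (fun y => rtrig D p (x - y)) = fun y => Re p`_D + rtrig D dA (x - y).
  by apply/funext => y; rewrite rtrig_antideriv.
rewrite int01D; last 2 first.
- by apply: continuous_integrable01; exact: cst_continuous.
- exact: continuous_integrable01.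
have dF (y : R) : is_derive y 1 (fun z => - rtrig D A (x - z)) (rtrig D dA (x - y)).
  by have := is_deriveN (is_derive_rtrig_reflect D A x y); rewrite opprK.
rewrite int01_cst (int01_derivative dF) // opprK subr0.
by rewrite -[rtrig D A (x - 1)](rtrig_periodic D A) subrK addNr addr0.
Qed.

End TorusIntegral.

(** * The essential sup norm *)

Section LinftyNorm.
Variable R : realType.
Implicit Types (f g : R -> R).

Let mu := @lebesgue_measure R.

Lemma torus_measure_gt0 : (0 < torus_measure R [set: measurableTypeR R])%E.
Proof.
change (0 < @lebesgue_measure R ([set: R] `&` `[0%R, 1%R]%classic))%E.
rewrite setTI.
have -> : lebesgue_measure `[0%R, 1%R]%classic = 1%E :> \bar R by exact: mu01.
exact: lte01.
Qed.

Lemma Linfty_norm_leP g (c : \bar R) :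
  (Linfty_norm g <= c)%E <->
  (\forall x \ae torus_measure R, (`|g x|%:E <= c)%E).
Proof.
rewrite /Linfty_norm unlock torus_measure_gt0; split.
  by move/ess_supP.
by move=> h; apply/ess_supP.
Qed.

Lemma Linfty_norm_le g (c : R) : (forall x, `|g x| <= c) ->
  (Linfty_norm g <= c%:E)%E.
Proof.
by move=> gc; apply/Linfty_norm_leP; apply: nearW => x; rewrite lee_fin.
Qed.

Lemma Linfty_norm_ge0 g : (0 <= Linfty_norm g)%E.
Proof. exact: Lnorm_ge0. Qed.

Lemma continuous_le_Linfty_norm g (c : R) : periodic g 1 -> continuous g ->
  (Linfty_norm g <= c%:E)%E -> forall x, `|g x| <= c.
Proof.
move=> gp gc /Linfty_norm_leP [N [mN N0 sub]] x.
rewrite -(periodic_int (- Num.floor x) x gp).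
have y01 : 0 <= x + (- Num.floor x)%:~R < 1.
  by have := floor_itv x; rewrite intrD mulrNz; lra.
move: (x + _) y01 => y y01.
rewrite leNgt; apply/negP => cy.
have hc : (fun z => `|g z|) @ y --> `|g y|.
  by apply: cvg_norm; exact: gc.
have : \forall z \near y, c < `|g z| by exact: (cvgr_gt `|g y| hc c cy).
move=> /nbhs_ballP[d /= d0 hd].
(* The interval is taken to the right of [y], which lies in [0, 1): it has positive length and stays
   inside the fundamental domain even for [y = 0]. *)
pose b := Num.min (y + d) 1.
have yb : y < b by rewrite /b lt_min ltrDl d0; case/andP: y01.
have sJ : (`]y, b[ `<=` N `&` `[0%R, 1%R])%classic.
  move=> z /=; rewrite in_itv /= /b lt_min => /andP[yz /andP[zd z1]]; split.
    apply: sub => /=; apply/negP; rewrite -ltNge lte_fin; apply: hd.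
    rewrite /ball /= distrC ger0_norm ?subr_ge0 ?(ltW yz) //.
    by rewrite ltrBlDl.
  by rewrite in_itv /= (ltW z1) andbT (le_trans _ (ltW yz)) //; case/andP: y01.
have : (mu `]y, b[%classic <= mu (N `&` `[0%R, 1%R]%classic))%E.
  apply: le_measure => //; rewrite inE; first exact: measurable_itv.
  by apply: measurableI => //; exact: measurable_itv.
have -> : mu (N `&` `[0%R, 1%R]%classic) = 0%E by exact: N0.
rewrite /mu lebesgue_measure_itv /= lte_fin yb -EFinB lee_fin.
by rewrite leNgt subr_gt0 yb.
Qed.

(** The datum is bounded only almost everywhere; clipping yields a representative bounded at every
    point, with the same integrals against continuous functions ([int01_clip]). *)
Definition clip (M : R) f (x : R) : R := Num.max (Num.min (f x) M) (- M).

Lemma clip_norm_le M f x : 0 <= M -> `|clip M f x| <= M.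
Proof.
move=> M0; rewrite ler_norml /clip le_max lexx orbT /= ge_max ge_min lexx orbT /=.
by rewrite (le_trans _ M0) // oppr_le0.
Qed.

Lemma clip_id M f x : `|f x| <= M -> clip M f x = f x.
Proof.
rewrite ler_norml => /andP[h1 h2]; rewrite /clip.
by rewrite (min_idPl h2) (max_idPl h1).
Qed.

Lemma clip_measurable M f : measurable_fun [set: measurableTypeR R] f ->
  measurable_fun [set: measurableTypeR R] (clip M f).
Proof.
move=> mf; apply: measurable_maxr; last exact: measurable_cst.
by apply: measurable_minr => //; exact: measurable_cst.
Qed.

Lemma int01_clip M f (phi : R -> R) :
  measurable_fun [set: measurableTypeR R] f -> continuous phi ->
  (Linfty_norm f <= M%:E)%E ->
  int01 (fun x => f x * phi x) = int01 (fun x => clip M f x * phi x).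
Proof.
move=> mf cphi /Linfty_norm_leP [N [mN N0 sub]].
have mphi : measurable_fun [set: measurableTypeR R] phi.
  exact: continuous_measurable_fun.
have m01 : measurable (`[0%R, 1%R]%classic : set (measurableTypeR R)).
  exact: measurable_itv.
congr fine; apply: ae_eq_integral => //.
- apply/measurable_EFinP; apply: measurable_funTS.
  exact: measurable_funM.
- apply/measurable_EFinP; apply: measurable_funTS.
  by apply: measurable_funM => //; exact: clip_measurable.
exists (N `&` `[0%R, 1%R]%classic); split.
- exact: measurableI.
- exact: N0.
move=> x /= /not_implyP[x01 ne]; split=> //; apply: sub => /= fx.
by apply: ne; rewrite /= clip_id // -lee_fin.
Qed.

End LinftyNorm.

(** * Fourier coefficients and the de la Vallee Poussin majorant *)

Section FourierCoefficients.
Variable R : realType.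
Implicit Types (f g : R -> R) (p q : {poly R[i]}) (N D : nat).

Lemma Im_trig D p x : Im (trig D p x) = rtrig D (- 'i *: p) x.
Proof.
rewrite /rtrig trigZ; case: (trig D p x) => a b /=.
by rewrite oppr0 mul0r sub0r mulN1r opprK.
Qed.

Lemma fourier_coef_rtrig N D q j : real_trig D q -> (N <= D)%N ->
  fourier_coef (rtrig D q) (j%:Z - N%:Z) = q`_(j + (D - N)).
Proof.
move=> rq ND; set r := 'X^N * q.
have gE x : (rtrig D q x)%:C * expi (- (2 * pi * (j%:Z - N%:Z)%:~R * x)) =
    trig (D + j) r x.
  rewrite (real_trigC x rq) /trig /r hornerM hornerXn -eMn.
  have -> : expi (- (2 * pi * (j%:Z - N%:Z)%:~R * x)) =
      e ((N%:R - j%:R) * x) :> R[i].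
    by rewrite /e intrB -!pmulrn; congr expi; ring.
  rewrite mulrAC [RHS]mulrA -!eD; congr (e _ * _).
  by rewrite natrD; ring.
have rE : r`_(D + j) = q`_(j + (D - N)).
  rewrite /r coefXnM ifF; last by apply/negbTE; lia.
  by congr (_`_ _); lia.
rewrite /fourier_coef /integral01.
have -> : (fun x => complex.Re ((rtrig D q x)%:C *
    expi (- (2 * pi * (j%:Z - N%:Z)%:~R * x)))) = rtrig (D + j) r.
  by apply/funext => x; rewrite gE.
have -> : (fun x => complex.Im ((rtrig D q x)%:C *
    expi (- (2 * pi * (j%:Z - N%:Z)%:~R * x)))) = rtrig (D + j) (- 'i *: r).
  by apply/funext => x; rewrite gE Im_trig.
rewrite -!/(int01 _) !int01_rtrig coefZ rE.
by case: (q`_ _) => a b /=; rewrite oppr0 mul0r sub0r mulN1r opprK.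
Qed.

Definition fourier_poly N f : {poly R[i]} :=
  \poly_(j < N.*2.+1) fourier_coef f (j%:Z - N%:Z).

Lemma Pi_N_trig N f x : Pi_N N f x = trig N (fourier_poly N f) x.
Proof.
rewrite (trigE _ _ (size_poly _ _)); apply: eq_bigr => j _.
rewrite coef_poly ltn_ord /e intrB -!pmulrn; congr (_ * expi _); ring.
Qed.

Lemma fourier_poly_rtrig N q : real_trig (N + N) q ->
  fourier_poly N (rtrig (N + N) q) = proj N q.
Proof.
move=> rq; apply/polyP => j; rewrite coef_poly coef_proj ltnS.
by case: leqP => // jN; rewrite fourier_coef_rtrig ?leq_addr // addnK.
Qed.

Definition geom n : {poly R[i]} := \poly_(i < n) 1.

Lemma horner_geom n x : (geom n).[e x] = \sum_(i < n) e (i%:R * x).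
Proof.
by rewrite horner_poly; apply: eq_bigr => i _; rewrite mul1r eMn.
Qed.

Lemma conj_geom n x : conjc (geom n.+1).[e x] = e (- (n%:R * x)) * (geom n.+1).[e x].
Proof.
rewrite horner_geom conjc_sum mulr_sumr (reindex_inj rev_ord_inj).
apply: eq_bigr => i _; rewrite conj_e -eD; congr e.
have ni : (i <= n)%N by rewrite -ltnS.
by rewrite /= subSS natrB //; ring.
Qed.

Lemma sqr_normc_geom n x :
  normc (geom n.+1).[e x] ^+ 2 = rtrig n (geom n.+1 * geom n.+1) x.
Proof.
rewrite /rtrig /trig hornerM mulrA -conj_geom mulrC mul_conj.
by [].
Qed.

Lemma coef_geomM n m k : (n <= k.+1)%N -> (k < m)%N ->
  (geom n * geom m)`_k = n%:R.
Proof.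
move=> nk km; rewrite coefM.
rewrite (eq_bigr (fun i : 'I_k.+1 => if (i < n)%N then 1 else 0)); last first.
  move=> i _; rewrite !coef_poly; have -> : (k - i < m)%N by lia.
  by case: ifP => _; rewrite ?mulr1 ?mul0r.
rewrite (@big_ord_widen0 _ (fun i => if (i < n)%N then 1 else 0) n k.+1 nk).
  rewrite (eq_bigr (fun=> 1)) ?sumr_const ?card_ord // => i _.
  by rewrite ltn_ord.
by move=> i ni; rewrite ltnNge ni.
Qed.

(* A de la Vallee Poussin kernel: its coefficients form a trapezoid equal to
   [1] at the frequencies [|k| <= N], and its L^1 norm is at most [2]. *)
Definition vp_kernel N : {poly R[i]} :=
  (N%:R^-1)%:C *: ('X * (geom N * geom (3 * N))).

Lemma size_vp_kernel N : (0 < N)%N -> (size (vp_kernel N) <= (N + N).*2.+1)%N.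
Proof.
move=> N0; apply: leq_trans (size_scale_leq _ _) _.
apply: leq_trans (size_polyMleq _ _) _; rewrite size_polyX add2n /= ltnS.
apply: leq_trans (size_polyMleq _ _) _; rewrite -subn1 leq_subLR.
apply: leq_trans (leq_add (size_poly _ _) (size_poly _ _)) _; lia.
Qed.

Lemma coef_vp_kernel N j : (0 < N)%N -> (j <= N.*2)%N -> (vp_kernel N)`_(j + N) = 1.
Proof.
move=> N0 jN; rewrite coefZ coefXM ifF; last by apply/negbTE; lia.
rewrite coef_geomM; [|lia|lia].
rewrite -(rmorph_nat (real_complex R)) -rmorphM mulVf ?rmorph1 //.
by rewrite pnatr_eq0 -lt0n.
Qed.

(** The factor ['X] makes the symmetric coefficients occupy the indices 1 to 4N - 1, centred at
    [N + N]. *)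
Lemma real_vp_kernel N : (0 < N)%N -> real_trig (N + N) (vp_kernel N).
Proof.
move=> N0; split; first exact: size_vp_kernel.
move=> x; apply/conj_real; rewrite /trig /vp_kernel hornerZ !hornerM hornerX.
case: N N0 => // n _.
have e3 : (3 * n.+1 = (3 * n).+2.+1)%N by lia.
rewrite e3 !conjcM conjc_real !conj_geom !conj_e.
set A := (geom _).[_]; set B := (geom _).[_]; set c := (_^-1)%:C.
have -> : e (- - ((n.+1 + n.+1)%:R * x)) * (c * (e (- x) *
    (e (- (n%:R * x)) * A * (e (- ((3 * n).+2%:R * x)) * B)))) =
  (e (- - ((n.+1 + n.+1)%:R * x)) * e (- x) * e (- (n%:R * x)) *
    e (- ((3 * n).+2%:R * x))) * (c * (A * B)) by ring.
have -> : e (- ((n.+1 + n.+1)%:R * x)) * (c * (e x * (A * B))) =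
  (e (- ((n.+1 + n.+1)%:R * x)) * e x) * (c * (A * B)) by ring.
rewrite -!eD; congr (e _ * _).
have a1 : n.+1%:R = n%:R + 1 :> R by rewrite natr1.
have a2 : (3 * n).+2%:R = 3 * n%:R + 2 :> R by rewrite -addn2 natrD natrM.
by rewrite natrD a1 a2; ring.
Qed.

(** The inequality between means for the product of two geometric sums. The squares are Fejer
    kernels up to normalization, with means N and 3N read off one coefficient, whence the L^1 bound
    (N + 3N) / (2N) = 2. *)
Lemma vp_kernel_le N x : (0 < N)%N -> `|rtrig (N + N) (vp_kernel N) x| <=
  (2 * N%:R)^-1 * (rtrig N.-1 (geom N * geom N) x +
    rtrig (3 * N).-1 (geom (3 * N) * geom (3 * N)) x).
Proof.
move=> N0; apply: le_trans (norm_rtrig_le _ _ _) _.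
have n0 : (0 : R) < N%:R by rewrite ltr0n.
rewrite /vp_kernel hornerZ !hornerM hornerX !normcM normc_e mul1r normc_real.
rewrite ger0_norm ?invr_ge0 ?ler0n //.
have s1 : rtrig N.-1 (geom N * geom N) x = normc (geom N).[e x] ^+ 2.
  by case: (N) N0 => // n _; rewrite sqr_normc_geom.
have s2 : rtrig (3 * N).-1 (geom (3 * N) * geom (3 * N)) x =
    normc (geom (3 * N)).[e x] ^+ 2.
  have -> : (3 * N = (3 * N).-1.+1)%N by lia.
  by rewrite sqr_normc_geom.
rewrite s1 s2 invfM [2^-1 * _]mulrC -mulrA ler_wpM2l ?invr_ge0 ?ler0n //.
have := sqr_ge0 (normc (geom N).[e x] - normc (geom (3 * N)).[e x]).
by rewrite !expr2; lra.
Qed.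

Section Majorant.
Variables (f : R -> R) (M : R) (N : nat).
Hypotheses (N0 : (0 < N)%N) (fL : in_Linfty f) (fM : Linfty_norm f = M%:E).

Let M0 : 0 <= M.
Proof. by rewrite -lee_fin -fM Linfty_norm_ge0. Qed.

Let mf : measurable_fun [set: measurableTypeR R] f.
Proof. by have [_ /andP[+ _]] := fL; rewrite inE. Qed.

Let f1 := clip M f.

Let integrable_mul phi : continuous phi -> integrable01 (fun y => f1 y * phi y).
Proof.
move=> cphi; have m01 : measurable (`[0%R, 1%R]%classic : set (measurableTypeR R)).
  exact: measurable_itv.
apply: (@le_integrable _ _ _ (@lebesgue_measure R) _ m01 _
  (EFin \o (fun y => M * phi y))).
- apply/measurable_EFinP; apply: measurable_funTS; apply: measurable_funM.
    exact: clip_measurable.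
  exact: continuous_measurable_fun.
- move=> y _; rewrite /= lee_fin !normrM ler_wpM2r // (ger0_norm M0).
  exact: clip_norm_le.
- apply: continuous_integrable01 => y.
  by apply: continuousM; [exact: cst_continuous|exact: cphi].
Qed.

Let cint (psi : R -> R[i]) : R[i] :=
  int01 (fun y => f1 y * Re (psi y)) +i* int01 (fun y => f1 y * Im (psi y)).

Let cont (psi : R -> R[i]) := continuous (fun y => Re (psi y)) /\
  continuous (fun y => Im (psi y)).

Let cint_sum n (alpha : 'I_n -> R[i]) (psi : 'I_n -> R -> R[i]) :
  (forall j, cont (psi j)) ->
  \sum_(j < n) alpha j * cint (psi j) =
  cint (fun y => \sum_(j < n) alpha j * psi j y).
Proof.
move=> cpsi.
have scal (a : R) phi : continuous phi ->
    integrable01 (fun y => a * (f1 y * phi y)) /\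
    int01 (fun y => a * (f1 y * phi y)) = a * int01 (fun y => f1 y * phi y).
  move=> cphi; split; last by apply: int01Z; exact: integrable_mul.
  have := integrable_mul (phi := fun y => a * phi y) _.
  have -> : (fun y => f1 y * (a * phi y)) = (fun y => a * (f1 y * phi y)).
    by apply/funext => y; rewrite mulrCA.
  apply=> y; apply: continuousM; [exact: cst_continuous|exact: cphi].
have R1 j := scal (Re (alpha j)) _ (cpsi j).1.
have R2 j := scal (- Im (alpha j)) _ (cpsi j).2.
have I1 j := scal (Re (alpha j)) _ (cpsi j).2.
have I2 j := scal (Im (alpha j)) _ (cpsi j).1.
rewrite /cint.
have -> : (fun y => f1 y * Re (\sum_(j < n) alpha j * psi j y)) =
  (fun y => \sum_(j < n) (Re (alpha j) * (f1 y * Re (psi j y))) +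
   \sum_(j < n) (- Im (alpha j) * (f1 y * Im (psi j y)))).
  apply/funext => y; rewrite Re_sum mulr_sumr -big_split /=.
  apply: eq_bigr => j _; case: (alpha j) (psi j y) => [a b] [c d] /=; ring.
have -> : (fun y => f1 y * Im (\sum_(j < n) alpha j * psi j y)) =
  (fun y => \sum_(j < n) (Re (alpha j) * (f1 y * Im (psi j y))) +
   \sum_(j < n) (Im (alpha j) * (f1 y * Re (psi j y)))).
  apply/funext => y.
  have -> z : Im z = Re (- 'i * z) :> R.
    by case: z => a b /=; rewrite oppr0 mul0r sub0r mulN1r opprK.
  rewrite mulr_sumr Re_sum mulr_sumr -big_split /=.
  apply: eq_bigr => j _; case: (alpha j) (psi j y) => [a b] [c d] /=; ring.
have [i1 e1] := int01_sum (fun j => (R1 j).1).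
have [i2 e2] := int01_sum (fun j => (R2 j).1).
have [i3 e3] := int01_sum (fun j => (I1 j).1).
have [i4 e4] := int01_sum (fun j => (I2 j).1).
rewrite (int01D i1 i2) (int01D i3 i4) e1 e2 e3 e4 -!big_split /=.
rewrite [LHS]complexE Re_sum.
have -> z : Im z = Re (- 'i * z) :> R.
  by case: z => a b /=; rewrite oppr0 mul0r sub0r mulN1r opprK.
rewrite mulr_sumr Re_sum mulrC; simpc; congr (_ +i* _).
  apply: eq_bigr => j _; rewrite (R1 j).2 (R2 j).2.
  by case: (alpha j) => a b /=; ring.
apply: eq_bigr => j _; rewrite (I1 j).2 (I2 j).2.
by case: (alpha j) => a b /=; ring.
Qed.

Let cont_trig D p : cont (trig D p).
Proof.
split; first exact: rtrig_continuous.
have -> : (fun y => Im (trig D p y)) = rtrig D (- 'i *: p).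
  by apply/funext => y; rewrite Im_trig.
exact: rtrig_continuous.
Qed.

Let fourier_cint m D : fourier_coef f (m%:Z - D%:Z) = cint (trig m 'X^D).
Proof.
rewrite /fourier_coef /integral01 -!/(int01 _).
have gE x : expi (- (2 * pi * (m%:Z - D%:Z)%:~R * x)) = trig m 'X^D x :> R[i].
  rewrite /trig hornerXn -eMn -eD /e intrB -!pmulrn; congr expi; ring.
have [c1 c2] := cont_trig m 'X^D.
rewrite /cint -(int01_clip mf c1) ?fM // -(int01_clip mf c2) ?fM //.
congr (int01 _ +i* int01 _); apply/funext => x; rewrite gE.
  by case: (trig m _ x) => a b /=; rewrite mul0r subr0.
by case: (trig m _ x) => a b /=; rewrite mul0r addr0.
Qed.

(** [q] is the convolution of [f] with the kernel. It shares the frequencies |k| <= N with [f], and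
    its sup norm is free of the logarithm that [Pi_N] may introduce. *)
Lemma fourier_majorant : exists q,
  [/\ real_trig (N + N) q, sup_le q (2 * M) & proj N q = fourier_poly N f].
Proof.
set D := (N + N)%N.
pose q : {poly R[i]} := \poly_(m < D.*2.+1)
  ((vp_kernel N)`_m * fourier_coef f (m%:Z - D%:Z)).
have sq : (size q <= D.*2.+1)%N by exact: size_poly.
have rv := real_vp_kernel N0; have [sv hv] := rv.
have qE x : trig D q x =
    (int01 (fun y => f1 y * rtrig D (vp_kernel N) (x - y)))%:C.
  rewrite (trigE _ _ sq).
  rewrite (eq_bigr (fun m : 'I_D.*2.+1 =>
     ((vp_kernel N)`_m * e ((m%:R - D%:R) * x)) * cint (trig m 'X^D))); last first.
    by move=> m _; rewrite coef_poly ltn_ord fourier_cint mulrAC.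
  rewrite cint_sum; last by move=> j; exact: cont_trig.
  have -> : (fun y => \sum_(m < D.*2.+1)
     (vp_kernel N)`_m * e ((m%:R - D%:R) * x) * trig m 'X^D y) =
     fun y => trig D (vp_kernel N) (x - y).
    apply/funext => y; rewrite (trigE _ _ sv); apply: eq_bigr => m _.
    rewrite /trig hornerXn -eMn -mulrA -!eD; congr (_ * e _); ring.
  rewrite /cint; congr (_ +i* _).
  have -> : (fun y => f1 y * Im (trig D (vp_kernel N) (x - y))) = fun=> 0.
    by apply/funext => y; rewrite hv mulr0.
  exact: int01_cst.
have rq : real_trig D q by split=> // x; rewrite qE.
exists q; split=> //; last first.
  apply/polyP => j; rewrite coef_proj !coef_poly !ltnS; case: (leqP j N.*2) => // jN.
  rewrite coef_vp_kernel // mul1r ifT; last by rewrite /D; lia.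
  by congr fourier_coef; rewrite /D; lia.
move=> x; rewrite -(normc_trig D) qE normc_real.
have cr E p : continuous (fun y => rtrig E p (x - y)).
  exact: rtrig_reflect_continuous.
have m01 : measurable (`[0%R, 1%R]%classic : set (measurableTypeR R)).
  exact: measurable_itv.
set g1 := geom N * geom N; set g3 := geom (3 * N) * geom (3 * N).
set c : R := (2 * N%:R)^-1.
pose B y := (M * c) * (rtrig N.-1 g1 (x - y) + rtrig (3 * N).-1 g3 (x - y)).
have i1 := continuous_integrable01 (cr N.-1 g1).
have i3 := continuous_integrable01 (cr (3 * N).-1 g3).
have i13 : integrable01 (fun y => rtrig N.-1 g1 (x - y) + rtrig (3 * N).-1 g3 (x - y)).
  exact: (integrableD m01 i1 i3).
have iB : integrable01 B by exact: (integrableZl m01 (M * c) i13).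
have h0 := integrable_mul (cr D (vp_kernel N)).
apply: le_trans (le_normr_Rintegral m01 h0) _.
apply: (@le_trans _ _ (int01 B)).
  apply: le_Rintegral => //; first exact: integrable_norm h0.
  move=> y _; rewrite normrM /B -mulrA; apply: ler_pM => //.
    exact: clip_norm_le.
  exact: vp_kernel_le.
rewrite /B int01Z // int01D // !int01_rtrig_reflect /g1 /g3.
rewrite !coef_geomM; [|lia|lia|lia|lia].
have Ren (k : nat) : Re (k%:R : R[i]) = k%:R.
  by rewrite -(rmorph_nat (real_complex R)).
have n0 : (N%:R : R) != 0 by rewrite pnatr_eq0 -lt0n.
rewrite !Ren natrM /c le_eqVlt; apply/orP; left; apply/eqP.
by field.
Qed.

End Majorant.

End FourierCoefficients.

(** * Solutions of the scheme as polynomial iterates *)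

Section SchemeSolution.
Variable R : realType.

Lemma derivable_is_derive1 (g : R -> R) (x : R) :
  derivable g x 1 -> is_derive x 1 g (derive1 g x).
Proof. by move=> h; rewrite derive1E; exact/derivableP. Qed.

Lemma derive1_rtrig N (p : {poly R[i]}) : derive1 (rtrig N p) = rtrig N (dtrig N p).
Proof.
apply/funext => x; rewrite derive1E.
exact: (@derive_val _ _ _ _ _ _ _ (is_derive_rtrig N p x)).
Qed.

(* The implicit step is uniquely solvable by the maximum principle. *)
Lemma scheme_solution_trig (nu tau : R) N f u : 0 < nu -> 0 < tau ->
  scheme_solution nu tau N f u ->
  real_trig N (fourier_poly N f) /\
  forall n, u n = rtrig N (iter n (step nu tau N) (fourier_poly N f)).
Proof.
move=> nu0 tau0 [up ud u0 us]; set P0 := fourier_poly N f.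
have r0 : real_trig N P0.
  split; first exact: size_poly.
  by move=> x; rewrite -Pi_N_trig -u0.
have rP n : real_trig N (iter n (step nu tau N) P0).
  by elim: n => [//|n ih]; rewrite iterS; exact: real_step.
split=> //; elim=> [|n ih].
  by apply/funext => x; rewrite /= /rtrig -Pi_N_trig -u0.
set p := iter n _ _ in ih; have rp : real_trig N p by exact: rP.
set a := tau * nu ^+ 2; have a0 : 0 <= a.
  by rewrite mulr_ge0 ?sqr_ge0 // ltW.
have adv x : Pi_N N (fun y => u n y * derive1 (u n) y) x = trig N (advection N p) x.
  have -> : (fun y => u n y * derive1 (u n) y) = rtrig (N + N) (p * dtrig N p).
    by apply/funext => y; rewrite rtrigM // ih derive1_rtrig.
  rewrite Pi_N_trig fourier_poly_rtrig //.
  by apply: real_trigM => //; exact: real_dtrig.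
pose w := iter n.+1 (step nu tau N) P0.
pose d x := u n.+1 x - rtrig N w x.
pose d1 x := derive1 (u n.+1) x - rtrig N (dtrig N w) x.
pose d2 x := derive1 (derive1 (u n.+1)) x - rtrig N (dtrig N (dtrig N w)) x.
have dd (x : R) : is_derive x 1 d (d1 x).
  apply: is_deriveB; first exact: derivable_is_derive1 (ud _ _).1.
  exact: is_derive_rtrig.
have dd1 (x : R) : is_derive x 1 d1 (d2 x).
  apply: is_deriveB; first exact: derivable_is_derive1 (ud _ _).2.
  exact: is_derive_rtrig.
have dp : periodic d 1 by move=> x; rewrite /d up rtrig_periodic.
have d0 x : `|d x| <= 0.
  apply: (resolvent_norm_le dp dd dd1 a0) => y.
  suff -> : d y - a * d2 y = 0 by rewrite normr0.
  have := us n y; rewrite adv => /(congr1 (@complex.Re R)); rewrite ReD /=.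
  rewrite -/(rtrig N (advection N p) y) ih => h.
  have := resolvent_rtrig N (p - tau%:C *: advection N p) y a0.
  rewrite -/(step nu tau N p) rtrigD rtrigN rtrigZ -iterS -/w => h2.
  rewrite /d /d2.
  have h3 : u n.+1 y - rtrig N p y + tau * rtrig N (advection N p) y =
     a * derive1 (derive1 (u n.+1)) y.
    have := congr1 (fun z => tau * z) h.
    rewrite mulrDr mulrCA divff ?gt_eqF // mulr1 => ->.
    by rewrite /a mulrA.
  move: h2 h3; lra.
apply/funext => x; apply/eqP; rewrite -subr_eq0 -normr_le0.
exact: d0.
Qed.

End SchemeSolution.

(** * Choice of the parameters *)

Section PowerBounds.
Variable R : realType.

Lemma lam_powR (r : R) : 0 < r ->
  exists2 c : R, 1 <= c & forall D, (0 < D)%N -> lam R D <= c * D%:R `^ r.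
Proof.
(* The logarithm in the harmonic sum at 2D is absorbed by ln x <= x^r / r, and the constants by x^r
   >= 1. *)
move=> r0; exists ((3 + 2 / r) * 2 `^ r).
  have h1 : 1 <= 3 + 2 / r by have : 0 <= 2 / r by [rewrite divr_ge0 // ltW]; lra.
  have h2 : 1 <= 2 `^ r :> R by rewrite -{1}(powRr0 2); apply: ler_powR; rewrite ?ler1n ?ltW.
  by rewrite -[leLHS]mulr1 ler_pM.
move=> D D0; have d0 : (0 : R) < D%:R by rewrite ltr0n.
have D20 : (0 < D.*2)%N by lia.
have e2 : D.*2%:R = 2 * D%:R :> R by rewrite -mul2n natrM.
have h := harmonic_le R D20.
rewrite -mulrA -powRM ?ler0n //.
have x1 : 1 <= 2 * D%:R :> R by rewrite -e2 ler1n.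
rewrite e2 in h.
have p1 : 1 <= (2 * D%:R) `^ r :> R.
  by rewrite -{1}(powRr0 (2 * D%:R)); apply: ler_powR => //; exact: ltW.
have hl : ln (2 * D%:R) <= (2 * D%:R) `^ r / r :> R.
  rewrite ler_pdivlMr // [leLHS]mulrC -ln_powR; apply: ltW; apply: ln_sublinear.
  exact: lt_le_trans ltr01 p1.
rewrite /lam; move: hl h p1; move: (ln _) (_ `^ r) (\sum_(_ < _) _) => l p S hl h p1.
have -> : (3 + 2 / r) * p = 3 * p + 2 * (p / r) by ring.
lra.
Qed.

Lemma powR_small (r Y : R) : 0 < r -> 0 < Y ->
  exists2 d, 0 < d & forall t, 0 < t -> t < d -> t `^ r <= Y.
Proof.
move=> r0 Y0; exists (Y `^ r^-1); first exact: powR_gt0.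
move=> t t0 td.
have -> : Y = (Y `^ r^-1) `^ r by rewrite -powRrM mulVf ?powRr1 ?gt_eqF // ltW.
apply: ge0_ler_powR; rewrite ?nnegrE ?powR_ge0 ?(ltW r0) ?(ltW t0) ?(ltW td) //.
Qed.

Lemma powR_antimono (t r s : R) : 0 < t -> t <= 1 -> r <= s -> t `^ s <= t `^ r.
Proof. by move=> t0 t1 rs; apply: ger_powR => //; rewrite t0. Qed.

Lemma powR_mul (x r s : R) : 0 < x -> x `^ r * x `^ s = x `^ (r + s).
Proof. by move=> x0; rewrite powRD // (gt_eqF x0) implybT. Qed.

End PowerBounds.

Section ErrorBound.
Variables (R : realType) (nu tau E B B3 b c : R) (N : nat).
Hypotheses (nu0 : 0 < nu) (tau0 : 0 < tau) (tau1 : tau <= 1) (N0 : (0 < N)%N).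
Hypotheses (B0 : 0 <= B) (b0 : 0 <= b) (c1 : 1 <= c).

Variables (eps sig : R).
Hypotheses (eps0 : 0 < eps) (eps1 : 32 * eps <= 1) (sig1 : sig + 3 * eps <= 2^-1).
Local Notation n := (N%:R : R).

(** Logarithms are traded for n^eps. [B] is bounded in two ways: through [lam_bound] for errors that
    decay in [N], through tau^(-eps) for those that decay in [tau]. The late errors need -3/2 +
    15/16 + 2 eps <= -1/2, which is [eps1]; the first steps need tau^(1/2 - 3 eps) <= tau^sig, which
    is [sig1]. *)
Let lam_bound := 2 * c * n `^ eps.

Hypotheses (lamN : lam R N <= lam_bound) (lamN2 : lam R (N + N) <= lam_bound).
Hypotheses (BN : B <= b * lam_bound) (Btau : B <= 2 * tau `^ (- eps)).

Let n1 : 1 <= n. Proof. by rewrite ler1n. Qed.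
Let n0 : 0 < n. Proof. exact: lt_le_trans n1. Qed.
Let nge0 : 0 <= n. Proof. exact: ltW. Qed.

Let nmono (r s : R) : r <= s -> n `^ r <= n `^ s.
Proof. by move=> rs; apply: ler_powR. Qed.

Let lamb0 : 0 <= lam_bound.
Proof. by rewrite mulr_ge0 ?powR_ge0 // mulr_ge0 // (le_trans ler01). Qed.

Let lamb1 : 1 <= lam_bound.
Proof. exact: le_trans (lam_ge1 _ _) lamN. Qed.

Lemma pow32V_powR : pow32V n = n `^ (- (3 / 2)).
Proof.
rewrite /pow32V -powR12_sqrt // -{1}(powRr1 nge0) powR_mul // -powRN.
by congr (_ `^ _); field.
Qed.

Lemma sqrt_tau_powR : Num.sqrt tau = tau `^ 2^-1.
Proof. by rewrite powR12_sqrt // ltW. Qed.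

(** If tau N <= 1, the factor [lam] costs at most N^eps <= tau^(-eps) up to a constant; otherwise
    N^(-1/2) < tau^(1/2). In both regimes the first three steps cost a power of [tau] alone. *)
Definition first_error : R :=
  if tau * n <= 1 then
    tau / 2 * (lam R (N + N) * ((nu * Num.sqrt tau)^-1 * B ^+ 2))
  else tau / 2 * ((nu * Num.sqrt tau)^-1 * B ^+ 2 +
    (tau * nu ^+ 2)^-1 * ((Num.sqrt N%:R)^-1 * (B * Num.sqrt (4 * E)))).

Let s0 : 0 < Num.sqrt tau. Proof. by rewrite sqrtr_gt0. Qed.

Let half_step (x : R) : tau / 2 * ((nu * Num.sqrt tau)^-1 * x) =
  (2 * nu)^-1 * (tau `^ 2^-1 * x).
Proof.
rewrite -sqrt_tau_powR -{1}(sqr_sqrtr (ltW tau0)).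
by field; rewrite !gt_eqF.
Qed.

Let Bsqr : B ^+ 2 <= 4 * (tau `^ (- eps) * tau `^ (- eps)).
Proof.
have -> : 4 * (tau `^ (- eps) * tau `^ (- eps)) = (2 * tau `^ (- eps)) ^+ 2.
  by rewrite expr2; ring.
by rewrite ler_sqr ?nnegrE // mulr_ge0 ?powR_ge0.
Qed.

Lemma first_error_le : first_error <=
  (4 * c / nu + 2 / nu + Num.sqrt (4 * E) / nu ^+ 2) * tau `^ sig.
Proof.
have c0 : 0 <= c by exact: le_trans c1.
have nuV : 0 <= (2 * nu)^-1 by rewrite invr_ge0 mulr_ge0 // ltW.
set T := tau `^ sig; have T0 : 0 <= T by exact: powR_ge0.
have t0 r : 0 <= tau `^ r by exact: powR_ge0.
have e0 : 0 <= Num.sqrt (4 * E) by exact: sqrtr_ge0.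
have a1 : 0 <= 4 * c / nu by rewrite divr_ge0 ?(ltW nu0) // mulr_ge0.
have a2 : 0 <= 2 / nu by rewrite divr_ge0 ?(ltW nu0).
have a3 : 0 <= Num.sqrt (4 * E) / nu ^+ 2 by rewrite divr_ge0 ?exprn_ge0 ?(ltW nu0).
rewrite /first_error; case: ifPn => [small|large].
  have -> : tau / 2 * (lam R (N + N) * ((nu * Num.sqrt tau)^-1 * B ^+ 2)) =
    (2 * nu)^-1 * (tau `^ 2^-1 * (lam R (N + N) * B ^+ 2)).
    by rewrite -half_step; ring.
  have nT : n `^ eps <= tau `^ (- eps).
    have -> : - eps = -1 * eps by ring.
    rewrite powRrM; apply: ge0_ler_powR; [exact: ltW | exact: nge0 | exact: powR_ge0 |].
    rewrite powRN powRr1 ?(ltW tau0) // -(ler_pM2l tau0) mulfV ?gt_eqF //.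
  have pT : tau `^ 2^-1 * (tau `^ (- eps) * (tau `^ (- eps) * tau `^ (- eps))) <= T.
    by rewrite !powR_mul //; apply: powR_antimono => //; move: eps0 eps1 sig1; lra.
  have h : lam R (N + N) * B ^+ 2 <=
      (2 * c * tau `^ (- eps)) * (4 * (tau `^ (- eps) * tau `^ (- eps))).
    apply: ler_pM => //; rewrite ?sqr_ge0 ?(le_trans ler01 (lam_ge1 _ _)) //.
    by apply: le_trans lamN2 _; rewrite ler_wpM2l // mulr_ge0.
  apply: (@le_trans _ _ (4 * c / nu * T)); last first.
    by rewrite ler_wpM2r // -addrA lerDl addr_ge0.
  apply: (@le_trans _ _ ((2 * nu)^-1 * (8 * c * T))).
    rewrite ler_wpM2l //; apply: le_trans (ler_wpM2l (t0 _) h) _.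
    apply: le_trans (ler_wpM2l _ pT); rewrite ?mulr_ge0 //.
    by rewrite le_eqVlt; apply/orP; left; apply/eqP; ring.
  by rewrite le_eqVlt; apply/orP; left; apply/eqP; field; rewrite gt_eqF.
have nT : (Num.sqrt n)^-1 <= tau `^ 2^-1.
  rewrite -sqrt_tau_powR -(ler_pM2l (_ : 0 < Num.sqrt n)) ?sqrtr_gt0 //.
  rewrite mulfV ?gt_eqF ?sqrtr_gt0 // -sqrtrM // -[leLHS]sqrtr1 ler_sqrt ?mulr_ge0 ?(ltW tau0) //.
  by rewrite mulrC; apply: ltW; rewrite ltNge.
have p1 : tau `^ 2^-1 * (tau `^ (- eps) * tau `^ (- eps)) <= T.
  by rewrite !powR_mul //; apply: powR_antimono => //; move: eps0 eps1 sig1; lra.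
have p2 : tau `^ 2^-1 * tau `^ (- eps) <= T.
  by rewrite !powR_mul //; apply: powR_antimono => //; move: eps0 eps1 sig1; lra.
rewrite mulrDr half_step.
have -> : tau / 2 * ((tau * nu ^+ 2)^-1 * ((Num.sqrt n)^-1 * (B * Num.sqrt (4 * E))))
  = (2 * nu ^+ 2)^-1 * Num.sqrt (4 * E) * ((Num.sqrt n)^-1 * B).
  by field; rewrite !gt_eqF ?sqrtr_gt0.
have h1 : tau `^ 2^-1 * B ^+ 2 <= 4 * T.
  apply: le_trans (ler_wpM2l (t0 _) Bsqr) _.
  by rewrite mulrCA ler_wpM2l.
have h2 : (Num.sqrt n)^-1 * B <= 2 * T.
  apply: (@le_trans _ _ (tau `^ 2^-1 * (2 * tau `^ (- eps)))).
    by apply: ler_pM => //; rewrite invr_ge0 sqrtr_ge0.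
  by rewrite mulrCA ler_wpM2l.
have k1 := ler_wpM2l nuV h1.
have k2 : (2 * nu ^+ 2)^-1 * Num.sqrt (4 * E) * ((Num.sqrt n)^-1 * B) <=
  (2 * nu ^+ 2)^-1 * Num.sqrt (4 * E) * (2 * T).
  by rewrite ler_wpM2l // mulr_ge0 // invr_ge0 mulr_ge0 // exprn_ge0 // ltW.
apply: le_trans (lerD k1 k2) _.
have -> : (2 * nu)^-1 * (4 * T) + (2 * nu ^+ 2)^-1 * Num.sqrt (4 * E) * (2 * T)
  = (2 / nu + Num.sqrt (4 * E) / nu ^+ 2) * T by field; rewrite gt_eqF.
by rewrite ler_wpM2r // -addrA lerDr.
Qed.

Definition error_const : R :=
  3 * (4 * c / nu + 2 / nu + Num.sqrt (4 * E) / nu ^+ 2) + 8 * Num.sqrt B3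
  + 3 * 16 * 16 * b * c ^+ 2 * Num.sqrt B3
  + 16 * b * c ^+ 3 * (2 * b + 8 * 16 * Num.sqrt (4 * E)).

(* With [h = n^(-5/4)] the two terms of the interpolation bound for the early
   derivative balance, up to constants. With [t1 = n^(-a)] the late and the early
   errors are of orders [n^(a/2 - 3/2)] and [n^(5/4 - a)] up to powers [n^eps], and
   both beat [n^(-1/2)] for [7/4 < a < 2]. *)
Let t1 : R := n `^ (- (15 / 8)).
Let h : R := n `^ (- (5 / 4)).

(** The Taylor errors along characteristics, summed over all times: the earliest steps dominate. *)
Lemma early_error_le :
  B ^+ 2 * Num.sqrt B3 * (2 * Num.sqrt tau) <=
  8 * Num.sqrt B3 * tau `^ sig.
Proof.
have e0 : 0 <= Num.sqrt B3 by exact: sqrtr_ge0.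
have p1 : tau `^ 2^-1 * (tau `^ (- eps) * tau `^ (- eps)) <= tau `^ sig.
  by rewrite !powR_mul //; apply: powR_antimono => //; move: eps0 eps1 sig1; lra.
rewrite sqrt_tau_powR.
have -> : B ^+ 2 * Num.sqrt B3 * (2 * tau `^ 2^-1) =
  2 * Num.sqrt B3 * (tau `^ 2^-1 * B ^+ 2) by ring.
have -> : 8 * Num.sqrt B3 * tau `^ sig =
  2 * Num.sqrt B3 * (4 * tau `^ sig) by ring.
rewrite ler_wpM2l ?mulr_ge0 //.
apply: le_trans (ler_wpM2l (powR_ge0 _ _) Bsqr) _.
by rewrite mulrCA ler_wpM2l.
Qed.

(** The truncated frequencies after [t1], with one factor n^eps from [lam] and one from [B]. *)
Lemma late_error_le :
  24 * pow32V n * ((1 + lam R N) * B * Num.sqrt B3) * (4 / Num.sqrt t1) <=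
  3 * 16 * 16 * b * c ^+ 2 * Num.sqrt B3 * n `^ (- 2^-1).
Proof.
have e0 : 0 <= Num.sqrt B3 by exact: sqrtr_ge0.
have c0 : 0 <= c by exact: le_trans c1.
have -> : (4 / Num.sqrt t1) = 4 * n `^ (15 / 16).
  rewrite -powR12_sqrt ?powR_ge0 // /t1 -powRrM -powRN.
  by congr (_ * _ `^ _); field.
have p1 : n `^ (- (3 / 2)) * (n `^ (15 / 16) * (n `^ eps * n `^ eps)) <= n `^ (- 2^-1).
  by rewrite !powR_mul //; apply: nmono; move: eps0 eps1 sig1; lra.
rewrite pow32V_powR.
have hl : 1 + lam R N <= 2 * lam_bound by move: lamb1 lamN; lra.
have q0 r : 0 <= n `^ r by exact: powR_ge0.
have hh : (1 + lam R N) * B <= (2 * lam_bound) * (b * lam_bound).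
  by apply: ler_pM => //; rewrite addr_ge0 // (le_trans ler01 (lam_ge1 _ _)).
have -> : 24 * n `^ (- (3 / 2)) * ((1 + lam R N) * B * Num.sqrt B3) * (4 * n `^ (15 / 16))
  = 96 * Num.sqrt B3 * n `^ (- (3 / 2)) * n `^ (15 / 16) * ((1 + lam R N) * B) by ring.
apply: le_trans (ler_wpM2l _ hh) _; first by rewrite !mulr_ge0.
rewrite /lam_bound.
have -> : 96 * Num.sqrt B3 * n `^ (- (3 / 2)) * n `^ (15 / 16) *
    (2 * (2 * c * n `^ eps) * (b * (2 * c * n `^ eps))) =
  3 * 16 * 16 * b * c ^+ 2 * Num.sqrt B3 *
    (n `^ (- (3 / 2)) * (n `^ (15 / 16) * (n `^ eps * n `^ eps))) by ring.
by rewrite ler_wpM2l // !mulr_ge0 // exprn_ge0.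
Qed.

(** The truncated frequencies before [t1], with one factor n^eps from [lam] and two from the product
    of [B] with the derivative bound. *)
Lemma middle_error_le :
  (1 + lam R (N + N)) * (B * (2 * B / h +
    (8 * n) ^+ 2 * Num.sqrt (N.*2.+1%:R * (4 * E)) * h)) * t1 <=
  16 * b * c ^+ 3 * (2 * b + 8 * 16 * Num.sqrt (4 * E)) * n `^ (- 2^-1).
Proof.
have e0 : 0 <= Num.sqrt (4 * E) by exact: sqrtr_ge0.
have c0 : 0 <= c by exact: le_trans c1.
have q0 r : 0 <= n `^ r by exact: powR_ge0.
have hl : 1 + lam R (N + N) <= 2 * lam_bound by move: lamb1 lamN2; lra.
have hh : 2 * B / h <= 2 * b * lam_bound * n `^ (5 / 4).
  rewrite /h powRN invrK ler_wpM2r //; move: BN; lra.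
have hs : Num.sqrt (N.*2.+1%:R * (4 * E)) <= 2 * n `^ 2^-1 * Num.sqrt (4 * E).
  rewrite sqrtrM ?ler0n // ler_wpM2r // powR12_sqrt //.
  have -> : 2 * Num.sqrt n = Num.sqrt (2 ^+ 2 * n).
    by rewrite sqrtrM ?sqr_ge0 // sqrtr_sqr ger0_norm.
  rewrite ler_sqrt ?mulr_ge0 ?exprn_ge0 // -natr1 -mul2n natrM; move: n1; lra.
have hp : n ^+ 2 * n `^ 2^-1 * h = n `^ (5 / 4).
  by rewrite -powR_mulrn // /h !powR_mul //; congr (_ `^ _); field.
have hs2 : (8 * n) ^+ 2 * Num.sqrt (N.*2.+1%:R * (4 * E)) * h <=
    8 * 16 * Num.sqrt (4 * E) * lam_bound * n `^ (5 / 4).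
  apply: (@le_trans _ _ ((8 * n) ^+ 2 * (2 * n `^ 2^-1 * Num.sqrt (4 * E)) * h)).
    by rewrite ler_wpM2r ?powR_ge0 // ler_wpM2l // sqr_ge0.
  have -> : (8 * n) ^+ 2 * (2 * n `^ 2^-1 * Num.sqrt (4 * E)) * h =
    8 * 16 * Num.sqrt (4 * E) * 1 * (n ^+ 2 * n `^ 2^-1 * h) by ring.
  by rewrite hp ler_wpM2r // ler_wpM2l // mulr_ge0.
have hsum := lerD hh hs2.
have t10 : 0 <= t1 by exact: powR_ge0.
have h00 : 0 <= h by exact: powR_ge0.
have L0 : 0 <= 1 + lam R (N + N) by rewrite addr_ge0 // (le_trans ler01 (lam_ge1 _ _)).
have I0 : 0 <= 2 * B / h + (8 * n) ^+ 2 * Num.sqrt (N.*2.+1%:R * (4 * E)) * h.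
  by rewrite addr_ge0 ?divr_ge0 ?mulr_ge0 ?sqr_ge0 ?sqrtr_ge0.
apply: (@le_trans _ _ ((2 * lam_bound) * ((b * lam_bound) *
  (2 * b * lam_bound * n `^ (5 / 4) +
   8 * 16 * Num.sqrt (4 * E) * lam_bound * n `^ (5 / 4))) * t1)).
  rewrite ler_wpM2r //; apply: ler_pM; rewrite ?mulr_ge0 //.
  exact: ler_pM.
have p1 : n `^ eps * (n `^ eps * (n `^ eps * (n `^ (5 / 4) * t1))) <= n `^ (- 2^-1).
  by rewrite /t1 !powR_mul //; apply: nmono; move: eps0 eps1 sig1; lra.
rewrite /lam_bound.
have -> : 2 * (2 * c * n `^ eps) *
  (b * (2 * c * n `^ eps) *
   (2 * b * (2 * c * n `^ eps) * n `^ (5 / 4) +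
    8 * 16 * Num.sqrt (4 * E) * (2 * c * n `^ eps) * n `^ (5 / 4))) * t1 =
  16 * b * c ^+ 3 * (2 * b + 8 * 16 * Num.sqrt (4 * E)) *
   (n `^ eps * (n `^ eps * (n `^ eps * (n `^ (5 / 4) * t1)))) by ring.
rewrite ler_wpM2l // mulr_ge0 //; first by rewrite !mulr_ge0 // exprn_ge0.
by rewrite addr_ge0 // mulr_ge0.
Qed.

Lemma total_error_le :
  total_error tau E B t1 h B3 N first_error <=
  error_const * (n `^ (- 2^-1) + tau `^ sig).
Proof.
have c0 : 0 <= c by exact: le_trans c1.
have := early_error_le; have := late_error_le; have := middle_error_le.
have := first_error_le; rewrite /total_error /error_const.
have T0 : 0 <= tau `^ sig by exact: powR_ge0.
have S0 : 0 <= n `^ (- 2^-1) by exact: powR_ge0.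
have a1 : 0 <= 3 * (4 * c / nu + 2 / nu + Num.sqrt (4 * E) / nu ^+ 2).
  by rewrite mulr_ge0 // !addr_ge0 // divr_ge0 ?exprn_ge0 ?mulr_ge0 ?sqrtr_ge0 // ltW.
have a2 : 0 <= 8 * Num.sqrt B3 by rewrite mulr_ge0 ?sqrtr_ge0.
have a3 : 0 <= 3 * 16 * 16 * b * c ^+ 2 * Num.sqrt B3.
  by rewrite !mulr_ge0 ?sqrtr_ge0 ?exprn_ge0.
have a4 : 0 <= 16 * b * c ^+ 3 * (2 * b + 8 * 16 * Num.sqrt (4 * E)).
  by rewrite mulr_ge0 // ?addr_ge0 // !mulr_ge0 ?sqrtr_ge0 ?exprn_ge0.
move: a1 a2 a3 a4 T0 S0.
move: (4 * c / nu + 2 / nu + _) (8 * _) (3 * 16 * 16 * _ * _ * _) (16 * _ * _ * _).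
move=> x1 x2 x3 x4; move: (tau `^ _) (n `^ (- 2^-1)) => T S a1 a2 a3 a4 T0 S0.
move: (_ * t1) (_ * (4 / _)) (_ * (2 * Num.sqrt tau)) first_error => y1 y2 y3 y4.
move=> k1 k2 k3 k4.
have := mulr_ge0 a1 S0; have := mulr_ge0 a2 S0.
have := mulr_ge0 a3 T0; have := mulr_ge0 a4 T0; lra.
Qed.

Lemma error_const_ge0 : 0 <= error_const.
Proof.
have c0 : 0 <= c by exact: le_trans c1.
rewrite /error_const !addr_ge0 // ?mulr_ge0 ?addr_ge0 ?divr_ge0 ?exprn_ge0
  ?mulr_ge0 ?sqrtr_ge0 ?(ltW nu0) ?exprn_ge0 //.
Qed.

End ErrorBound.

(** * Uniform bound when the datum is at most tau^(-eps) *)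

Section SupBound.
Variables (R : realType) (nu E K eps sig : R).
Hypotheses (nu0 : 0 < nu) (E0 : 0 <= E) (K1 : 1 <= K).
Hypotheses (eps0 : 0 < eps) (eps1 : 32 * eps <= 1).
Hypotheses (sig0 : 0 < sig) (sig1 : sig + 3 * eps <= 2^-1).

Lemma lam_powR2 : exists2 c : R, 1 <= c & forall N, (0 < N)%N ->
  lam R N <= 2 * c * N%:R `^ eps /\ lam R (N + N) <= 2 * c * N%:R `^ eps.
Proof.
have [c c1 hc] := lam_powR eps0; have c0 : 0 <= c by exact: le_trans c1.
exists c => // N N0.
have x0 : 0 <= c * N%:R `^ eps by rewrite mulr_ge0 ?powR_ge0.
split; first by have := hc N N0; move: x0; lra.
have N20 : (0 < N + N)%N by rewrite addn_gt0 N0.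
apply: le_trans (hc _ N20) _.
have -> : (N + N)%:R = 2 * N%:R :> R by rewrite natrD; ring.
rewrite powRM ?ler0n // mulrA [2 * c]mulrC ler_wpM2r ?powR_ge0 // ler_wpM2l //.
rewrite -{2}(powRr1 (ler0n R 2)); apply: ler_powR; first by rewrite ler1n.
by move: eps1; lra.
Qed.

(** For bounded [N] the induction closes without any error estimate: sup bounds on earlier iterates
    keep the energy below 4E, and the energy bounds the sup norm through the 2N + 1 coefficients. *)
Lemma small_N_sup tau N p0 Z : 0 < tau -> real_trig N p0 -> nrm2 p0 <= E ->
  N.*2.+1%:R * (4 * E) <= Z -> tau * Z <= nu ^+ 2 / 2 ->
  forall k, sup_le (iter k (step nu tau N) p0) (Num.sqrt Z).
Proof.
move=> tau0 rp pE hZ htau; elim/ltn_ind => k ih.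
have Z0 : 0 <= Z by apply: le_trans hZ; rewrite mulr_ge0 ?ler0n // mulr_ge0.
have hB : tau * Num.sqrt Z ^+ 2 <= nu ^+ 2 / 2 by rewrite sqr_sqrtr.
have [h _] := energy_iter_decay nu0 tau0 rp pE hB ih.
have rk : real_trig N (iter k (step nu tau N) p0).
  by elim: (k) => [//|j hj]; rewrite iterS; exact: real_step.
have [sk _] := rk.
apply: sup_le_trans (sup_le_nrm2 sk); rewrite ler_sqrt //.
by apply: le_trans hZ; rewrite ler_wpM2l ?ler0n // h.
Qed.

(* Errors larger than [1/2] do not close the bootstrap; for small [tau] they only
   occur for boundedly many [N], where the energy controls the sup norm. *)
Lemma scheme_sup_bound : exists tau0 C, [/\ 0 < tau0, 0 < C &
  forall tau N p0 U, 0 < tau -> tau < tau0 -> (0 < N)%N ->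
  real_trig N p0 -> nrm2 p0 <= E -> sup_le p0 U ->
  U <= K * lam R (N + N) -> U <= tau `^ (- eps) ->
  forall k, sup_le (iter k (step nu tau N) p0)
    (U + C * (N%:R `^ (- 2^-1) + tau `^ sig))].
Proof.
have nu2 : 0 < nu ^+ 2 by rewrite exprn_gt0.
have KE0 : 0 <= 4 * E / nu ^+ 2 by rewrite divr_ge0 ?mulr_ge0 // ltW.
have sc0 s : 0 <= smoothing_const nu s.
  by rewrite /smoothing_const divr_ge0 ?exprn_ge0 // mulr_ge0 // ltW.
have [B3 B30 hB3] := smoothing nu0 KE0 sc0 2.
have [c c1 hc] := lam_powR2.
have b0 : 0 <= 2 * K by move: K1; lra.
set X := error_const nu E B3 (2 * K) c.
have X0 : 0 <= X by exact: error_const_ge0.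
(* When X N^(-1/2) > 1/2 one has N <= 4 X^2, so (2N + 1) 4E <= 3N * 4E <= Z. *)
set Z := 48 * X ^+ 2 * E.
have Z0 : 0 <= Z by rewrite !mulr_ge0 // exprn_ge0.
have [d1 d10 hd1] := @powR_small R (1 - 2 * eps) (nu ^+ 2 / 8)
  ltac:(move: eps1; lra) ltac:(by rewrite divr_gt0).
have X1 : 0 < (2 * (X + 1))^-1 by rewrite invr_gt0; move: X0; lra.
have [d2 d20 hd2] := powR_small sig0 X1.
have d30 : 0 < nu ^+ 2 / (2 * (Z + 1)) by rewrite divr_gt0 //; move: Z0; lra.
exists (Num.min (Num.min 1 d1) (Num.min d2 (nu ^+ 2 / (2 * (Z + 1))))).
have s0 : 0 <= Num.sqrt Z by exact: sqrtr_ge0.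
(* [X] serves large [N]. For small [N] one has 1 < 2 X N^(-1/2), which turns the constant bound sqrt
   Z into a multiple of N^(-1/2). The 1 ensures positivity. *)
exists (X + 2 * X * Num.sqrt Z + 1); split.
- by rewrite !lt_min ltr01 d10 d20 d30.
- by rewrite ltr_wpDl // addr_ge0 // mulr_ge0 // mulr_ge0.
move=> tau N p0 U tau0; rewrite !lt_min => /andP[/andP[t1 td1] /andP[td2 td3]].
move=> N0 rp pE pU UK Ut k; have [l1 l2] := hc N N0.
have {}hd1 := hd1 _ tau0 td1; have {}hd2 := hd2 _ tau0 td2.
have n0 : 0 < N%:R :> R by rewrite ltr0n.
have U0 : 0 <= U := sup_le_ge0 pU.
set S := N%:R `^ (- 2^-1); set T := tau `^ sig.
have S0 : 0 <= S by exact: powR_ge0.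
have T0 : 0 <= T by exact: powR_ge0.
have T1 : 1 <= tau `^ (- eps).
  rewrite -[leLHS](powRr0 tau); apply: powR_antimono => //; first exact: ltW.
  by move: eps0; lra.
case: (leP (X * S) 2^-1) => hS; last first.
  have hn : Num.sqrt N%:R <= 2 * X.
    have sn : 0 < Num.sqrt (N%:R : R) by rewrite sqrtr_gt0.
    have SE : S = (Num.sqrt N%:R)^-1 by rewrite /S powRN powR12_sqrt // ltW.
    move: hS; rewrite SE; rewrite ltr_pdivlMr // => h; move: h; lra.
  have hZ : N.*2.+1%:R * (4 * E) <= Z.
    have n1 : N.*2.+1%:R <= 3 * N%:R :> R.
      have e3 : 3 * N%:R = (3 * N)%N%:R :> R by rewrite natrM.
      by rewrite e3 ler_nat; clear -N0; lia.
    have n2 : N%:R <= 4 * X ^+ 2 :> R.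
      rewrite -(sqr_sqrtr (ltW n0)).
      have -> : 4 * X ^+ 2 = (2 * X) ^+ 2 by ring.
      by rewrite ler_sqr ?nnegrE ?sqrtr_ge0 // mulr_ge0.
    have -> : Z = (12 * X ^+ 2) * (4 * E) by rewrite /Z; ring.
    by rewrite ler_wpM2r ?mulr_ge0 //; move: n1 n2; lra.
  have htau : tau * Z <= nu ^+ 2 / 2.
    have Z1 : 0 < 2 * (Z + 1) by move: Z0; lra.
    rewrite ltr_pdivlMr // in td3.
    by have := tau0; move: td3; lra.
  apply: sup_le_trans (small_N_sup tau0 rp pE hZ htau k).
  have h1 := ler_wpM2r s0 (ltW hS).
  have h2 : 0 <= X * (S + T) by rewrite mulr_ge0 // addr_ge0.
  have h3 : 0 <= 2 * X * Num.sqrt Z * T by rewrite !mulr_ge0.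
  by move: U0 S0 T0 h1 h2 h3; lra.
(* The bootstrap runs with [B = U + 1]: each of the errors [X * S] and [X * T] is at most 1/2. *)
have BK : U + 1 <= 2 * K * (2 * c * N%:R `^ eps).
  have h1 : K * lam R (N + N) <= K * (2 * c * N%:R `^ eps).
    by rewrite ler_wpM2l // (le_trans ler01).
  have h2 : 1 <= K * lam R (N + N).
    by rewrite -[leLHS]mulr1 ler_pM // lam_ge1.
  by move: UK h1 h2; lra.
have Bt : U + 1 <= 2 * tau `^ (- eps) by move: Ut T1; lra.
have B0 : 0 <= U + 1 by rewrite addr_ge0.
have err := total_error_le E B3 nu0 tau0 (ltW t1) N0 B0 b0 c1 eps0 eps1 sig1 l1 l2
  BK Bt.
have hXT : X * T <= 2^-1.
  have h := ler_wpM2l X0 hd2.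
  by apply: le_trans h _; rewrite ler_pdivrMr; move: X0; lra.
have errB : U + total_error tau E (U + 1) (N%:R `^ (- (15 / 8)))
    (N%:R `^ (- (5 / 4))) B3 N (first_error nu tau E (U + 1) N) <= U + 1.
  rewrite lerD2l; apply: le_trans err _; rewrite -/X -/S -/T.
  by move: hS hXT; lra.
have hB : tau * (U + 1) ^+ 2 <= nu ^+ 2 / 2.
  have h : (U + 1) ^+ 2 <= (2 * tau `^ (- eps)) ^+ 2.
    by rewrite ler_sqr ?nnegrE // (le_trans B0).
  apply: le_trans (ler_wpM2l (ltW tau0) h) _.
  have -> : tau * (2 * tau `^ (- eps)) ^+ 2 = 4 * tau `^ (1 - 2 * eps).
    have -> : tau * (2 * tau `^ (- eps)) ^+ 2 =
      4 * (tau * (tau `^ (- eps) * tau `^ (- eps))) by ring.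
    rewrite -{1}(powRr1 (ltW tau0)) !powR_mul //.
    by congr (_ * _ `^ _); ring.
  by move: hd1; lra.
have c0P : tau / 2 * (lam R (N + N) * ((nu * Num.sqrt tau)^-1 * (U + 1) ^+ 2))
    <= first_error nu tau E (U + 1) N \/
  tau / 2 * ((nu * Num.sqrt tau)^-1 * (U + 1) ^+ 2 +
    (tau * nu ^+ 2)^-1 * ((Num.sqrt N%:R)^-1 * ((U + 1) * Num.sqrt (4 * E))))
    <= first_error nu tau E (U + 1) N.
  by rewrite /first_error; case: ifP => _; [left | right].
have hk := iterates_sup nu0 tau0 N0 (powR_gt0 _ n0) (powR_gt0 _ n0)
  rp pE pU hB (hB3 _) c0P errB B0 k.
apply: (sup_le_trans _ hk).
rewrite lerD2l; apply: le_trans err _; rewrite -/X -/S -/T.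
by rewrite ler_wpM2r ?addr_ge0 // -addrA lerDl addr_ge0 // mulr_ge0 // mulr_ge0.
Qed.

End SupBound.

(** * Data whose projection is large *)

Section LargeData.
Variables (R : realType) (nu : R).
Hypothesis nu0 : 0 < nu.

Definition first_step_const (m X : R) : R :=
  m + X * m / nu ^+ 2 + m ^+ 2 / 2 * (nu^-1 + (nu ^+ 2)^-1) + m ^+ 2 / nu ^+ 2.

(** The projected datum itself is bounded only through its L^2 norm, with a loss of order N^(1/2);
    the tail of the flux gains N^(-1/2), which compensates. The resolvent of the datum is bounded
    because 1/tau is at most a multiple of [N]. *)
Lemma first_step_sup tau N q m X : 0 < tau -> tau <= 1 -> (0 < N)%N -> 0 <= X ->
  real_trig (N + N) q -> sup_le q m -> tau^-1 <= X * N%:R ->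
  sup_le (step nu tau N (proj N q)) (first_step_const m X).
Proof.
move=> tau0 tau1 N0 X0 rq qm hX; have m0 := sup_le_ge0 qm.
have rp := real_proj rq; have [sp _] := rp.
have n0 : 0 < N%:R :> R by rewrite ltr0n.
have pE : nrm2 (proj N q) <= m ^+ 2.
  exact: le_trans (nrm2_proj_le _ _) (nrm2_le_sup qm).
set Q := nrm2 (proj N q) in pE *; have Q0 : 0 <= Q by exact: nrm2_ge0.
have h := step_sup_large_N nu0 tau0 N0 rp (sup_le_nrm2 sp)
  (resolvent_proj_sup nu0 tau0 N0 rq qm) (resolvent_sqr_sup nu0 tau0 rp).
apply: (sup_le_trans _ h); rewrite -/Q.
have s0 : 0 < Num.sqrt tau by rewrite sqrtr_gt0.
have s1 : Num.sqrt tau <= 1 by rewrite -sqrtr1 ler_sqrt.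
have r0 : 0 < Num.sqrt (N%:R : R) by rewrite sqrtr_gt0.
have r1 : (Num.sqrt (N%:R : R))^-1 <= 1.
  by rewrite invf_le1 // -[leLHS]sqrtr1 ler_sqrt ?ler0n // ler1n.
have nu2 : 0 < nu ^+ 2 by rewrite exprn_gt0.
have h1 : (tau * nu ^+ 2)^-1 * (N%:R^-1 * ((Num.sqrt N%:R)^-1 * m)) <= X * m / nu ^+ 2.
  have -> : (tau * nu ^+ 2)^-1 * (N%:R^-1 * ((Num.sqrt N%:R)^-1 * m)) =
    (nu ^+ 2)^-1 * (tau^-1 / N%:R * ((Num.sqrt N%:R)^-1 * m)).
    by rewrite invfM; ring.
  rewrite [leRHS]mulrC ler_wpM2l ?invr_ge0 ?(ltW nu2) //.
  apply: ler_pM.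
  - by rewrite divr_ge0 ?invr_ge0 ?ler0n // ltW.
  - by rewrite mulr_ge0 // invr_ge0 ltW.
  - by rewrite ler_pdivrMr.
  - by rewrite -[leRHS]mul1r ler_wpM2r.
have h2 : tau / 2 * ((nu * Num.sqrt tau)^-1 * (Q * (1 + (nu * Num.sqrt tau)^-1)))
    <= m ^+ 2 / 2 * (nu^-1 + (nu ^+ 2)^-1).
  have -> : tau / 2 * ((nu * Num.sqrt tau)^-1 * (Q * (1 + (nu * Num.sqrt tau)^-1)))
    = Q / 2 * (nu^-1 * Num.sqrt tau + (nu ^+ 2)^-1).
    rewrite -{1}(sqr_sqrtr (ltW tau0)).
    by field; rewrite !gt_eqF.
  apply: ler_pM.
  - by rewrite divr_ge0.
  - by rewrite addr_ge0 ?mulr_ge0 ?invr_ge0 // ltW.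
  - by rewrite ler_wpM2r // invr_ge0.
  - by rewrite lerD2r ler_piMr // invr_ge0 ltW.
have h3 : tau / 2 * ((tau * nu ^+ 2)^-1 * ((Num.sqrt N%:R)^-1 *
    (Num.sqrt (N.*2.+1%:R * Q) * Num.sqrt Q))) <= m ^+ 2 / nu ^+ 2.
  have hs : Num.sqrt (N.*2.+1%:R : R) <= 2 * Num.sqrt N%:R.
    have -> : 2 * Num.sqrt (N%:R : R) = Num.sqrt (2 ^+ 2 * N%:R).
      by rewrite sqrtrM ?sqr_ge0 // sqrtr_sqr ger0_norm.
    rewrite ler_sqrt ?mulr_ge0 ?exprn_ge0 ?ler0n // -natr1 -mul2n natrM.
    have : 1 <= N%:R :> R by rewrite ler1n.
    lra.
  have -> : tau / 2 * ((tau * nu ^+ 2)^-1 * ((Num.sqrt N%:R)^-1 *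
    (Num.sqrt (N.*2.+1%:R * Q) * Num.sqrt Q))) =
    (Num.sqrt N.*2.+1%:R / (2 * Num.sqrt N%:R)) * (Num.sqrt Q ^+ 2 / nu ^+ 2).
    rewrite sqrtrM ?ler0n //.
    by field; rewrite !gt_eqF.
  rewrite sqr_sqrtr // -[leRHS]mul1r; apply: ler_pM.
  - by rewrite divr_ge0 ?sqrtr_ge0 // mulr_ge0 // ltW.
  - by rewrite divr_ge0 // ltW.
  - by rewrite ler_pdivrMr ?mul1r ?mulr_gt0.
  - by rewrite ler_wpM2r // invr_ge0 ltW.
rewrite /first_step_const mulrDr addrA; apply: lerD h3.
by apply: lerD h2; rewrite lerD2l.
Qed.

Variables (S eps sig : R).
Hypotheses (S0 : 0 <= S) (eps0 : 0 < eps) (eps1 : 32 * eps <= 1).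
Hypotheses (sig0 : 0 < sig) (sig1 : sig + 3 * eps <= 2^-1).

(* [Pi_N f] is bounded only up to a factor [log N]. If its norm exceeds
   [tau^(-eps)], then [N] is at least of order [1/tau], and one implicit step
   already brings the norm down to a constant. *)
Lemma scheme_sup_bound_proj : exists tau0 C, [/\ 0 < tau0, 0 < C &
  forall tau N q U, 0 < tau -> tau < tau0 -> (0 < N)%N ->
  real_trig (N + N) q -> sup_le q S -> sup_le (proj N q) U ->
  forall k, sup_le (iter k (step nu tau N) (proj N q))
    (U + C * (N%:R `^ (- 2^-1) + tau `^ sig))].
Proof.
pose K := S + 1.
have K1 : 1 <= K by rewrite lerDr.
have K0 : 0 <= K by exact: le_trans K1.
have [tA [CA [tA0 CA0 hA]]] :=
  scheme_sup_bound nu0 (exprn_ge0 2 S0) K1 eps0 eps1 sig0 sig1.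
have [c c1 hc] := lam_powR2 eps0 eps1.
have c0 : 0 <= c by exact: le_trans c1.
(* If tau^(-eps) < K * (2c) * N^eps, raising to the power 1/eps gives 1/tau <= X * N. *)
pose X := (K * (2 * c)) `^ eps^-1.
have X0 : 0 <= X by exact: powR_ge0.
pose L := first_step_const S X.
have L0 : 0 <= L.
  rewrite /L /first_step_const; have := ltW nu0 => nuge0.
  by rewrite !addr_ge0 ?mulr_ge0 ?invr_ge0 ?addr_ge0 ?exprn_ge0 ?invr_ge0 ?exprn_ge0.
have L1 : 1 <= L + 1 by rewrite lerDr.
have [tB [CB [tB0 CB0 hB]]] :=
  scheme_sup_bound nu0 (exprn_ge0 2 L0) L1 eps0 eps1 sig0 sig1.
(* For such small [tau], L + 2 CB <= tau^(-eps). In the large-data case this is below [U], so all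
   iterates after the first step lie below the initial bound. *)
have Y0 : 0 < (L + 2 * CB)^-1 by rewrite invr_gt0; move: L0 CB0; lra.
have [d d0 hd] := powR_small eps0 Y0.
exists (Num.min (Num.min tA tB) (Num.min 1 d)), CA; split=> //.
  by rewrite !lt_min tA0 tB0 ltr01.
move=> tau N q U tau0; rewrite !lt_min => /andP[/andP[tauA tauB] /andP[tau1 taud]].
move=> N0 rq qS pU k; have rp := real_proj rq.
have [_ l2] := hc N N0; have {}hd := hd _ tau0 taud.
have U0 := sup_le_ge0 pU.
have n0 : 0 < N%:R :> R by rewrite ltr0n.
have n1 : 1 <= N%:R :> R by rewrite ler1n.
have lam1 : 1 <= lam R (N + N) by exact: lam_ge1.
have Sn0 : 0 <= N%:R `^ (- 2^-1) :> R by exact: powR_ge0.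
have T0 : 0 <= tau `^ sig by exact: powR_ge0.
have pE : nrm2 (proj N q) <= S ^+ 2.
  exact: le_trans (nrm2_proj_le _ _) (nrm2_le_sup qS).
have pK : sup_le (proj N q) (K * lam R (N + N)).
  apply: sup_le_proj; case: rq => sq _.
  apply: (sup_le_trans _ (lowpass_sup_le _ sq qS)).
  by rewrite mulrC ler_wpM2r ?(le_trans ler01) // lerDl.
(* [U] is an arbitrary bound; the minimum also satisfies the logarithmic bound that the case
   distinction relies on. *)
pose V := Num.min U (K * lam R (N + N)).
have pV : sup_le (proj N q) V by rewrite /V; case: leP.
have VU : V <= U by rewrite ge_min lexx.
have VK : V <= K * lam R (N + N) by rewrite ge_min lexx orbT.
case: (leP V (tau `^ (- eps))) => hV.
  apply: sup_le_trans (hA tau N _ V tau0 tauA N0 rp pE pV VK hV k).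
  by rewrite lerD2r.
case: k => [|k].
  apply: sup_le_trans pU; rewrite lerDl mulr_ge0 ?addr_ge0 // ltW //.
rewrite iterSr.
have hX : tau^-1 <= X * N%:R.
  have e1 : tau^-1 = (tau `^ (- eps)) `^ eps^-1.
    by rewrite -powRrM mulNr mulfV ?gt_eqF // powRN powRr1 // ltW.
  have e2 : X * N%:R = (K * (2 * c) * N%:R `^ eps) `^ eps^-1.
    rewrite powRM ?powR_ge0 ?mulr_ge0 // -powRrM mulfV ?gt_eqF // powRr1 ?ler0n //.
  rewrite e1 e2; apply: ge0_ler_powR.
  - by rewrite invr_ge0 ltW.
  - exact: powR_ge0.
  - by rewrite nnegrE mulr_ge0 ?powR_ge0 // mulr_ge0 // mulr_ge0.
  - apply: le_trans (ltW hV) _; apply: le_trans VK _.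
    by rewrite -mulrA ler_wpM2l.
have sL : sup_le (step nu tau N (proj N q)) L.
  by apply: first_step_sup => //; exact: ltW.
have Ttau : L + 2 * CB <= tau `^ (- eps).
  rewrite powRN -[leLHS]invrK lef_pV2 ?posrE ?powR_gt0 //.
have LT : L <= tau `^ (- eps) by move: Ttau CB0; lra.
have LK : L <= (L + 1) * lam R (N + N).
  by apply: (@le_trans _ _ ((L + 1) * 1)); [lra | rewrite ler_wpM2l // addr_ge0].
have rs := real_step nu tau rp.
apply: sup_le_trans (hB tau N _ L tau0 tauB N0 rs (nrm2_le_sup sL) sL LK LT k).
have Sn1 : N%:R `^ (- 2^-1) <= 1 :> R.
  by rewrite -[leRHS](powRr0 (N%:R : R)); apply: ler_powR => //; rewrite oppr_le0 invr_ge0.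
have T1 : tau `^ sig <= 1.
  by rewrite -[leRHS](powRr0 tau); apply: powR_antimono; rewrite ?(ltW tau1) ?(ltW sig0).
have h1 : CB * (N%:R `^ (- 2^-1) + tau `^ sig) <= CB * 2.
  by rewrite ler_wpM2l ?(ltW CB0) //; move: Sn1 T1; lra.
have h2 : 0 <= CA * (N%:R `^ (- 2^-1) + tau `^ sig).
  by rewrite mulr_ge0 ?(ltW CA0) // addr_ge0.
by move: h1 h2 Ttau hV VU; lra.
Qed.

End LargeData.

Theorem theorem1p10 (R : realType) (nu : R) (hnu : 0 < nu) (M : R) :
  exists tau0 alpha1 alpha2 : R,
    [/\ 0 < tau0, 0 < alpha1, 0 < alpha2
      & forall (f : R -> R), in_Linfty f -> Linfty_norm f = M%:E ->
        forall (tau : R) (N : nat) (u : nat -> R -> R),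
          0 < tau -> tau < tau0 -> (2 <= N)%N ->
          scheme_solution nu tau N f u ->
          (ereal_sup [set Linfty_norm (u n) | n in [set: nat]] <=
           Linfty_norm (u 0%N)
           + (alpha1 * N%:R `^ (- 2^-1) + alpha2 * tau `^ (49%:R / 100%:R))%:E)%E].
Proof.
(* The factor 2 is the L^1 bound of the kernel. The absolute value is there because [M] is fixed
   before any [f], so its sign is unknown at this point. *)
pose S := 2 * `|M|; have S0 : 0 <= S by rewrite mulr_ge0.
(* With this choice 49/100 + 3 eps is exactly 1/2. *)
have eps0 : 0 < (300%:R)^-1 :> R by rewrite invr_gt0 ltr0n.
have eps1 : 32 * (300%:R)^-1 <= 1 :> R by lra.
have sig0 : 0 < 49%:R / 100%:R :> R by rewrite divr_gt0 ?ltr0n.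
have sig1 : 49%:R / 100%:R + 3 * (300%:R)^-1 <= 2^-1 :> R by lra.
have [tau0 [C [tau00 C0 hC]]] := scheme_sup_bound_proj hnu S0 eps0 eps1 sig0 sig1.
exists tau0, C, C; split=> // f fL fM tau N u t0 t1 N2 sol.
have M0 : 0 <= M by rewrite -lee_fin -fM Linfty_norm_ge0.
have N0 : (0 < N)%N by exact: leq_trans N2.
have [q [rq qS qf]] := fourier_majorant N0 fL fM.
have [rp hu] := scheme_solution_trig hnu t0 sol.
rewrite -qf in rp hu.
rewrite -(ger0_norm M0) -/S in qS.
have u0S x : `|u 0%N x| <= lam R (N + N) * S.
  rewrite hu; apply: rtrig_norm_sup; apply: sup_le_proj.
  by apply: lowpass_sup_le qS; case: rq.
have u0fin : Linfty_norm (u 0%N) \is a fin_num.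
  rewrite ge0_fin_numE ?Linfty_norm_ge0 //.
  by apply: le_lt_trans (Linfty_norm_le u0S) _; exact: ltry.
(* [U] is the exact essential norm of the initial iterate; by continuity it bounds that iterate at
   every point, so no constant is lost. *)
pose U := fine (Linfty_norm (u 0%N)).
have uE : Linfty_norm (u 0%N) = U%:E by rewrite fineK.
have u0U x : `|u 0%N x| <= U.
  apply: continuous_le_Linfty_norm; last by rewrite uE.
  - by rewrite hu; exact: rtrig_periodic.
  - by rewrite hu; exact: rtrig_continuous.
have pU : sup_le (proj N q) U.
  move=> x; rewrite -(normc_trig N) -real_trigC // normc_real.
  by have := u0U x; rewrite hu.
rewrite uE -EFinD; apply: ub_ereal_sup => _ [n _ <-].
apply: Linfty_norm_le => x; rewrite hu; apply: rtrig_norm_sup.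
by rewrite -mulrDr; exact: hC.
Qed.
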